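(* Let $k$ be a field of characteristic $0$ and let $p(t)$ be the Hilbert polynomial of some closed subscheme of $\mathbb{P}^n=\mathbb{P}^n_k$. The Hilbert functor $\underline{\mathbf{Hilb}}^n_{p(t)}$ is the functor of points of a closed subscheme $\mathbf{Hilb}^n_{p(t)}$ of the Grassmannian $\mathbf{Gr}_p^N$.
   Context: The Gotzmann number $r$ of $p(t)$ is the number of summands in the unique expression $p(t)=\sum_{i=1}^{r}\binom{t+a_i-i+1}{a_i}$ with $a_1\ge\dots\ge a_r\ge 0$. Put $N=\binom{n+r}{n}$ and $p=p(r)$. The Hilbert functor $\underline{\mathbf{Hilb}}^n_{p(t)}$ sends a noetherian $k$-algebra $A$ to the set of closed subschemes $X\subset\mathbb{P}^n_A$ flat over $\operatorname{Spec}A$ whose fibers have Hilbert polynomial $p(t)$; a morphism $A\to B$ is sent to $X\mapsto X\times_{\operatorname{Spec}A}\operatorname{Spec}B$. The Grassmann functor $\underline{\mathbf{Gr}}_p^N$ sends $A$ to the set of submodules $L\subseteq A^N$ such that $A^N/L$ is locally free of rank $p$; it is represented by the Grassmannian $\mathbf{Gr}_p^N$. Identifying the standard basis of $A^N$ with the monomials of degree $r$ in $x_0,\dots,x_n$, i.e. $A^N\simeq H^0(\mathcal{O}_{\mathbb{P}^n_A}(r))$, the Hilbert functor is compared with the Grassmann functor via the natural transformation $\mathscr{H}:\underline{\mathbf{Hilb}}^n_{p(t)}\to\underline{\mathbf{Gr}}_p^N$, $X\mapsto H^0(\mathcal{I}_X(r))$ (equivalently, $X\mapsto$ the quotient $H^0(\mathcal{O}_{\mathbb{P}^n_A}(r))\to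 H^0(\mathcal{O}_X(r))$). *)

(* Defs.v *)
From HB Require Import structures.
From mathcomp Require Import all_boot all_order all_algebra.
From mathcomp Require Export mpoly.

Set Implicit Arguments.
Unset Strict Implicit.
Unset Printing Implicit Defensive.

Import GRing.Theory.
Local Open Scope ring_scope.

(* Ideals, submodules and subschemes are Prop-valued predicates; two of them  *)
(* are identified when they have the same elements.                           *)
Definition same_elts (T : Type) (U V : T -> Prop) : Prop :=
  forall x, U x <-> V x.

Definition is_ideal (R : comNzRingType) (I : R -> Prop) : Prop :=
  [/\ I 0, forall x y, I x -> I y -> I (x + y) & forall a x, I x -> I (a * x)].

Definition ideal_gen (R : comNzRingType) (S : R -> Prop) (x : R) : Prop :=
  forall I : R -> Prop, is_ideal I -> (forall y, S y -> I y) -> I x.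

Definition is_prime_ideal (R : comNzRingType) (P : R -> Prop) : Prop :=
  [/\ is_ideal P, ~ P 1 & forall x y, P (x * y) -> P x \/ P y].

Definition noetherian (R : comNzRingType) : Prop :=
  forall I : R -> Prop, is_ideal I ->
  exists s : seq R, same_elts I (ideal_gen (fun x => x \in s)).

Definition is_submod (R : comNzRingType) (V : lmodType R) (W : V -> Prop) :
    Prop :=
  [/\ W 0, forall x y, W x -> W y -> W (x + y) & forall a x, W x -> W (a *: x)].

Definition submod_gen (R : comNzRingType) (V : lmodType R) (S : V -> Prop)
    (x : V) : Prop :=
  forall W : V -> Prop, is_submod W -> (forall y, S y -> W y) -> W x.

(* For a submodule W of V, the finite sequence s of pairs (m, v) represents   *)
(* the element \sum m (x) [v] of M (x) (V / W). By the universal property of  *)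
(* the tensor product this element is 0 iff every bilinear map on M x (V / W) *)
(* (that is, every bilinear map on M x V that vanishes on M x W) kills it.    *)
Definition tensor_zero (R : comNzRingType) (M V : lmodType R) (W : V -> Prop)
    (s : seq (M * V)) : Prop :=
  forall (T : lmodType R) (beta : M -> V -> T),
    (forall v, linear (beta^~ v)) -> (forall m, linear (beta m)) ->
    (forall m w, W w -> beta m w = 0) ->
  \sum_(x <- s) beta x.1 x.2 = 0.

(* The R-module V / W is flat: M' (x) (V / W) -> M (x) (V / W) is injective   *)
(* for every injective R-linear map phi : M' -> M.                            *)
Definition flat_quotient (R : comNzRingType) (V : lmodType R) (W : V -> Prop) :
    Prop :=
  forall (M' M : lmodType R) (phi : {linear M' -> M}), injective phi ->
  forall s : seq (M' * V),
    tensor_zero W [seq (phi x.1, x.2) | x <- s] -> tensor_zero W s.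

(* Closed subschemes of P^n_A. The i-th standard affine chart U_i = D_+(x_i)  *)
(* has coordinate ring A[x_j / x_i | j != i], which is encoded as             *)
(* {mpoly A[n]}, the variable 'X_j standing for x_(lift i j) / x_i.           *)
(* For f homogeneous of degree d, dehomog i f is f / x_i ^ d.                 *)
Definition dehomog (n : nat) (A : comNzRingType) (i : 'I_n.+1)
    (f : {mpoly A[n.+1]}) : {mpoly A[n]} :=
  mmap (@mpolyC n A) (fun j => if unlift i j is Some l then 'X_l else 1) f.

(* A closed subscheme of P^n_A, i.e. a quasi-coherent sheaf of ideals, is a   *)
(* family of ideals X i of the rings of the charts U_i such that X i and X j  *)
(* extend to the same ideal of the ring of U_i :&: U_j. Up to a unit, every   *)
(* element of the latter ring is f / x_i ^ d with f homogeneous of degree d   *)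
(* (equivalently f / x_j ^ d, as x_i / x_j is a unit), and f / x_i ^ d is in  *)
(* the extension of X i iff (x_j / x_i) ^ m * (f / x_i ^ d) is in X i for     *)
(* some m.                                                                    *)
Definition chart_family (n : nat) (A : comNzRingType) : Type :=
  'I_n.+1 -> {mpoly A[n]} -> Prop.

Definition closed_subscheme (n : nat) (A : comNzRingType)
    (X : chart_family n A) : Prop :=
  (forall i, is_ideal (X i)) /\
  (forall (i j : 'I_n.+1) (d : nat) (f : {mpoly A[n.+1]}), f \is d.-homog ->
     (exists m, X i (dehomog i 'X_j ^+ m * dehomog i f)) <->
     (exists m, X j (dehomog j 'X_i ^+ m * dehomog j f))).

(* X x_(Spec A) Spec B, for the morphism Spec B -> Spec A given by g.         *)
Definition base_change (n : nat) (A B : comNzRingType) (g : {rmorphism A -> B})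
    (X : chart_family n A) : chart_family n B :=
  fun i => ideal_gen (fun f => exists2 h, X i h & f = map_mpoly g h).

(* H^0(I_X(d)), as a submodule of H^0(O(d)) = A[x_0, .., x_n]_d.              *)
Definition H0_ideal (n : nat) (A : comNzRingType) (X : chart_family n A)
    (d : nat) (f : {mpoly A[n.+1]}) : Prop :=
  f \is d.-homog /\ forall i, X i (dehomog i f).

(* P is the Hilbert polynomial of X over a field K: for all large t, P(t) is  *)
(* the dimension of the degree t part K[x]_t / H^0(I_X(t)) of the homogeneous *)
(* coordinate ring of X.                                                      *)
Definition hilbert_polynomial (n : nat) (K : fieldType) (X : chart_family n K)
    (P : {poly rat}) : Prop :=
  exists t0 : nat, forall t : nat, (t0 <= t)%N ->
  exists2 d : nat, P.[t%:R] = d%:R &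
  exists2 b : 'I_d -> {mpoly K[n.+1]}, (forall j, b j \is t.-homog) &
  forall f : {mpoly K[n.+1]}, f \is t.-homog ->
    exists! c : 'rV[K]_d, H0_ideal X t (f - \sum_j c 0 j *: b j).

(* g : A -> K is the canonical map to the residue field of a point of Spec A, *)
(* namely of the prime ideal ker g: K is the fraction field of the image.     *)
Definition residue_field (A : comNzRingType) (K : fieldType)
    (g : {rmorphism A -> K}) : Prop :=
  forall x : K, exists a b : A, g b != 0 /\ x = g a / g b.

Definition Hilb (n : nat) (P : {poly rat}) (A : comNzRingType)
    (X : chart_family n A) : Prop :=
  [/\ closed_subscheme X,
      forall i, flat_quotient (X i)
    & forall (K : fieldType) (g : {rmorphism A -> K}), residue_field g ->
        hilbert_polynomial (base_change g X) P].

(* The binomial coefficient (t + c choose a), as a polynomial in t.           *)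
Definition binomial_poly (c : rat) (a : nat) : {poly rat} :=
  (a`!%:R)^-1 *: \prod_(j < a) ('X + (c - j%:R)%:P).

(* The index i starts at 0, whence c = a_i - i.                               *)
Definition gotzmann_number (P : {poly rat}) (r : nat) : Prop :=
  exists2 a : r.-tuple nat, sorted geq a &
  P = \sum_(i < r) binomial_poly ((tnth a i)%:R - i%:R) (tnth a i).

(* V / W is locally free of rank p, for V = A^N and a submodule W: each prime *)
(* P has a basic open neighbourhood D(s) on which the rows of some matrix b   *)
(* induce a basis of the localization (A^N / W)_s. Denominators are cleared,  *)
(* so that b can be taken with entries in A.                                  *)
Definition locally_free_quotient (A : comNzRingType) (N p : nat)
    (W : 'rV[A]_N -> Prop) : Prop :=
  forall P : A -> Prop, is_prime_ideal P ->
  exists2 s : A, ~ P s &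
  exists b : 'M[A]_(p, N),
    (forall v, exists (m : nat) (c : 'rV[A]_p), W (s ^+ m *: v - c *m b)) /\
    (forall c : 'rV[A]_p, W (c *m b) -> exists m : nat, s ^+ m *: c = 0).

Definition Grass (N p : nat) (A : comNzRingType) (L : 'rV[A]_N -> Prop) :
    Prop :=
  is_submod L /\ locally_free_quotient p L.

(* The image of L under Gr_p^N(g): the kernel of B^N -> (A^N / L) (x)_A B.    *)
Definition Grass_map (N : nat) (A B : comNzRingType) (g : {rmorphism A -> B})
    (L : 'rV[A]_N -> Prop) : 'rV[B]_N -> Prop :=
  submod_gen (fun w => exists2 v, L v & w = map_mx g v).

(* Standard affine charts of Gr_p^N: U_sigma is the open subscheme where the  *)
(* e_(sigma j), j < p, form a basis of the quotient A^N / L. Its coordinates  *)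
(* are the entries of the N x p matrix C whose rows express the classes of    *)
(* the e_i in this basis; L is then the kernel of v |-> v *m C. (If sigma is  *)
(* not injective, U_sigma is empty.)                                          *)
Definition Grass_chart (N p : nat) (A : comNzRingType) (sigma : 'I_p -> 'I_N)
    (C : 'M[A]_(N, p)) (L : 'rV[A]_N -> Prop) : Prop :=
  rowsub sigma C = 1%:M /\ (forall v, L v <-> v *m C = 0).

(* Closed subschemes of the k-scheme Gr_p^N. The coordinate ring of U_sigma   *)
(* is the quotient of the ring k[C_ij] of polynomials in the entries of C by  *)
(* the relations rowsub sigma C = 1%:M, so a closed subscheme of U_sigma is   *)
(* given by an ideal of equations in k[C_ij].                                 *)
Definition Grass_ideals (k : fieldType) (N p : nat) : Type :=
  ('I_p -> 'I_N) -> {mpoly k[N * p]} -> Prop.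

Definition satisfies (k : fieldType) (N p : nat) (I : {mpoly k[N * p]} -> Prop)
    (A : comAlgType k) (C : 'M[A]_(N, p)) : Prop :=
  forall F, I F -> mmap (fun c : k => c%:A) (fun x => mxvec C 0 x) F = 0.

(* The ideals glue: on U_sigma :&: U_tau, where L has both the coordinates C  *)
(* and D, the ideals of the two charts define the same closed subscheme.      *)
Definition Grass_closed_subscheme (k : fieldType) (N p : nat)
    (Z : Grass_ideals k N p) : Prop :=
  (forall sigma, is_ideal (Z sigma)) /\
  (forall (sigma tau : 'I_p -> 'I_N) (A : comAlgType k)
      (C D : 'M[A]_(N, p)) (L : 'rV[A]_N -> Prop), noetherian A ->
    Grass_chart sigma C L -> Grass_chart tau D L ->
    satisfies (Z sigma) C <-> satisfies (Z tau) D).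

(* The functor of points of Z: the A-point L : Spec A -> Gr_p^N factors       *)
(* through Z iff the equations of Z in U_sigma vanish at the coordinates of   *)
(* every point Spec B -> Spec A -> Gr_p^N that lands in U_sigma.              *)
Definition Grass_points (k : fieldType) (N p : nat) (Z : Grass_ideals k N p)
    (A : comAlgType k) (L : 'rV[A]_N -> Prop) : Prop :=
  Grass p L /\
  forall (B : comAlgType k) (g : {lrmorphism A -> B}), noetherian B ->
  forall (sigma : 'I_p -> 'I_N) (C : 'M[B]_(N, p)),
    Grass_chart sigma C (Grass_map g L) -> satisfies (Z sigma) C.

(* e lists the monomials of degree r in x_0, .., x_n.                         *)
Definition monomial_basis (n r N : nat) (e : 'I_N -> 'X_{1..n.+1}) : Prop :=
  injective e /\ (forall m, mdeg m = r <-> exists i, e i = m).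

(* X |-> H^0(I_X(r)), A^N being identified with A[x_0, .., x_n]_r through e.  *)
Definition Hilb_to_Grass (n r N : nat) (e : 'I_N -> 'X_{1..n.+1})
    (A : comNzRingType) (X : chart_family n A) (v : 'rV[A]_N) : Prop :=
  H0_ideal X r (\sum_i v 0 i *: 'X_[e i]).

(* X |-> H^0(I_X(r)) is an isomorphism of functors on noetherian k-algebras   *)
(* from Hilb^n_P onto the functor of points of Z.                             *)
Definition Hilb_iso_points (k : fieldType) (n : nat) (P : {poly rat})
    (r N p : nat) (e : 'I_N -> 'X_{1..n.+1}) (Z : Grass_ideals k N p) : Prop :=
  (forall A : comAlgType k, noetherian A ->
    [/\ forall X : chart_family n A, Hilb P X ->
          Grass_points Z (Hilb_to_Grass r e X),
        forall X Y : chart_family n A, Hilb P X -> Hilb P Y ->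
          same_elts (Hilb_to_Grass r e X) (Hilb_to_Grass r e Y) ->
          forall i, same_elts (X i) (Y i)
      & forall L : 'rV[A]_N -> Prop, Grass_points Z L ->
          exists2 X : chart_family n A, Hilb P X &
          same_elts (Hilb_to_Grass r e X) L]) /\
  (forall (A B : comAlgType k) (g : {lrmorphism A -> B}),
    noetherian A -> noetherian B ->
    forall X : chart_family n A, Hilb P X ->
      Hilb P (base_change g X) /\
      same_elts (Hilb_to_Grass r e (base_change g X))
                (Grass_map g (Hilb_to_Grass r e X))).

(* Main.v *)
(* Over an infinite field Green's hyperplane restriction theorem yields
   Macaulay's growth bound and, by induction on hyperplane sections, Gotzmann
   regularity: a saturated ideal with Hilbert polynomial P has Hilbert function
   P in every degree d >= r. Over a local ring the same induction lifts the
   sections of degree d >= r of the special fibre of a flat family, so S_d/I_d is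
   locally free of rank P(d), compatibly with base change. Conversely, let L be
   a point of the Grassmannian for which S_(d-r) L has codimension at least P(d)
   for all d >= r. This codimension is at most P(d) by Macaulay, so the
   quotients S_d/S_(d-r)L are locally free, and the charts of the ideal generated
   by L, being direct limits of these, are flat. The condition on L is the
   vanishing of minors. *)
Require Import Defs.
From HB Require Import structures.
From mathcomp Require Import all_boot all_order all_algebra.
From mathcomp Require Import boolp.
From mathcomp Require Import zify ring perm.
Set Implicit Arguments.
Unset Strict Implicit.
Unset Printing Implicit Defensive.
Import GRing.Theory.
Local Open Scope ring_scope.

(** * Binomial representations *)

(** Everything is done degree by degree: a graded ideal is a family of submodules of free modules,
    and the algebra is reduced to matrices over a noetherian ring, its local rings and their residue
    fields. No cohomology appears. Its vanishing theorems are replaced by the lifting of sections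
    from the special fibre, which is the delicate point: over a local ring a direct argument lifts
    them only in large degrees, and they have to be carried down to degree r. Flatness enters
    through one criterion, that independent families lift to independent families. Noetherianity
    serves to test membership in a submodule prime by prime and to extend a splitting at a prime to
    a neighbourhood. Characteristic 0 makes every residue field infinite, so that general linear
    forms exist there. Equations are imposed in all degrees d >= r, so that Gotzmann's persistence
    theorem is not called upon. *)

Section MacaulayNumbers.
Local Open Scope nat_scope.

(* For a weakly decreasing with size a <= d + 1, hf d a is the value at d of the
   polynomial with Gotzmann exponents a, gf is the bound of Green's theorem and
   dec a has the exponents of the difference polynomial. *)
Fixpoint hf (d : nat) (a : seq nat) : nat :=
  if a is x :: a' then 'C(d + x, d) + hf d.-1 a' else 0.

Fixpoint gf (d : nat) (a : seq nat) : nat :=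
  if a is x :: a' then 'C((d + x).-1, d) + gf d.-1 a' else 0.

Fixpoint lex (a b : seq nat) : bool :=
  match a, b with
  | _, [::] => false
  | [::], _ => true
  | x :: a', y :: b' => (x < y) || (x == y) && lex a' b'
  end.

Definition dec (a : seq nat) := [seq x.-1 | x <- a & 0 < x].

(** ['C(d + x.+1, d)] is the sum of the ['C(j + x, j)] for j <= d. As [size a <= d], the term j = 0
    is left over, whence strictness: exponents at most x together weigh less than a single exponent
    x + 1. *)
Lemma hf_ub d x a : path geq x a -> size a <= d -> hf d a < 'C(d + x.+1, d).
Proof.
elim: a d x => [|y a IH] d x /=; first by move=> _ _; rewrite bin_gt0 leq_addr.
case: d => [//|d] /andP[yx pa]; rewrite ltnS /= => sa.
have := IH d y pa sa; rewrite -addSnnS.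
have: 'C((d.+1 + y).+1, d.+1) <= 'C((d.+1 + x).+1, d.+1).
  by apply: leq_bin2l; rewrite ltnS leq_add2l.
by rewrite -!addSnnS !binS; lia.
Qed.

Lemma gf_ub d x a : path geq x a -> size a <= d -> gf d a < 'C(d + x, d).
Proof.
elim: a d x => [|y a IH] d x /=; first by move=> _ _; rewrite bin_gt0 leq_addr.
case: d => [//|d] /andP[yx pa]; rewrite ltnS /= => sa.
have := IH d y pa sa.
have: 'C(d.+1 + y, d.+1) <= 'C(d.+1 + x, d.+1).
  by apply: leq_bin2l; rewrite leq_add2l.
by rewrite addSn binS; lia.
Qed.

Lemma lex_hf d a b : sorted geq a -> sorted geq b -> size a <= d ->
  lex a b -> hf d a < hf d b.
Proof.
elim: a d b => [|x a IH] d [|y b] //=.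
  by move=> *; rewrite addn_gt0 bin_gt0 leq_addr.
case: d => [//|d] pa pb; rewrite ltnS => sa /orP[xy|/andP[/eqP-> l]].
  have h := @hf_ub d.+1 x (x :: a); rewrite /= leqnn ltnS in h.
  have: 'C(d.+1 + x.+1, d.+1) <= 'C(d.+1 + y, d.+1).
    by apply: leq_bin2l; rewrite leq_add2l.
  by move: (h pa sa); rewrite /=; lia.
by rewrite ltn_add2l IH // (path_sorted pa, path_sorted pb).
Qed.

Lemma lex_total a b : [\/ lex a b, a = b | lex b a].
Proof.
elim: a b => [|x a IH] [|y b] /=; try by [constructor 2 | constructor 1 | constructor 3].
case: (ltngtP x y) => [_|_|->] /=; [by constructor 1|by constructor 3|].
by case: (IH b) => [->|->|->]; [constructor 1|constructor 2|constructor 3].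
Qed.

Lemma hf_lex d a b : sorted geq a -> sorted geq b -> size b <= d ->
  hf d a < hf d b -> lex a b.
Proof.
move=> sa sb zb h; case: (lex_total a b) => [//|e|l].
  by rewrite e ltnn in h.
by have := lex_hf sb sa zb l; lia.
Qed.

(** A zero exponent adds ['C(d.-1, d) = 0] to [gf] when d > 0, so the strict comparison asks for
    positive exponents in [b]. *)
Lemma lex_gf d a b : sorted geq a -> sorted geq b -> size a <= d ->
  lex a b -> all (ltn 0) b -> gf d a < gf d b.
Proof.
elim: a d b => [|x a IH] d [|y b] //=.
  by move=> _ _ _ _ /andP[y0 _]; rewrite addn_gt0 bin_gt0; lia.
case: d => [//|d] pa pb; rewrite ltnS => sa /orP[xy|/andP[/eqP-> l]] /andP[y0 ab].
  have h := @gf_ub d.+1 x (x :: a); rewrite /= leqnn ltnS in h.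
  have: 'C(d.+1 + x, d.+1) <= 'C((d.+1 + y).-1, d.+1).
    by apply: leq_bin2l; lia.
  by move: (h pa sa); rewrite /=; lia.
by rewrite ltn_add2l IH // (path_sorted pa, path_sorted pb).
Qed.

Lemma lex_gfW d a b : sorted geq a -> sorted geq b -> size a <= d ->
  lex a b -> gf d a <= gf d b.
Proof.
elim: a d b => [|x a IH] d [|y b] //=.
case: d => [//|d] pa pb; rewrite ltnS => sa /orP[xy|/andP[/eqP-> l]].
  have h := @gf_ub d.+1 x (x :: a); rewrite /= leqnn ltnS in h.
  have: 'C(d.+1 + x, d.+1) <= 'C((d.+1 + y).-1, d.+1).
    by apply: leq_bin2l; lia.
  by move: (h pa sa); rewrite /=; lia.
by rewrite leq_add2l IH // (path_sorted pa, path_sorted pb).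
Qed.

Lemma gf_mono d a b : sorted geq a -> sorted geq b -> size a <= d ->
  size b <= d -> hf d a <= hf d b -> gf d a <= gf d b.
Proof.
move=> sa sb za zb h; case: (lex_total a b) => [l|->//|l].
  exact: lex_gfW.
by have := lex_hf sb sa zb l; lia.
Qed.

(** Values compare as their exponent sequences do lexicographically, and this order does not see the
    degree. *)
Lemma hf_ltS d t a b : sorted geq a -> sorted geq b -> size a <= d ->
  size b <= d -> d <= t -> hf d a < hf d b -> hf t a < hf t b.
Proof.
move=> sa sb za zb dt h; apply: lex_hf => //; first exact: leq_trans dt.
exact: hf_lex h.
Qed.

Lemma hf_mono d t a b : sorted geq a -> sorted geq b -> size a <= d ->
  size b <= d -> d <= t -> hf d a <= hf d b -> hf t a <= hf t b.
Proof.
move=> sa sb za zb dt; rewrite leq_eqVlt => /orP[/eqP e|h]; last first.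
  by apply: ltnW; apply: hf_ltS h.
case: (lex_total a b) => [l|->//|l].
  by have := lex_hf sa sb za l; rewrite e ltnn.
by have := lex_hf sb sa zb l; rewrite e ltnn.
Qed.

(** Macaulay's representation of c, found greedily: the leading exponent is the largest x with
    ['C(d + x, d) <= c], and the remainder is represented in degree d - 1. The search is bounded
    since [c < 'C(d + c.+1, d)] for d > 0. *)
Lemma hf_rep d c : 0 < d ->
  exists a, [/\ sorted geq a, size a <= d & hf d a = c].
Proof.
move=> d0; suff H: forall d x c, c < 'C(d + x.+1, d) ->
    exists a, [/\ path geq x a, size a <= d & hf d a = c].
  have [|a [pa sa ha]] := H d c c; last by exists a; split=> //; exact: path_sorted pa.
  case: d d0 => // d _; rewrite addSn -bin_sub ?leq_addl; last by lia.
  have -> : (d + c.+1).+1 - d.+1 = c.+1 by lia.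
  elim: d => [|d IH]; first by rewrite binSn.
  apply: leq_trans IH _; apply: leq_bin2l; lia.
move=> {c d d0}; elim=> [|d IHd] x.
  by move=> c; rewrite bin0 ltnS leqn0 => /eqP->; exists [::].
elim: x => [|x IHx] c hc.
  case: (posnP c) => [->|c0]; first by exists [::].
  have [|a [pa sa ha]] := IHd 0 c.-1.
    by move: hc; rewrite addn1 binS binn [d + 1]addn1; lia.
  by exists (0 :: a); split=> //=; rewrite addn0 binn ha; lia.
case: (ltnP c 'C(d.+1 + x.+1, d.+1)) => h.
  have [a [pa sa ha]] := IHx _ h; exists a; split=> //.
  by case: a pa {sa ha} => //= y a /andP[yx ->]; rewrite andbT; lia.
have [|a [pa sa ha]] := IHd x.+1 (c - 'C(d.+1 + x.+1, d.+1)).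
  by move: hc; rewrite (addnS d.+1 x.+1) binS -(addSnnS d x.+1); lia.
by exists (x.+1 :: a); split=> //=; rewrite ?leqnn ?ha //; lia.
Qed.

Lemma hf_succ d a : size a <= d.+1 -> hf d.+1 a = hf d a + gf d.+1 a.
Proof.
elim: a d => [|x a IH] //= d; rewrite ltnS => sa.
case: d sa => [|d] sa.
  by case: a sa {IH} => //= _; rewrite !bin0 !bin1; lia.
by rewrite (IH d) //= addSn /= binS; lia.
Qed.

Lemma gf_incr d l : gf d (map succn l) = hf d l.
Proof. by elim: l d => [|x l IH] d //=; rewrite IH addnS. Qed.

Lemma hf_incr d l : size l <= d.+1 ->
  hf d.+1 (map succn l) = hf d (map succn l) + hf d.+1 l.
Proof. by move=> sl; rewrite hf_succ ?size_map // gf_incr. Qed.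

Lemma sorted_incr l : sorted geq l -> sorted geq (map succn l).
Proof. by rewrite sorted_map. Qed.

Lemma hf_rcons d l x : size l = d -> hf d (rcons l x) = (hf d l).+1.
Proof.
elim: l d => [|y l IH] [|d] //=; first by rewrite add0n bin0.
by case=> e; rewrite IH //; lia.
Qed.

(** Here [a], [b], [l] represent the codimensions of V, of V : h and of V + hS for a linear form h.
    As u is the Green bound of [map succn l], it suffices to compare that sequence with [a] in
    degree d + 1, where its value is [hf d (map succn l) + u]; this reduces to a comparison with [b]
    in degree d. If the latter failed, [gf d b] would be less than [hf d l], against the last
    hypothesis. *)
Lemma green_numeric d u a b l : sorted geq a -> sorted geq b -> sorted geq l ->
  size a <= d.+1 -> size b <= d -> size l <= d.+1 ->
  hf d.+1 l = u -> hf d.+1 a = hf d b + u -> u <= gf d b + gf d.+1 l ->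
  u <= gf d.+1 a.
Proof.
move=> sa sb sl za zb zl hl ha hu.
have h1: hf d (map succn l) <= hf d b.
  rewrite leqNgt; apply/negP => lt.
  have {}hu: hf d l <= gf d b by move: (hf_succ zl); lia.
  move: zl; rewrite leq_eqVlt => /orP[/eqP zl|zl]; last first.
    have := lex_gf sb (sorted_incr sl) zb; rewrite gf_incr.
    move/(_ (hf_lex sb (sorted_incr sl) _ lt)); rewrite size_map all_map.
    have -> : all (preim succn (ltn 0)) l by apply/allP.
    by move=> /(_ zl isT); lia.
  (* A sequence of d + 1 exponents is too long for the comparison in degree d. Its last exponent has
     weight 1 there and is removed. *)
  case/lastP: l => [|l x] in sl zl hl hu lt *; first by [].
  move: zl; rewrite size_rcons => -[zl].
  have sl': sorted geq l by move: sl; rewrite -cats1 => /cat_sorted2[].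
  rewrite map_rcons hf_rcons ?size_map // ltnS in lt.
  have := gf_mono sb (sorted_incr sl') zb; rewrite size_map zl leqnn => /(_ isT lt).
  by rewrite gf_incr; move: hu; rewrite hf_rcons //; lia.
have h2: hf d.+1 (map succn l) <= hf d.+1 a by rewrite hf_incr //; lia.
have := gf_mono (sorted_incr sl) sa; rewrite size_map => /(_ d.+1 zl za h2).
by rewrite gf_incr hl.
Qed.

Lemma lex_catl l a s : lex l a -> size a <= size l -> lex (l ++ s) a.
Proof.
elim: l a => [|x l IH] [|y a] //=.
case/orP=> [-> //|/andP[-> h]]; rewrite ltnS => sa.
by rewrite IH // orbT.
Qed.

(** By [hf_succ] the hypothesis says [hf d l <= hf d a], and such comparisons persist. If [l] has d
    + 1 exponents, the last one weighs 1 in degree d; without it the sequence is strictly below [a],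
    and lexicographic strictness survives appending it again. *)
Lemma macaulay_numeric d a l : sorted geq a -> sorted geq l ->
  size a <= d -> size l <= d.+1 ->
  hf d.+1 l <= hf d a + gf d.+1 l -> hf d.+1 l <= hf d.+1 a.
Proof.
move=> sa sl za zl hu.
have {}hu: hf d l <= hf d a by move: (hf_succ zl); lia.
move: zl; rewrite leq_eqVlt => /orP[/eqP zl|zl]; last exact: hf_mono hu.
case/lastP: l => [//|l x] in sl zl hu *.
move: zl; rewrite size_rcons => -[zl].
have sl': sorted geq l by move: sl; rewrite -cats1 => /cat_sorted2[].
rewrite hf_rcons // in hu.
apply: ltnW; apply: lex_hf => //; first by rewrite size_rcons zl.
rewrite -cats1; apply: lex_catl; last by rewrite zl.
exact: hf_lex hu.
Qed.

Lemma path0_zero a : path geq 0 a -> dec a = [::] /\ forall d, size a <= d -> gf d a = 0.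
Proof.
elim: a => [//|y a IH] /= /andP[]; case: y => // _ /IH[h1 h2]; split=> //.
by case=> // d; rewrite ltnS => h; rewrite addn0 /= h2 // bin_small.
Qed.

Lemma hf_dec d a : sorted geq a -> size a <= d -> hf d (dec a) = gf d a.
Proof.
elim: a d => [//|[|x] a IH] [|d] //= pa; rewrite ltnS => sa.
  have [h1 h2] := path0_zero pa.
  have -> : dec (0 :: a) = [::] by rewrite /dec /= -/(dec a).
  by rewrite h2 // !addn0 /= bin_small.
rewrite /dec /= -/(dec a) IH // ?addnS //; exact: path_sorted pa.
Qed.

Lemma size_dec a : size (dec a) <= size a.
Proof. by rewrite size_map size_filter count_size. Qed.

Lemma sorted_dec a : sorted geq a -> sorted geq (dec a).
Proof.
move=> sa; rewrite sorted_map; have: sorted geq [seq x <- a | 0 < x].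
  by apply: sorted_filter sa => x y z /= h1 h2; apply: leq_trans h2 h1.
apply: sub_sorted => x y /= ; lia.
Qed.

(** The leading exponent is the measure for the induction on hyperplane sections. *)
Lemma head_dec a : a != [::] -> dec a != [::] -> sorted geq a ->
  head 0 (dec a) < head 0 a.
Proof.
case: a => //= -[|x] a _ // + pa.
by have [+ _] := path0_zero pa; rewrite /dec /= => ->.
Qed.

Lemma hf_diff d a : sorted geq a -> size a <= d.+1 ->
  hf d.+1 a = hf d a + hf d.+1 (dec a).
Proof. by move=> sa za; rewrite hf_dec // hf_succ. Qed.

End MacaulayNumbers.

(** * Theorems of Green, Macaulay and Gotzmann *)

(* A form of degree d is the row vector of its coordinates in the monomial basis
   E d, and maps between forms are matrices acting on the right. *)
Definition mult_mx (n : nat) (E : forall d, 'I_('C(n + d, n)) -> 'X_{1..n.+1})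
    (R : pzSemiRingType) (i : 'I_n.+1) (d : nat) :
    'M[R]_('C(n + d, n), 'C(n + d.+1, n)) :=
  \matrix_(k, l) (E d.+1 l == E d k + U_(i))%MM%:R.

Definition lform_mx (n : nat) (E : forall d, 'I_('C(n + d, n)) -> 'X_{1..n.+1})
    (R : pzSemiRingType) (d : nat) (t : 'rV[R]_n.+1) :
    'M[R]_('C(n + d, n), 'C(n + d.+1, n)) :=
  \sum_i t 0 i *: mult_mx E R i d.

Section Multiplication.
Context (n : nat) (E : forall d, 'I_('C(n + d, n)) -> 'X_{1..n.+1}).
Hypothesis hE : forall d, monomial_basis d (@E d).

Lemma mult_mx_row (i : 'I_n.+1) d (k : 'I_('C(n + d, n))) :
  exists l, E l = (E k + U_(i))%MM /\
  forall (R : pzSemiRingType) p (M : 'M[R]_(_, p)), row k (mult_mx E R i d *m M) = row l M.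
Proof.
have [inj cov] := hE d.+1.
have [_ cov'] := hE d.
have /cov[l hl] : mdeg (E k + U_(i))%MM = d.+1.
  by rewrite mdegD mdeg1 (proj2 (cov' _)) ?addn1 //; exists k.
exists l; split=> // R p M; apply/rowP=> j; rewrite !mxE (bigD1 l) //= big1 ?addr0.
  by rewrite !mxE hl eqxx mul1r.
move=> l' ll'; rewrite !mxE -hl; case: eqP => [/inj e|]; last by rewrite mul0r.
by rewrite e eqxx in ll'.
Qed.

Lemma mult_mxC (R : pzSemiRingType) (i j : 'I_n.+1) d :
  mult_mx E R i d *m mult_mx E R j d.+1 = mult_mx E R j d *m mult_mx E R i d.+1.
Proof.
apply/row_matrixP => k.
have [l [hl ->]] := mult_mx_row i k; have [l' [hl' ->]] := mult_mx_row j k.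
rewrite -[mult_mx E R j d.+1]mulmx1 -[mult_mx E R i d.+1]mulmx1.
have [m [hm ->]] := mult_mx_row j l; have [m' [hm' ->]] := mult_mx_row i l'.
suff -> : m = m' by [].
have [inj _] := hE d.+2; apply: inj; rewrite hm hm' hl hl'.
by rewrite -!addmA [(U_(i) + _)%MM]addmC.
Qed.

Lemma mult_mx_gen d (l : 'I_('C(n + d.+1, n))) :
  exists k i, E l = (E k + U_(i))%MM /\ forall R : pzSemiRingType,
    row k (mult_mx E R i d) = row l 1%:M.
Proof.
have [inj cov] := hE d.+1; have [_ cov'] := hE d.
have dl : mdeg (E l) = d.+1 by apply/cov; exists l.
have [i hi] : exists i, (0 < E l i)%N.
  apply: contrapT => h; move: dl; rewrite mdegE big1 // => i _; apply/eqP.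
  by rewrite -leqn0 leqNgt; apply/negP => hi; apply: h; exists i.
have le : (U_(i) <= E l)%MM by rewrite lep1mP -lt0n.
have el : (E l - U_(i) + U_(i))%MM = E l by rewrite submK.
have /cov'[k hk] : mdeg (E l - U_(i))%MM = d.
  by apply/eqP; rewrite -(eqn_add2r 1) -{1}(mdeg1 i) -mdegD el dl addn1.
exists k, i; split; first by rewrite hk el.
move=> R; rewrite -[mult_mx E R i d]mulmx1; have [l' [hl' ->]] := mult_mx_row i k.
by congr row; apply: inj; rewrite hl' hk.
Qed.

Lemma mult_mx_map (R S : nzRingType) (g : {rmorphism R -> S}) i d :
  map_mx g (mult_mx E R i d) = mult_mx E S i d.
Proof. by apply/matrixP=> k l; rewrite !mxE rmorph_nat. Qed.

Lemma lform_mxC (R : comNzRingType) d (t u : 'rV[R]_n.+1) :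
  lform_mx E d t *m lform_mx E d.+1 u = lform_mx E d u *m lform_mx E d.+1 t.
Proof.
rewrite /lform_mx !mulmx_suml.
under eq_bigr do rewrite mulmx_sumr.
rewrite exchange_big; apply: eq_bigr => i _; rewrite mulmx_sumr.
apply: eq_bigr => j _; rewrite -!scalemxAl -!scalemxAr mult_mxC.
by rewrite !scalerA mulrC.
Qed.

Lemma lin_mult_mxC (R : comNzRingType) d (t : 'rV[R]_n.+1) i :
  lform_mx E d t *m mult_mx E R i d.+1 = mult_mx E R i d *m lform_mx E d.+1 t.
Proof.
rewrite /lform_mx mulmx_suml mulmx_sumr; apply: eq_bigr => j _.
by rewrite -scalemxAl -scalemxAr mult_mxC.
Qed.

Lemma lform_mx_delta (R : comNzRingType) d i :
  lform_mx E d (delta_mx 0 i : 'rV[R]_n.+1) = mult_mx E R i d.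
Proof.
rewrite /lform_mx (bigD1 i) //= big1 => [|j ji].
  by rewrite mxE !eqxx scale1r addr0.
by rewrite mxE eqxx (negbTE ji) scale0r.
Qed.

Lemma lform_mx_map (R S : comNzRingType) (g : {rmorphism R -> S}) d (t : 'rV[R]_n.+1) :
  map_mx g (lform_mx E d t) = lform_mx E d (map_mx g t).
Proof.
rewrite /lform_mx raddf_sum; apply: eq_bigr => i _.
by rewrite /= map_mxZ mult_mx_map mxE.
Qed.

End Multiplication.

(** * Codimension, colon spaces and general points over a field *)

Section Field.
Context (K : fieldType).

Definition codim (m p : nat) (V : 'M[K]_(m, p)) : nat := (p - \rank V)%N.

Lemma codim_le m1 m2 p (V : 'M[K]_(m1, p)) (W : 'M[K]_(m2, p)) :
  (V <= W)%MS -> (codim W <= codim V)%N.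
Proof. by move=> /mxrankS; rewrite /codim; lia. Qed.

Lemma codim_eq m1 m2 p (V : 'M[K]_(m1, p)) (W : 'M[K]_(m2, p)) :
  (V <= W)%MS -> (codim V <= codim W)%N -> (W <= V)%MS.
Proof.
move=> VW c; have := rank_leq_col V; have := rank_leq_col W; have := mxrankS VW.
move=> h1 h2 h3.
move: (mxrank_leqif_eq VW) => [_]; have -> : \rank V == \rank W.
  by move: c; rewrite /codim => c; apply/eqP; lia.
by move/esym/andP=> [].
Qed.

Lemma codim0 m p (V : 'M[K]_(m, p)) : codim V = 0%N -> row_full V.
Proof. by rewrite /codim /row_full => h; have := rank_leq_col V; lia. Qed.

Definition colon (m a p : nat) (V : 'M[K]_(m, p)) (L : 'M[K]_(a, p)) : 'M[K]_a :=
  kermx (L *m cokermx V).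

Lemma sub_colon m a p q (V : 'M[K]_(m, p)) (L : 'M[K]_(a, p)) (w : 'M[K]_(q, a)) :
  (w <= colon V L)%MS = (w *m L <= V)%MS.
Proof. by rewrite sub_kermx submxE mulmxA. Qed.

(** Exactness of 0 -> S/(V : L) -> S/V -> S/(V + L) -> 0, where the first map is multiplication by
    L. *)
Lemma codim_colon m a p (V : 'M[K]_(m, p)) (L : 'M[K]_(a, p)) :
  codim V = (codim (colon V L) + codim (V + L)%MS)%N.
Proof.
have e : (kermx (cokermx V) :=: V)%MS.
  apply/eqmxP/andP; split; last by rewrite sub_kermx mulmx_coker.
  by rewrite submxE mulmx_ker.
have := mxrank_mul_ker L (cokermx V); have := mxrank_sum_cap V L.
rewrite (cap_eqmx (eqmx_refl L) e) (capmxC L V) /codim /colon mxrank_ker.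
have := rank_leq_row (L *m cokermx V); have := rank_leq_col V.
have := rank_leq_col (V + L)%MS; lia.
Qed.

(** A substitute for Zariski openness that is tested on lines: on a line through a point of G, all
    but finitely many points lie in G. This is enough to find a common point of two nonempty such
    sets. *)
Definition generic_open (m : nat) (G : 'rV[K]_m -> Prop) : Prop :=
  forall t u, G t -> exists2 q : {poly K}, q != 0 &
  forall x, q.[x] != 0 -> G (t + x *: u).

Lemma poly_nonroot (hK : injective (fun i : nat => i%:R : K)) (q : {poly K}) :
  q != 0 -> exists x, q.[x] != 0.
Proof.
move=> q0; apply: contrapT => h.
have h' x : q.[x] = 0 by apply/eqP; apply: contraPT isT => qx; case: h; exists x.
have := @max_poly_roots _ q [seq i%:R | i <- iota 0 (size q)] q0.
rewrite size_map size_iota ltnn map_inj_uniq ?iota_uniq //.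
have -> : all (root q) [seq i%:R | i <- iota 0 (size q)].
  by apply/allP => x _; rewrite /root h'.
by move=> /(_ isT isT).
Qed.

(** Each set contains all but finitely many points of the line joining [t1] and [t2]; substituting 1
    - X turns the parameter counted from [t2] into the one counted from [t1]. *)
Lemma generic_meet (hK : injective (fun i : nat => i%:R : K)) m
    (G H : 'rV[K]_m -> Prop) t1 t2 :
  generic_open G -> generic_open H -> G t1 -> H t2 -> exists t, G t /\ H t.
Proof.
move=> oG oH G1 H2.
have [q1 q10 h1] := oG _ (t2 - t1) G1.
have [q2 q20 h2] := oH _ (t1 - t2) H2.
have s2 : size (1 - 'X : {poly K}) = 2 by rewrite -opprB size_polyN size_XsubC.
have [|x] := @poly_nonroot hK (q1 * (q2 \Po (1 - 'X))).
  by rewrite mulf_neq0 // comp_poly2_eq0.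
rewrite hornerM horner_comp !hornerE mulf_eq0 negb_or => /andP[/h1 g1 /h2 g2].
exists (t1 + x *: (t2 - t1)); split=> //.
suff -> : t1 + x *: (t2 - t1) = t2 + (1 - x) *: (t1 - t2) by [].
apply/rowP=> i; rewrite !mxE; ring.
Qed.

(** [W] and [U] compress [A t] to an identity matrix of size its rank. The determinant of the same
    compression along the line is a polynomial with value 1 at 0, and the rank does not drop where
    it is nonzero. *)
Lemma generic_rank m a p (A : 'rV[K]_m -> 'M[K]_(a, p)) (B : 'rV[K]_m -> 'M[K]_(a, p)) c :
  (forall t x u, A (t + x *: u) = A t + x *: B u) ->
  generic_open (fun t => codim (A t) <= c)%N.
Proof.
move=> hA t u ht.
have /row_freeP[U hU] : row_free (row_base (A t)) by exact: row_base_free.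
have [W hW] : exists W, W *m col_base (A t) = 1%:M.
  by apply/row_fullP; exact: col_base_full.
pose M0 := W *m A t *m U; pose M1 := W *m B u *m U.
have hM0 : M0 = 1%:M.
  transitivity (W *m (col_base (A t) *m row_base (A t)) *m U).
    by rewrite mulmx_base.
  by rewrite mulmxA hW mul1mx hU.
pose Q := map_mx polyC M0 + 'X *: map_mx polyC M1.
have hQ x : (\det Q).[x] = \det (M0 + x *: M1).
  rewrite -horner_evalE -det_map_mx; congr (\det _); apply/matrixP=> i j.
  by rewrite !mxE /= /horner_eval !hornerE.
exists (\det Q).
  apply/eqP => Q0; have := hQ 0; rewrite Q0 horner0 scale0r addr0 hM0 det1 => /eqP.
  by rewrite eq_sym oner_eq0.
move=> x; rewrite hQ -unitfE -/(M0 + x *: M1 \in unitmx) => hu.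
have e : M0 + x *: M1 = W *m A (t + x *: u) *m U.
  by rewrite hA mulmxDr mulmxDl -scalemxAr -scalemxAl.
have := mxrank_unit hu; rewrite e => hr.
have := mxrankM_maxl (W *m A (t + x *: u)) U; have := mxrankM_maxr W (A (t + x *: u)).
rewrite hr; move: ht; rewrite /codim; lia.
Qed.

End Field.

Section Macaulay.
Context (n : nat) (E : forall d, 'I_('C(n + d, n)) -> 'X_{1..n.+1}).
Hypothesis hE : forall d, monomial_basis d (@E d).
Context (K : fieldType) (hK : injective (fun i : nat => i%:R : K)).

Lemma lform_mx_affine d (t u : 'rV[K]_n.+1) x :
  lform_mx E d (t + x *: u) = lform_mx E d t + x *: lform_mx E d u.
Proof.
rewrite /lform_mx scaler_sumr -big_split; apply: eq_bigr => i _ /=.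
by rewrite !mxE scalerDl scalerA.
Qed.

Lemma codim_adds_col m1 m2 p (V : 'M[K]_(m1, p)) (W : 'M[K]_(m2, p)) :
  codim (V + W)%MS = codim (col_mx V W).
Proof. by rewrite /codim addsmxE. Qed.

Lemma generic_lin d m (V : 'M[K]_(m, 'C(n + d.+1, n))) c :
  generic_open (fun t => codim (V + lform_mx E d t)%MS <= c)%N.
Proof.
move=> t u; rewrite codim_adds_col => h.
have [|q q0 hq] := @generic_rank K _ _ _ (fun t => col_mx V (lform_mx E d t))
    (fun u => col_mx 0 (lform_mx E d u)) c _ t u h.
  by move=> t' x u'; rewrite lform_mx_affine scale_col_mx add_col_mx scaler0 addr0.
by exists q => // x /hq; rewrite codim_adds_col.
Qed.

Lemma row_full_mult d m (V : 'M[K]_(m, 'C(n + d.+1, n))) :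
  (forall i, (mult_mx E K i d <= V)%MS) -> row_full V.
Proof.
move=> h; rewrite -sub1mx; apply/row_subP => l.
have [k [i [_ <-]]] := mult_mx_gen hE l; apply: submx_trans (h i); exact: row_sub.
Qed.

(* Green's hyperplane restriction theorem. The codimension u of V + lS for a
   general linear form l satisfies u <= codim ((V : l) + l'S) +
   codim (V + lS + l'S) for every l', and both terms are covered by induction
   when l' is general. *)
Lemma green d (V : 'M[K]_('C(n + d.+1, n))) a : sorted geq a ->
  (size a <= d.+1)%N -> (codim V <= hf d.+1 a)%N ->
  exists t, (codim (V + lform_mx E d t)%MS <= gf d.+1 a)%N.
Proof.
move=> sa za ha.
suff [b [sb zb hb [t ht]]] : exists b, [/\ sorted geq b, (size b <= d.+1)%N,
    hf d.+1 b = codim V & exists t, (codim (V + lform_mx E d t)%MS <= gf d.+1 b)%N].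
  exists t; apply: leq_trans ht _; apply: gf_mono => //; rewrite hb //.
have [b [sb zb hb]] := @hf_rep d.+1 (codim V) isT; exists b; split=> //.
clear a sa za ha.
have triv d' (V' : 'M[K]_('C(n + d'.+1, n))) b' : codim V' = 0%N ->
    exists t, (codim (V' + lform_mx E d' t)%MS <= gf d'.+1 b')%N.
  move=> V0; exists 0; apply: (@leq_trans (codim V')); last by rewrite V0.
  by apply: codim_le; exact: addsmxSl.
(* Outer induction on the degree, inner induction on a bound c for the codimension of V. *)
elim: d => [|d IHd] in V b sb zb hb *; move: {-1}(codim V) (leqnn (codim V)) => c hc.
all: elim: c => [|c IHc] in V b sb zb hb hc *.
1,3: by apply: triv; move: hc; rewrite leqn0 => /eqP.
all: pose P u := `[< exists t, codim (V + lform_mx E _ t)%MS = u >].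
all: have /ex_minnP[u /asboolP[t ht] hmin] : exists u, P u by
  exists (codim (V + lform_mx E _ 0)%MS); apply/asboolP; exists 0.
all: have [V0|V0] := posnP (codim V).
1,3: exact: triv.
(* Otherwise minimality of u, applied to each variable, would put all multiples of the variables
   into V, and V would be everything. *)
all: have uV : (u < codim V)%N by
  rewrite ltnNge; apply/negP => le; move: V0; rewrite lt0n => /eqP; apply;
  (suff : row_full V by rewrite /row_full /codim => /eqP->; rewrite subnn);
  apply: row_full_mult => i; apply: submx_trans (addsmxSr V _) _;
  apply: codim_eq (addsmxSl _ _) _; apply: leq_trans le _;
  rewrite -(lform_mx_delta E K) ; apply: hmin; apply/asboolP; eexists.
  (* In degree 1 the Green bound is [codim V - 1], so [uV] suffices. *)
  exists t; rewrite ht; case: b sb zb hb => [|x [|//]] _ _ /=; first by lia.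
  by rewrite !addn0 !add1n !bin1 /=; lia.
set V' := (V + lform_mx E d.+1 t)%MS in ht.
pose W := colon V (lform_mx E d.+1 t).
have cW := codim_colon V (lform_mx E d.+1 t); rewrite -/V' -/W ht in cW.
have [b1 [sb1 zb1 hb1]] := @hf_rep d.+1 (codim W) isT.
have [b2 [sb2 zb2 hb2]] := @hf_rep d.+2 u isT.
have [t1 ht1] := IHd W b1 sb1 zb1 hb1.
have [||t2 ht2] := IHc V' b2 sb2 zb2; rewrite ?ht //; first by lia.
have [t' [h1 h2]] := generic_meet hK (@generic_lin _ _ W _) (@generic_lin _ _ V' _) ht1 ht2.
exists t; rewrite ht; apply: (@green_numeric _ u b b1 b2) => //; first by rewrite hb hb1 cW.
apply: leq_trans (leq_add h1 h2).
apply: (@leq_trans (codim (V + lform_mx E d.+1 t')%MS)); first by apply: hmin; apply/asboolP; exists t'.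
(* The colon space of V + l'S by l contains V : l and, since linear forms commute, the multiples of
   l'. *)
rewrite (codim_colon (V + lform_mx E d.+1 t')%MS (lform_mx E d.+1 t)); apply: leq_add.
  apply: codim_le; rewrite addsmx_sub !sub_colon; apply/andP; split.
    by apply: submx_trans (addsmxSl _ _); rewrite -sub_colon.
  by rewrite lform_mxC //; apply: submx_trans (addsmxSr _ _); rewrite submxMl.
by apply: codim_le; rewrite /V' -!addsmxA addsmxS // addsmxC.
Qed.

Definition up d (V : 'M[K]_('C(n + d, n))) : 'M[K]_('C(n + d.+1, n)) :=
  (\sum_i (<<V *m mult_mx E K i d>>))%MS.

Lemma sub_up d (V : 'M[K]_('C(n + d, n))) m (w : 'M[K]_(m, _)) i :
  (w <= V)%MS -> (w *m mult_mx E K i d <= up V)%MS.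
Proof. by move=> h; apply: (sumsmx_sup i) => //; rewrite genmxE submxMr. Qed.

Lemma up_sub d (V : 'M[K]_('C(n + d, n))) m (W : 'M[K]_(m, _)) :
  (forall i, (V *m mult_mx E K i d <= W)%MS) -> (up V <= W)%MS.
Proof. by move=> h; apply/sumsmx_subP => i _; rewrite genmxE. Qed.

Lemma up_lin d (V : 'M[K]_('C(n + d, n))) m (w : 'M[K]_(m, _)) t :
  (w <= V)%MS -> (w *m lform_mx E d t <= up V)%MS.
Proof.
move=> h; rewrite /lform_mx mulmx_sumr; apply: summx_sub => i _.
by rewrite -scalemxAr scalemx_sub // sub_up.
Qed.

(** Since V lies in (up V) : t, Green's theorem for [up V] bounds its codimension by [hf d a] plus
    the Green bound of that codimension; [macaulay_numeric] solves this inequality. *)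
Lemma macaulay d (V : 'M[K]_('C(n + d, n))) a : sorted geq a ->
  (size a <= d)%N -> (codim V <= hf d a)%N -> (codim (up V) <= hf d.+1 a)%N.
Proof.
move=> sa za hV.
have [l [sl zl hl]] := @hf_rep d.+1 (codim (up V)) isT.
rewrite -hl; apply: macaulay_numeric => //.
have [|t ht] := @green d (up V) l sl zl; first by rewrite hl.
rewrite hl (codim_colon (up V) (lform_mx E d t)); apply: leq_add ht.
by apply: leq_trans hV; apply: codim_le; rewrite sub_colon up_lin.
Qed.

Lemma macaulay_strict d (V : 'M[K]_('C(n + d, n))) a : sorted geq a ->
  (size a <= d)%N -> (codim V < hf d a)%N -> (codim (up V) < hf d.+1 a)%N.
Proof.
move=> sa za hV.
case: d => [|d] in V za hV *; first by case: a sa za hV.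
have [b [sb zb hb]] := @hf_rep d.+1 (codim V) isT.
apply: (@leq_ltn_trans (hf d.+2 b)); first by apply: macaulay; rewrite ?hb.
by apply: (@hf_ltS d.+1) => //; rewrite hb.
Qed.

End Macaulay.

Section Submodules.
Context (R : comNzRingType).

Lemma submodN (V : lmodType R) (W : V -> Prop) x : is_submod W -> W x -> W (- x).
Proof. by move=> [_ _ h] hx; rewrite -scaleN1r; apply: h. Qed.

Lemma submodB (V : lmodType R) (W : V -> Prop) x y :
  is_submod W -> W x -> W y -> W (x - y).
Proof. by move=> hW hx hy; case: (hW) => _ hD _; apply: hD => //; apply: submodN. Qed.

Lemma submod_sum (V : lmodType R) (W : V -> Prop) (I : Type) (s : seq I) (P : pred I) F :
  is_submod W -> (forall i, P i -> W (F i)) -> W (\sum_(i <- s | P i) F i).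
Proof. by move=> [h0 hD _] h; elim/big_ind: _. Qed.

Lemma submod_mulmx m p (W : 'rV[R]_p -> Prop) (M : 'M[R]_(m, p)) c :
  is_submod W -> (forall i, W (row i M)) -> W (c *m M).
Proof.
move=> hW h; rewrite mulmx_sum_row; apply: submod_sum => // i _.
by case: hW => _ _; apply.
Qed.

Lemma submod_comp (m p : nat) (W : 'rV[R]_p -> Prop) (M : 'M[R]_(m, p)) :
  is_submod W -> is_submod (fun v => W (v *m M)).
Proof.
move=> [h0 hD hZ]; split=> [|x y|a x]; first by rewrite mul0mx.
  by rewrite mulmxDl; apply: hD.
by rewrite -scalemxAl; apply: hZ.
Qed.

Lemma submod_addr (V : lmodType R) (W : V -> Prop) x y :
  is_submod W -> W x -> W (y + x) -> W y.
Proof. by move=> hW hx h; rewrite -[y](addrK x); apply: submodB. Qed.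

End Submodules.

(** * Graded ideals, saturation and hyperplane sections *)

Definition gfamily (n : nat) (R : comNzRingType) :=
  forall d, 'rV[R]_('C(n + d, n)) -> Prop.

Section Families.
Context (n : nat) (E : forall d, 'I_('C(n + d, n)) -> 'X_{1..n.+1}).
Hypothesis hE : forall d, monomial_basis d (@E d).
Context (R : comNzRingType).
Implicit Types (I : gfamily n R).

Definition graded_ideal I :=
  (forall d, is_submod (I d)) /\
  (forall d i v, I d v -> I d.+1 (v *m mult_mx E R i d)).

Definition saturated I :=
  forall d v, (forall i, I d.+1 (v *m mult_mx E R i d)) -> I d v.

Fixpoint satn I (k d : nat) (v : 'rV[R]_('C(n + d, n))) : Prop :=
  if k is k'.+1 then forall i, satn I k' (v *m mult_mx E R i d) else I d v.

Definition sat I : gfamily n R := fun d v => exists k, satn I k v.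

(** The ideal I + tS. There are no multiples of t in degree 0, whence the separate case. *)
Definition hyper I (t : 'rV[R]_n.+1) : gfamily n R := fun d =>
  match d with
  | 0 => I 0
  | e.+1 => fun v => exists u, I e.+1 (v - u *m lform_mx E e t)
  end.

Lemma satn_submod I k d : graded_ideal I -> is_submod (@satn I k d).
Proof.
move=> [hI _]; elim: k d => [|k IH] d //=.
split=> [i|x y hx hy i|a x hx i]; have [h0 hD hZ] := IH d.+1.
- by rewrite mul0mx.
- by rewrite mulmxDl; apply: hD.
- by rewrite -scalemxAl; apply: hZ.
Qed.

Lemma satn_mult I k d i (v : 'rV_('C(n + d, n))) : graded_ideal I ->
  satn I k v -> satn I k (v *m mult_mx E R i d).
Proof.
move=> [_ hI]; elim: k d v => [|k IH] d v /=; first exact: hI.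
by move=> h j; rewrite -mulmxA mult_mxC // mulmxA; apply: IH.
Qed.

Lemma satn_leq I k l d (v : 'rV_('C(n + d, n))) : graded_ideal I ->
  (k <= l)%N -> satn I k v -> satn I l v.
Proof.
move=> gI; elim: l k d v => [|l IH] [|k] d v //= kl h.
  by move=> i; apply: (IH 0%N) => //; case: gI => _; apply.
by move=> i; apply: IH (h i).
Qed.

Lemma sat_sub I d (v : 'rV_('C(n + d, n))) : I d v -> sat I v.
Proof. by exists 0%N. Qed.

Lemma sat_graded I : graded_ideal I -> graded_ideal (sat I).
Proof.
move=> gI; split=> [d|d i v [k hk]]; last by exists k; apply: satn_mult.
split=> [|x y [k hx] [l hy]|a x [k hx]].
- by exists 0%N => /=; case: gI => /(_ d)[].
- exists (maxn k l); have [_ hD _] := satn_submod (maxn k l) d gI.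
  by apply: hD; [apply: satn_leq hx | apply: satn_leq hy] => //; lia.
- by exists k; have [_ _ hZ] := satn_submod k d gI; apply: hZ.
Qed.

Lemma sat_saturated I : graded_ideal I -> saturated (sat I).
Proof.
move=> gI d v /fin_all_exists[k hk]; exists (\max_i k i).+1 => i /=.
by apply: satn_leq (hk i) => //; apply: leq_bigmax.
Qed.

Lemma graded_lin I d (v : 'rV_('C(n + d, n))) t : graded_ideal I -> I d v ->
  I d.+1 (v *m lform_mx E d t).
Proof.
move=> [hI gI] hv; rewrite mulmx_sumr; apply: submod_sum => // i _.
by rewrite -scalemxAr; case: (hI d.+1) => _ _; apply; apply: gI.
Qed.

Lemma hyper_sub I t d (v : 'rV_('C(n + d, n))) : I d v -> hyper I t v.
Proof. by case: d v => [//|d] v h; exists 0; rewrite mul0mx subr0. Qed.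

Lemma hyper_lin I t d (u : 'rV_('C(n + d, n))) : graded_ideal I ->
  @hyper I t d.+1 (u *m lform_mx E d t).
Proof. by move=> [/(_ d.+1)[h0 _ _] _]; exists u; rewrite subrr. Qed.

Lemma hyper_graded I t : graded_ideal I -> graded_ideal (hyper I t).
Proof.
move=> [hI gI]; split=> [[|d]|[|d] i v] //=.
- split=> [|x y [u hu] [w hw]|a x [u hu]]; case: (hI d.+1) => h0 hD hZ.
  + by exists 0; rewrite mul0mx subr0.
  + by exists (u + w); rewrite mulmxDl opprD addrACA; apply: hD.
  + by exists (a *: u); rewrite -scalemxAl -scalerBr; apply: hZ.
- by move=> h; exists 0; rewrite mul0mx subr0; apply: gI.
- case=> u hu; exists (u *m mult_mx E R i d).
  by rewrite -mulmxA -lin_mult_mxC // mulmxA -mulmxBl; apply: gI.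
Qed.

(** Descending induction on the degree: if t v lies in I, then so does t x_i v, hence x_i v lies in
    I for every i, and v does by saturation. *)
Lemma saturated_lin I t d0 : graded_ideal I -> saturated I ->
  (forall d v, (d0 <= d)%N -> I d.+1 (v *m lform_mx E d t) -> I d v) ->
  forall d v, I d.+1 (v *m lform_mx E d t) -> I d v.
Proof.
move=> [hI gI] sI h d; have [m] := ubnP (d0 - d)%N.
elim: m d => [//|m IH] d dm v hv; have [le|lt] := leqP d0 d; first exact: h.
apply: sI => i; apply: IH; first by lia.
by rewrite -mulmxA -lin_mult_mxC // mulmxA; apply: gI.
Qed.

End Families.

(** * Codimension of subspaces given as predicates *)

Section Codimension.
Context (K : fieldType).

(** A matrix of maximal rank with rows in W works, since an element of W outside its row space would
    raise the rank. *)
Lemma submod_mx p (W : 'rV[K]_p -> Prop) : is_submod W ->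
  exists M : 'M[K]_p, forall u, W u <-> (u <= M)%MS.
Proof.
move=> hW; pose P r := `[< exists M : 'M[K]_p, (forall i, W (row i M)) /\ \rank M = r >].
have exP : exists r, P r.
  exists 0%N; apply/asboolP; exists 0; split; last by rewrite mxrank0.
  by move=> i; rewrite row0; case: hW.
have ubP r : P r -> (r <= p)%N by move=> /asboolP[M [_ <-]]; exact: rank_leq_col.
have [r /asboolP[M [hM rM]] hmax] := ex_maxnP exP ubP.
exists M => u; split=> [hu|/submxP[c ->]]; last exact: submod_mulmx.
apply: contrapT => /negP nu.
have : P (\rank (M + u)%MS).
  apply/asboolP; exists (M + u)%MS; split=> // i.
  have /sub_addsmxP[[c d] /= ->] : (row i (M + u)%MS <= M + u)%MS by exact: row_sub.
  case: (hW) => _ hD _; apply: hD; apply: submod_mulmx => // j.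
  by rewrite (ord1 j) row_id.
move=> /hmax; rewrite -rM leqNgt => /negP; apply.
have := mxrank_leqif_sup (addsmxSl M u); rewrite addsmx_sub submx_refl (negbTE nu) /=.
by move=> [h1 h2]; rewrite ltn_neqAle h2 h1.
Qed.

Definition spmx p (W : 'rV[K]_p -> Prop) : 'M[K]_p :=
  if pselect (exists M : 'M[K]_p, forall u, W u <-> (u <= M)%MS) is left h
  then projT1 (cid h) else 0.

Lemma spmxP p (W : 'rV[K]_p -> Prop) u : is_submod W -> W u <-> (u <= spmx W)%MS.
Proof.
move=> hW; rewrite /spmx; case: pselect => [h|]; first exact: (projT2 (cid h)).
by move=> h; case: h; apply: submod_mx.
Qed.

Definition cod p (W : 'rV[K]_p -> Prop) := codim (spmx W).

Lemma spmx_le p (W : 'rV[K]_p -> Prop) m (M : 'M[K]_(m, p)) : is_submod W ->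
  (forall u : 'rV_p, W u -> (u <= M)%MS) -> (spmx W <= M)%MS.
Proof. by move=> hW h; apply/row_subP => i; apply/h/spmxP => //; exact: row_sub. Qed.

Lemma le_spmx p (W : 'rV[K]_p -> Prop) m (M : 'M[K]_(m, p)) : is_submod W ->
  (forall i, W (row i M)) -> (M <= spmx W)%MS.
Proof. by move=> hW h; apply/row_subP => i; apply/spmxP. Qed.

Lemma cod_mx p (W : 'rV[K]_p -> Prop) m (M : 'M[K]_(m, p)) :
  (forall u : 'rV_p, W u <-> (u <= M)%MS) -> cod W = codim M.
Proof.
move=> h; have hW : is_submod W.
  split=> [|x y|a x]; rewrite !h ?sub0mx //; first exact: addmx_sub.
  exact: scalemx_sub.
apply/eqP; rewrite eqn_leq; apply/andP; split; apply: codim_le.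
  by apply: le_spmx => // i; apply/h; exact: row_sub.
by apply: spmx_le => // u /h.
Qed.

Lemma cod_le p (W W' : 'rV[K]_p -> Prop) : is_submod W -> is_submod W' ->
  (forall u, W u -> W' u) -> (cod W' <= cod W)%N.
Proof. by move=> hW hW' h; apply: codim_le; apply: spmx_le => // u /h /spmxP; apply. Qed.

Lemma cod_ext p (W W' : 'rV[K]_p -> Prop) : (forall u, W u <-> W' u) -> cod W = cod W'.
Proof. by move=> h; congr cod; apply: funext => u; apply: propext. Qed.

Lemma cod_sub p (W W' : 'rV[K]_p -> Prop) : is_submod W -> is_submod W' ->
  (forall u, W u -> W' u) -> (cod W <= cod W')%N -> forall u, W' u -> W u.
Proof.
move=> hW hW' h c u /spmxP-/(_ hW') hu; apply/spmxP => //.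
apply: submx_trans hu _; apply: codim_eq c; apply: spmx_le => // w /h.
by move/spmxP; apply.
Qed.

End Codimension.

(** * Gotzmann regularity over a field *)

Section Regularity.
Context (n : nat) (E : forall d, 'I_('C(n + d, n)) -> 'X_{1..n.+1}).
Hypothesis hE : forall d, monomial_basis d (@E d).
Context (K : fieldType) (hK : injective (fun i : nat => i%:R : K)).
Implicit Types (I : gfamily n K).

Lemma cod_hyper I t d : graded_ideal E I ->
  cod (I d.+1) = (cod (fun v => I d.+1 (v *m lform_mx E d t)) + cod (@hyper _ E _ I t d.+1))%N.
Proof.
move=> [hI _]; rewrite {1}/cod (codim_colon _ (lform_mx E d t)); congr (_ + _)%N; symmetry.
  by apply: cod_mx => u; rewrite sub_colon; apply: spmxP.
apply: cod_mx => v; split=> [[u hu]|/sub_addsmxP[[a b] /= ->]].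
  rewrite -[v](subrK (u *m lform_mx E d t)); apply: addmx_sub_adds.
    by apply/spmxP.
  exact: submxMl.
by exists b; rewrite addrK; apply/spmxP => //; exact: submxMl.
Qed.

Lemma up_graded I d : graded_ideal E I -> (up E (spmx (I d)) <= spmx (I d.+1))%MS.
Proof.
move=> [hI gI]; apply: up_sub => i; apply: le_spmx => // k.
by rewrite row_mul; apply: gI; apply/spmxP => //; exact: row_sub.
Qed.

Lemma macaulay_family I d e a : graded_ideal E I -> sorted geq a -> (size a <= d)%N ->
  (d <= e)%N -> (cod (I d) <= hf d a)%N -> (cod (I e) <= hf e a)%N.
Proof.
move=> gI sa za; elim: e => [|e IH]; first by rewrite leqn0 => /eqP->.
rewrite leq_eqVlt => /orP[/eqP<-//|]; rewrite ltnS => de /(IH de) h.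
apply: leq_trans (codim_le (up_graded e gI)) _; apply: macaulay => //.
exact: leq_trans de.
Qed.

Lemma macaulay_strict_family I d e a : graded_ideal E I -> sorted geq a -> (size a <= d)%N ->
  (d <= e)%N -> (cod (I d) < hf d a)%N -> (cod (I e) < hf e a)%N.
Proof.
move=> gI sa za; elim: e => [|e IH]; first by rewrite leqn0 => /eqP->.
rewrite leq_eqVlt => /orP[/eqP<-//|]; rewrite ltnS => de /(IH de) h.
apply: leq_ltn_trans (codim_le (up_graded e gI)) _; apply: macaulay_strict => //.
exact: leq_trans de.
Qed.

(** A value strictly below the bound in one degree would stay strictly below it in all later
    degrees. *)
Lemma cod_lower I a d0 : graded_ideal E I -> sorted geq a ->
  (forall d, (d0 <= d)%N -> (hf d a <= cod (I d))%N) ->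
  forall d, (size a <= d)%N -> (hf d a <= cod (I d))%N.
Proof.
move=> gI sa h d zd; rewrite leqNgt; apply/negP => lt.
have := macaulay_strict_family gI sa zd (leq_maxr d0 d) lt.
by rewrite ltnNge h ?leq_maxl.
Qed.

(** All multiples of W by forms of degree k lie in I, so k applications of Macaulay's theorem carry
    the bound from W to I in degree d + k. *)
Lemma satn_bound I a k d (W : 'M[K]_('C(n + d, n))) : graded_ideal E I -> sorted geq a ->
  (forall w : 'rV_('C(n + d, n)), (w <= W)%MS -> satn E I k w) -> (size a <= d)%N ->
  (codim W <= hf d a)%N -> exists2 e, (d <= e)%N & (cod (I e) <= hf e a)%N.
Proof.
move=> gI sa; elim: k d W => [|k IH] d W hW zd le.
  exists d => //; apply: leq_trans le; apply: codim_le; apply: le_spmx.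
    by case: gI => h _; exact: h.
  by move=> i; apply: hW; exact: row_sub.
have hW' (w : 'rV_('C(n + d.+1, n))) : (w <= up E W)%MS -> satn E I k w.
  move=> /sub_sumsmxP[u ->]; apply: submod_sum; first exact: satn_submod.
  move=> i _; have : (u i *m <<W *m mult_mx E K i d>> <= W *m mult_mx E K i d)%MS.
    by rewrite (submx_trans (submxMl _ _)) // genmxE.
  by move=> /submxP[c ->]; rewrite mulmxA; apply: hW; exact: submxMl.
have [e de he] := IH _ _ hW' (leqW zd) (macaulay hE hK sa zd le).
by exists e => //; apply: ltnW.
Qed.

Lemma satn_strict I a k d (W : 'M[K]_('C(n + d, n))) : graded_ideal E I -> sorted geq a ->
  (forall w : 'rV_('C(n + d, n)), (w <= W)%MS -> satn E I k w) -> (size a <= d)%N ->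
  (codim W < hf d a)%N -> exists2 e, (d <= e)%N & (cod (I e) < hf e a)%N.
Proof.
move=> gI sa hW zd lt; have [d0|d0] := posnP d.
  by subst d; case: a sa zd lt.
have [b [sb zb hb]] := hf_rep (codim W) d0.
have [e de he] := satn_bound gI sb hW zb (eq_leq (esym hb)).
by exists e => //; apply: leq_ltn_trans he (hf_ltS sb sa zb zd de _); rewrite hb.
Qed.

(** An extra element v of the saturation would give I_d + v a codimension less than [hf d a]. By
    Macaulay the strict inequality would reach I itself in a larger degree, where equality is
    assumed. *)
Lemma sat_large I a d0 : graded_ideal E I -> sorted geq a ->
  (forall d, (d0 <= d)%N -> cod (I d) = hf d a) ->
  forall d v, (d0 <= d)%N -> (size a <= d)%N -> sat E I v -> I d v.
Proof.
move=> gI sa h d v dd zd [k hk]; apply: contrapT => nv.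
have sI := (proj1 gI d).
have hW (w : 'rV_('C(n + d, n))) : (w <= spmx (@I d) + v)%MS -> satn E I k w.
  move=> /sub_addsmxP[[c c'] /= ->]; have [_ hD _] := satn_submod k d gI.
  apply: hD; last by apply: submod_mulmx => [|i]; [exact: satn_submod|rewrite (ord1 i) row_id].
  by apply: (satn_leq gI (leq0n k)) => /=; apply/spmxP => //; exact: submxMl.
have lt : (codim (spmx (@I d) + v)%MS < hf d a)%N.
  rewrite -(h d dd) ltnNge; apply/negP => c; apply: nv; apply/spmxP => //.
  apply: submx_trans (addsmxSr _ _) _; exact: codim_eq (addsmxSl _ _) c.
have [e de] := satn_strict gI sa hW zd lt.
by rewrite h ?ltnn //; exact: leq_trans de.
Qed.

(* For d large Green's theorem bounds the codimension of I_d + l S_(d-1) by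
   the difference P(d) - P(d-1), and Macaulay's theorem propagates this bound
   to all larger degrees. Hence multiplication by l is injective on S/I in
   large degrees, and then in all degrees as I is saturated. *)
Lemma exists_regular_form I a d0 : graded_ideal E I -> saturated E I -> sorted geq a ->
  (forall d, (d0 <= d)%N -> cod (I d) = hf d a) ->
  exists t, (forall d v, I d.+1 (v *m lform_mx E d t) -> I d v) /\
  exists d1, forall d, (d1 <= d)%N -> cod (hyper E I t (d := d)) = hf d (dec a).
Proof.
move=> gI sI sa h; pose d1 := maxn d0 (size a).
have [||t ht] := @green n E hE K hK d1 (spmx (I d1.+1)) a sa.
- by rewrite leqW // leq_maxr.
- by rewrite -/(cod _) h // leqW // leq_maxl.
exists t; have zd d : (d1 <= d)%N -> (size a <= d)%N by apply: leq_trans; apply: leq_maxr.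
have dd d : (d1 <= d)%N -> (d0 <= d)%N by apply: leq_trans; apply: leq_maxl.
have gJ := hyper_graded hE t gI.
have ub d : (d1 < d)%N -> (cod (@hyper _ E _ I t d) <= hf d (dec a))%N.
  move=> hd; apply: (@macaulay_family _ d1.+1) => //; first exact: sorted_dec.
    by apply: leq_trans (size_dec a) _; apply: zd.
  rewrite hf_dec //; last by apply: zd.
  apply: leq_trans ht; apply: codim_le; rewrite addsmx_sub.
  have sJ := proj1 gJ d1.+1; apply/andP; split; apply: le_spmx => // i.
    by apply: hyper_sub; apply/spmxP; [case: gI | exact: row_sub].
  by rewrite rowE; apply: hyper_lin.
have sC d : is_submod (fun v => I d.+1 (v *m lform_mx E d t)).
  by apply: submod_comp; case: gI.
have cl d : (d1 <= d)%N -> (cod (fun v => I d.+1 (v *m lform_mx E d t)) <= cod (I d))%N.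
  by move=> hd; apply: cod_le => // [|u]; [case: gI | exact: graded_lin].
have eq d : (d1 <= d)%N -> cod (fun v => I d.+1 (v *m lform_mx E d t)) = cod (I d) /\
    cod (@hyper _ E _ I t d.+1) = hf d.+1 (dec a).
  move=> hd; have := cod_hyper t d gI; have := cl d hd; have := ub d.+1 hd.
  have := h d (dd _ hd); have := h d.+1 (dd _ (leqW hd)).
  by have := hf_diff sa (leqW (zd _ hd)); lia.
split; last by exists d1.+1 => -[//|d] /eq[].
apply: (@saturated_lin _ _ hE _ _ _ d1) => // d v hd.
move: v; apply: (@cod_sub _ _ (I d) (fun v => I d.+1 (v *m lform_mx E d t))) => //.
- by case: gI.
- by move=> u; exact: graded_lin.
- by rewrite (eq d hd).1.
Qed.

Lemma hyper_sat_large I t a d0 : graded_ideal E I -> sorted geq a ->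
  (forall d, (d0 <= d)%N -> cod (@hyper _ E _ I t d) = hf d a) ->
  exists d1, forall d, (d1 <= d)%N ->
    (forall v, sat E (hyper E I t) v <-> @hyper _ E _ I t d v) /\ cod (@sat _ E _ (hyper E I t) d) = hf d a.
Proof.
move=> gI sa h; exists (maxn d0 (size a)) => d hd.
have e v : sat E (hyper E I t) v <-> @hyper _ E _ I t d v.
  split=> [|hv]; last exact: sat_sub.
  by apply: (sat_large (hyper_graded hE t gI) sa h); lia.
by split=> //; rewrite (cod_ext e) h //; lia.
Qed.

(** Induction on the leading exponent. For a regular form t one has I : t = I, so from d to d + 1
    the codimension of I grows by that of I + tS, which is at least that of its saturation, known by
    induction. Descending from large degrees this gives the upper bound; [cod_lower] gives the lower
    one. *)
Theorem gotzmann_regularity a I d0 : sorted geq a -> graded_ideal E I -> saturated E I ->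
  (forall d, (d0 <= d)%N -> cod (I d) = hf d a) ->
  forall d, (size a <= d)%N -> cod (I d) = hf d a.
Proof.
have [m] := ubnP (if a is x :: _ then x.+1 else 0)%N.
elim: m => [//|m IH] in a I d0 *; rewrite ltnS => hm sa gI sI h.
have [a0|a0] := eqVneq a [::].
  subst a; suff hI : forall d v, I d v.
    by move=> d _; rewrite (@cod_mx _ _ _ _ 1%:M) ?/codim ?mxrank1 ?subnn // => u; rewrite submx1; split.
  move=> d; have [k] := ubnP (d0 - d)%N; elim: k d => [//|k IHk] d dk v.
  have [le|lt] := leqP d0 d; last by apply: sI => i; apply: IHk; lia.
  by apply/spmxP; [case: gI | rewrite submx_full // codim0 // -/(cod _) h].
have [t [nzd [d1 hd1]]] := exists_regular_form gI sI sa h.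
have [d2 hd2] := hyper_sat_large gI (sorted_dec sa) hd1.
have gJ := hyper_graded hE t gI.
have reg : forall d, (size (dec a) <= d)%N -> cod (@sat _ E _ (hyper E I t) d) = hf d (dec a).
  apply: (@IH _ _ d2); rewrite ?sorted_dec //.
  - case E': (dec a) => [|x b]; first by case: (a) a0 hm => //= y s _; lia.
    have := head_dec a0 _ sa; rewrite E' => /(_ isT) /=.
    by case: (a) a0 hm => //= y s _; lia.
  - exact: sat_graded.
  - exact: sat_saturated.
  - by move=> d /hd2[].
have lb := cod_lower gI sa (fun d hd => eq_leq (esym (h d hd))).
have step d : (size a <= d)%N -> (cod (I d.+1) >= cod (I d) + hf d.+1 (dec a))%N.
  move=> zd; rewrite (cod_hyper t d gI); apply: leq_add.
    by apply: cod_le; [apply: submod_comp; case: gI|case: gI|move=> u /nzd].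
  rewrite -reg; last by apply: leq_trans (size_dec a) (leqW zd).
  apply: cod_le; [exact: (proj1 gJ)|exact: (proj1 (sat_graded hE gJ))|].
  by move=> u; apply: sat_sub.
move=> d zd; apply/eqP; rewrite eqn_leq lb // andbT.
have [k] := ubnP (d0 - d)%N; elim: k d zd => [//|k IHk] d zd dk.
have [le|lt] := leqP d0 d; first by rewrite h.
have := step d zd; have := IHk d.+1 (leqW zd); rewrite hf_diff ?(leqW zd) //.
by lia.
Qed.

End Regularity.

(** * Flatness and lifting over a local ring *)

(* The quotient of the row space by W is free of rank p: C induces the
   isomorphism with the free module and F is a section of it. *)
Definition free_quotient (R : comNzRingType) (p N : nat) (W : 'rV[R]_N -> Prop) : Prop :=
  exists (C : 'M[R]_(N, p)) (F : 'M[R]_(p, N)),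
    F *m C = 1%:M /\ forall v, W v <-> v *m C = 0.

Lemma free_quotientI (R : comNzRingType) (p N : nat) (W : 'rV[R]_N -> Prop)
    (C : 'M[R]_(N, p)) (F : 'M[R]_(p, N)) : is_submod W ->
  (forall v, W (v - v *m C *m F)) -> (forall c, W (c *m F) -> c = 0) ->
  F *m C = 1%:M /\ forall v, W v <-> v *m C = 0.
Proof.
move=> sW h1 h2; have h3 v : W v -> v *m C = 0.
  move=> hv; apply: h2; rewrite -[_ *m F](subKr v); exact: submodB.
split=> [|v]; last by split=> [/h3//|e]; have := h1 v; rewrite e mul0mx subr0.
apply/row_matrixP => i; rewrite row_mul row1; apply/eqP; rewrite -subr_eq0; apply/eqP.
by apply: h2; rewrite mulmxBl -rowE -opprB; apply: submodN.
Qed.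

Lemma satn_map_mx (B K : comNzRingType) (g : {rmorphism B -> K}) n
    (E : forall d, 'I_('C(n + d, n)) -> 'X_{1..n.+1}) (I : gfamily n B) (I' : gfamily n K) :
  (forall d v, I d v -> I' d (map_mx g v)) ->
  forall k d v, @satn n E B I k d v -> @satn n E K I' k d (map_mx g v).
Proof.
move=> h; elim=> [|k IH] d v /=; first exact: h.
by move=> hv i; have := IH _ _ (hv i); rewrite map_mxM mult_mx_map.
Qed.

(** * Linear algebra over a local ring [B] with residue field [K] *)

Section Local.
Context (B : comNzRingType) (K : fieldType) (g : {rmorphism B -> K}).
Hypothesis gsurj : forall x, exists b, g b = x.
Hypothesis gunit : forall b, g b != 0 -> exists b', b * b' = 1.

Lemma lift_mx m p (M : 'M[K]_(m, p)) : exists M', map_mx g M' = M.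
Proof.
have [h hh] := choice gsurj.
by exists (map_mx h M); apply/matrixP => i j; rewrite !mxE hh.
Qed.

Lemma local_inv p (M : 'M[B]_p) : map_mx g M \in unitmx ->
  exists N, N *m M = 1%:M /\ M *m N = 1%:M.
Proof.
rewrite unitmxE unitfE det_map_mx => /gunit[d hd].
exists (d *: \adj M); rewrite -scalemxAl -scalemxAr mul_adj_mx mul_mx_adj.
by rewrite scale_scalar_mx mulrC hd.
Qed.

Lemma local_left_inv m p (M : 'M[B]_(m, p)) : row_full (map_mx g M) ->
  exists Z, Z *m M = 1%:M.
Proof.
move=> /row_fullP[Z hZ]; have [Z' hZ'] := lift_mx Z.
have [|N [hN _]] := @local_inv _ (Z' *m M); first by rewrite map_mxM hZ' hZ unitmx1.
by exists (N *m Z'); rewrite -mulmxA.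
Qed.

Lemma local_right_inv m p (M : 'M[B]_(m, p)) : row_free (map_mx g M) ->
  exists Z, M *m Z = 1%:M.
Proof.
move=> /row_freeP[Z hZ]; have [Z' hZ'] := lift_mx Z.
have [|N [_ hN]] := @local_inv _ (M *m Z'); first by rewrite map_mxM hZ' hZ unitmx1.
by exists (Z' *m N); rewrite mulmxA.
Qed.

Section Pairs.
Context (N : nat).
Implicit Types (W : 'rV[B]_N -> Prop) (Wk : 'rV[K]_N -> Prop).

Definition maps W Wk := forall v, W v -> Wk (map_mx g v).

Definition onto W Wk := forall u, Wk u -> exists2 v, W v & map_mx g v = u.

(* The equational criterion for the flatness of the quotient by W, tested on
   the K-valued functionals u on the ideal generated by the entries of c. *)
Definition flat_pair W Wk := forall p (c : 'rV[B]_p) (b : 'M[B]_(p, N)), W (c *m b) ->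
  forall u : 'rV[K]_p, (forall a : 'cV[B]_p, c *m a = 0 -> u *m map_mx g a = 0) ->
  Wk (u *m map_mx g b).

Definition indep_pair W Wk := forall p (F : 'M[B]_(p, N)),
  (forall u, Wk (u *m map_mx g F) -> u = 0) -> forall c, W (c *m F) -> c = 0.

(** If the relations a with c a = 0 reduced to a proper subspace over K, a nonzero functional u
    would kill it, and flatness would turn u into a dependence of the family on the fibre. So they
    reduce to everything, and lifts of a basis form an invertible matrix A with c A = 0. *)
Lemma flat_indep W Wk : flat_pair W Wk -> indep_pair W Wk.
Proof.
move=> fl p F hF c hc.
pose T (x : 'rV[K]_p) := exists2 a : 'cV[B]_p, c *m a = 0 & x = (map_mx g a)^T.
have sT : is_submod T.
  split=> [|x y [a ha ->] [b hb ->]|x y [a ha ->]].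
  - by exists 0; rewrite ?mulmx0 // map_mx0 trmx0.
  - by exists (a + b); rewrite ?mulmxDr ?ha ?hb ?addr0 // map_mxD linearD.
  - have [b <-] := gsurj x; exists (b *: a); last by rewrite map_mxZ linearZ.
    by rewrite -scalemxAr ha scaler0.
have full : row_full (spmx T).
  rewrite -col_leq_rank leqNgt; apply/negP => lt.
  have : kermx (spmx T)^T != 0 by rewrite -mxrank_eq0 mxrank_ker mxrank_tr; lia.
  move=> /rowV0Pn[u /sub_kermxP hu /eqP u0]; apply: u0; apply: hF; apply: fl hc _ _.
  move=> a ha; have /spmxP-/(_ sT)/submxP[x hx] : T (map_mx g a)^T by exists a.
  by apply: trmx_inj; rewrite trmx_mul hx -mulmxA -[spmx T]trmxK -trmx_mul hu !trmx0 mulmx0.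
have /fin_all_exists2[a ha1 ha2] (j : 'I_p) : T (delta_mx 0 j).
  by apply/spmxP => //; exact: submx_full.
pose A : 'M[B]_p := \matrix_(i, j) a j i 0.
have [|A' [_ hA']] := @local_inv _ A.
  suff -> : map_mx g A = 1%:M by exact: unitmx1.
  by apply/matrixP=> i j; have := congr1 (fun M : 'rV[K]_p => M 0 i) (ha2 j); rewrite !mxE eqxx.
rewrite -[c]mulmx1 -hA' mulmxA; suff -> : c *m A = 0 by rewrite mul0mx.
apply/rowP => j; have := congr1 (fun M : 'M[B]_1 => M 0 0) (ha1 j); rewrite !mxE => h.
rewrite -[RHS]h; by apply: eq_bigr => i _; rewrite mxE.
Qed.

Lemma free_ker W Wk p (C : 'M[B]_(N, p)) (F : 'M[B]_(p, N)) : maps W Wk -> onto W Wk ->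
  F *m C = 1%:M -> (forall v, W v <-> v *m C = 0) ->
  forall u, Wk u <-> u *m map_mx g C = 0.
Proof.
move=> hm ho hFC hC u; split=> [/ho[v /hC hv <-]|hu].
  by rewrite -map_mxM hv map_mx0.
have [v hv] := lift_mx u.
have : W (v - v *m C *m F) by apply/hC; rewrite mulmxBl -!mulmxA hFC mulmx1 subrr.
by move=> /hm; rewrite map_mxB !map_mxM hv hu mul0mx subr0.
Qed.

Lemma free_flat W Wk p : maps W Wk -> onto W Wk -> free_quotient p W -> flat_pair W Wk.
Proof.
move=> hm ho [C [F [hFC hC]]] q c b /hC hcb u hu.
apply/(free_ker hm ho hFC hC); rewrite -mulmxA -map_mxM; apply/matrixP => i j.
have /hu e : c *m col j (b *m C) = 0 by rewrite colE !mulmxA hcb mul0mx.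
have := congr1 (fun M : 'M[K]_1 => M i 0) e; rewrite !mxE => h.
rewrite -[RHS]h; by apply: eq_bigr => k _; rewrite !mxE.
Qed.

Lemma complement_mx p (Wk : 'rV[K]_N -> Prop) : is_submod Wk -> cod Wk = p ->
  exists F : 'M[K]_(p, N), (forall u, Wk (u *m F) -> u = 0) /\
    row_full (col_mx (spmx Wk) F).
Proof.
move=> sW hp; have e : \rank (spmx Wk)^C%MS = p by rewrite mxrank_compl.
have [F [hF1 hF2]] : exists F : 'M[K]_(p, N), row_free F /\ (F :=: (spmx Wk)^C)%MS.
  by rewrite -e; exists (row_base (spmx Wk)^C%MS); split; [exact: row_base_free|exact: eq_row_base].
exists F; split.
  move=> u /spmxP-/(_ sW) hu; apply: (row_free_inj hF1); rewrite mul0mx; apply/eqP.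
  rewrite -submx0 -(capmx_compl (spmx Wk)) sub_capmx hu /= -hF2; exact: submxMl.
by rewrite -sub1mx -addsmxE (adds_eqmx (eqmx_refl _) hF2) sub1mx addsmx_compl_full.
Qed.

(** Nakayama: lifts to W of generators of Wk and a lift [F] of a complementary basis generate the
    free module. So [F] generates the quotient, and [indep_pair] makes it a basis. *)
Lemma local_free W Wk p : is_submod W -> is_submod Wk -> onto W Wk ->
  indep_pair W Wk -> cod Wk = p -> free_quotient p W.
Proof.
move=> sW sWk ho hi /(complement_mx sWk)[Fk [hF full]].
have [F eF] := lift_mx Fk.
have /fin_all_exists2[w hw1 hw2] (i : 'I_N) : exists2 v, W v & map_mx g v = row i (spmx Wk).
  by apply: ho; apply/spmxP => //; exact: row_sub.
pose w' := \matrix_i w i.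
have [|Z hZ] := @local_left_inv _ _ (col_mx w' F).
  rewrite map_col_mx eF; suff -> : map_mx g w' = spmx Wk by [].
  by apply/row_matrixP => i; rewrite -map_row rowK hw2.
exists (rsubmx Z), F; apply: free_quotientI => //; last first.
  by apply: hi => u; rewrite eF; apply: hF.
move=> v; rewrite -{1}[v]mulmx1 -hZ -{1}[Z]hsubmxK mul_row_col mulmxDr !mulmxA addrK.
by apply: submod_mulmx => // i; rewrite rowK.
Qed.

(** Lifts to W' of generators of Wk together with the basis [F] of the quotient by W span
    everything. An element of W has no component on [F], hence is a combination of the lifts. *)
Lemma nakayama_eq W' W Wk p : is_submod W' -> (forall v, W' v -> W v) -> is_submod W ->
  maps W Wk -> is_submod Wk -> onto W' Wk -> free_quotient p W ->
  forall v, W v -> W' v.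
Proof.
move=> sW' hs sW hm sWk ho [C [F [hFC hC]]] v hv.
have hk := free_ker hm (fun u hu => let: ex_intro2 v h1 h2 := ho u hu in
  ex_intro2 _ _ v (hs v h1) h2) hFC hC.
have /fin_all_exists2[w hw1 hw2] (i : 'I_N) : exists2 v, W' v & map_mx g v = row i (spmx Wk).
  by apply: ho; apply/spmxP => //; exact: row_sub.
pose w' := \matrix_i w i.
have [|Z hZ] := @local_left_inv _ _ (col_mx w' F).
  rewrite map_col_mx; have -> : map_mx g w' = spmx Wk.
    by apply/row_matrixP => i; rewrite -map_row rowK hw2.
  rewrite -sub1mx -addsmxE -[1%:M](subrK (map_mx g C *m map_mx g F)).
  apply: addmx_sub_adds; last exact: submxMl.
  apply: le_spmx => // i; apply/hk; rewrite -row_mul mulmxBl mul1mx -mulmxA.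
  by rewrite -(map_mxM g F) hFC map_mx1 mulmx1 subrr row0.
have hww i : W' (row i w') by rewrite rowK.
have e : v = v *m lsubmx Z *m w' + v *m rsubmx Z *m F.
  by rewrite -{1}[v]mulmx1 -hZ -{1}[Z]hsubmxK mul_row_col mulmxDr !mulmxA.
have h1 : W' (v *m lsubmx Z *m w') by apply: submod_mulmx.
have : W (v *m rsubmx Z *m F).
  by apply: (submod_addr sW (hs _ h1)); rewrite addrC -e.
by move=> /hC; rewrite -!mulmxA hFC mulmx1 => h2; rewrite e h2 mul0mx addr0.
Qed.

End Pairs.

Context (n : nat) (E : forall d, 'I_('C(n + d, n)) -> 'X_{1..n.+1}).
Hypothesis hE : forall d, monomial_basis d (@E d).
Implicit Types (I : gfamily n B) (Ik : gfamily n K).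

Lemma sat_maps I Ik : (forall d, maps (@I d) (@Ik d)) ->
  forall d, maps (@sat _ E _ I d) (@sat _ E _ Ik d).
Proof. by move=> h d v [k hk]; exists k; apply: satn_map_mx hk. Qed.

Lemma hyper_maps I Ik t : (forall d, maps (@I d) (@Ik d)) ->
  forall d, maps (@hyper _ E _ I t d) (@hyper _ E _ Ik (map_mx g t) d).
Proof.
move=> h [|d] v /=; first exact: h.
by case=> u /h; rewrite map_mxB map_mxM lform_mx_map => hu; exists (map_mx g u).
Qed.

Lemma satn_flat I Ik k d : (forall e, (d + k <= e)%N -> flat_pair (@I e) (@Ik e)) ->
  flat_pair (@satn _ E _ I k d) (@satn _ E _ Ik k d).
Proof.
elim: k d => [|k IH] d h; first by apply: h; rewrite addn0.
move=> p c b hb u hu i; rewrite -mulmxA -(mult_mx_map E g) -map_mxM.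
apply: (IH d.+1 _ _ c) => //; first by move=> e; rewrite addSnnS; apply: h.
by rewrite mulmxA; apply: hb.
Qed.

(** Membership in the saturation is tested after multiplication into higher degrees; enlarging the
    exponent k by d0 reaches degrees where flatness is known. *)
Lemma sat_flat I Ik d0 : graded_ideal E I ->
  (forall d, (d0 <= d)%N -> flat_pair (@I d) (@Ik d)) ->
  forall d, flat_pair (@sat _ E _ I d) (@sat _ E _ Ik d).
Proof.
move=> gI h d p c b [k hk] u hu; exists (k + d0)%N.
apply: (@satn_flat I Ik _ d) hu => [e he|]; first by apply: h; lia.
by apply: satn_leq hk => //; lia.
Qed.

Lemma hyper_onto I Ik t d : onto (@I d) (@Ik d) ->
  onto (@hyper _ E _ I t d) (@hyper _ E _ Ik (map_mx g t) d).
Proof.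
case: d => [//|d] h v /= [u /h[w hw e]].
have [u' hu'] := lift_mx u; exists (w + u' *m lform_mx E d t).
  by exists u'; rewrite addrK.
by rewrite map_mxD e map_mxM lform_mx_map hu' subrK.
Qed.

(** If [F] is a basis of S_d/I_d, then t times [F] is independent on the special fibre, hence over
    B, so t v in I forces the coordinates of v to vanish. This covers large degrees, and saturation
    extends it to all. *)
Lemma lform_regular I Ik t d0 : graded_ideal E I -> saturated E I ->
  (forall d, maps (@I d) (@Ik d)) -> (forall d, indep_pair (@I d) (@Ik d)) ->
  (forall d, (d0 <= d)%N -> exists p, free_quotient p (@I d)) ->
  (forall d v, Ik d.+1 (v *m lform_mx E d (map_mx g t)) -> Ik d v) ->
  (forall d, (d0 <= d)%N -> onto (@I d) (@Ik d)) ->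
  forall d v, I d.+1 (v *m lform_mx E d t) -> I d v.
Proof.
move=> gI sI hm hi hf nzd ho; apply: (saturated_lin hE (d0 := d0)) => // d v hd hv.
have [p [C [F [hFC hC]]]] := hf d hd; apply/hC.
apply: (hi d.+1 _ (F *m lform_mx E d t)) => [u|].
  rewrite map_mxM mulmxA lform_mx_map => /nzd/(free_ker (hm d) (ho d hd) hFC hC).
  by rewrite -mulmxA -map_mxM hFC map_mx1 mulmx1.
rewrite mulmxA; have : I d (v - v *m C *m F).
  by apply/hC; rewrite mulmxBl -!mulmxA hFC mulmx1 subrr.
move=> /(graded_lin t gI); rewrite mulmxBl => h.
by have := submodB (proj1 gI d.+1) hv h; rewrite subKr.
Qed.

(** A family independent modulo Ik + tS, joined with t times a basis of S_d/I_d, is independent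
    modulo Ik. The joint family lifts to one independent modulo I, and a relation modulo I + tS is a
    relation between its members. *)
Lemma hyper_indep I Ik t d p : graded_ideal E I -> graded_ideal E Ik ->
  (forall d, maps (@I d) (@Ik d)) -> (forall d, indep_pair (@I d) (@Ik d)) ->
  free_quotient p (@I d) -> onto (@I d) (@Ik d) ->
  (forall v, Ik d.+1 (v *m lform_mx E d (map_mx g t)) -> Ik d v) ->
  indep_pair (@hyper _ E _ I t d.+1) (@hyper _ E _ Ik (map_mx g t) d.+1).
Proof.
move=> gI gIk hm hi [C [F [hFC hC]]] ho nzd q F' hF' c [h hh].
have hind : forall u, Ik d.+1 (u *m map_mx g (col_mx F' (F *m lform_mx E d t))) -> u = 0.
  move=> u; rewrite -[u]hsubmxK map_col_mx mul_row_col map_mxM lform_mx_map mulmxA => hu.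
  have u1 : lsubmx u = 0.
    by apply: hF'; exists (- (rsubmx u *m map_mx g F)); rewrite mulNmx opprK.
  rewrite u1 mul0mx add0r in hu; move/nzd/(free_ker (hm d) ho hFC hC): hu.
  by rewrite -mulmxA -map_mxM hFC map_mx1 mulmx1 u1 => ->; rewrite row_mx0.
have : row_mx c (- (h *m C)) = 0.
  apply: (hi _ _ _ hind); rewrite mul_row_col mulNmx mulmxA.
  have : I d (h - h *m C *m F) by apply/hC; rewrite mulmxBl -!mulmxA hFC mulmx1 subrr.
  move=> /(graded_lin t gI) hh2; case: (proj1 gI d.+1) => _ hD _.
  by have := hD _ _ hh hh2; rewrite mulmxBl addrA subrK.
by move=> e; have := congr1 lsubmx e; rewrite row_mxKl linear0.
Qed.

(* A section f of Ik_d is lifted by lifting l f to I_(d+1) and correcting the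
   lift modulo the maximal ideal. This is possible because J = I + l S is
   saturated in degree d + 1 with a free quotient, which follows from the
   theorem for the saturation of J. *)
Theorem local_descent (hK : injective (fun i : nat => i%:R : K)) a I Ik d0 :
  sorted geq a -> graded_ideal E I -> graded_ideal E Ik ->
  saturated E I -> saturated E Ik ->
  (forall d, maps (@I d) (@Ik d)) -> (forall d, flat_pair (@I d) (@Ik d)) ->
  (forall d, (d0 <= d)%N -> cod (@Ik d) = hf d a) ->
  (forall d, (d0 <= d)%N -> onto (@I d) (@Ik d)) ->
  forall d, (size a <= d)%N -> onto (@I d) (@Ik d).
Proof.
have [m] := ubnP (if a is x :: _ then x.+1 else 0)%N.
elim: m => [//|m IH] in a I Ik d0 *; rewrite ltnS => am sa gI gIk sI sIk hm hfl hcod ho.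
have hi d := flat_indep (hfl d).
have hfree d : (d0 <= d)%N -> free_quotient (hf d a) (@I d).
  move=> hd; apply: (@local_free _ _ (@Ik d)) => //; [exact: (proj1 gI)|exact: (proj1 gIk)|exact: ho|exact: hcod].
have [a0|a0] := eqVneq a [::].
  subst a; suff hI : forall d v, I d v.
    by move=> d _ u _; have [v <-] := lift_mx u; exists v.
  move=> d; have [k] := ubnP (d0 - d)%N; elim: k d => [//|k IHk] d dk v.
  have [le|lt] := leqP d0 d; last by apply: sI => i; apply: IHk; lia.
  have [C [F [_ hC]]] := hfree d le; apply/hC; exact: thinmx0.
have reg := gotzmann_regularity hE hK sa gIk sIk hcod.
have [tk [nzdk [d1 hd1]]] := exists_regular_form hE hK gIk sIk sa hcod.
have [t et] := lift_mx tk; subst tk.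
have hfree' d : (d0 <= d)%N -> exists p, free_quotient p (@I d).
  by move=> /hfree; exists (hf d a).
have nzd := lform_regular gI sI hm hi hfree' nzdk ho.
have [d2 hd2] := hyper_sat_large hE hK gIk (sorted_dec sa) hd1.
have gJ := hyper_graded hE t gI; have gJk := hyper_graded hE (map_mx g t) gIk.
have mJ := hyper_maps (t := t) hm.
(* Freeness of S/(I + tS) in degree d uses that of S/I in degree d - 1, whence [d0.+1]. *)
pose d3 := maxn d0.+1 (maxn d1 d2).
have flJ d : (d3 <= d)%N -> flat_pair (@hyper _ E _ I t d) (@hyper _ E _ Ik (map_mx g t) d).
  case: d => [|d] hd; first by move: hd; rewrite /d3; lia.
  have od : onto (@I d) (@Ik d) by apply: ho; move: hd; rewrite /d3; lia.
  have oJ : onto (@hyper _ E _ I t d.+1) (@hyper _ E _ Ik (map_mx g t) d.+1).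
    by apply: hyper_onto; apply: ho; move: hd; rewrite /d3; lia.
  apply: (free_flat (p := hf d.+1 (dec a)) (mJ d.+1) oJ).
  apply: (local_free (proj1 gJ d.+1) (proj1 gJk d.+1) oJ); last first.
    by apply: hd1; move: hd; rewrite /d3; lia.
  by apply: hyper_indep => //; [apply: hfree; move: hd; rewrite /d3; lia|exact: nzdk].
have gsJ := sat_graded hE gJ; have gsJk := sat_graded hE gJk.
have ssJ := sat_saturated gJ; have ssJk := sat_saturated gJk.
have msJ := sat_maps mJ.
have flsJ := sat_flat gJ flJ.
have csJ d : (d3 <= d)%N -> cod (@sat _ E _ (hyper E Ik (map_mx g t)) d) = hf d (dec a).
  by move=> hd; apply: (hd2 d _).2; move: hd; rewrite /d3; lia.
have osJ : forall d, (size (dec a) <= d)%N ->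
    onto (@sat _ E _ (hyper E I t) d) (@sat _ E _ (hyper E Ik (map_mx g t)) d).
  apply: (@IH _ _ _ d3) => //.
  - case E': (dec a) => [|x b]; first by case: (a) a0 am => //= y s _; lia.
    have := head_dec a0 _ sa; rewrite E' => /(_ isT) /=.
    by case: (a) a0 am => //= y s _; lia.
  - exact: sorted_dec.
  move=> d hd u; have d2d : (d2 <= d)%N by move: hd; rewrite /d3; lia.
  have [h _] := hd2 d d2d; move=> /h hu.
  have [|v hv <-] := @hyper_onto I Ik t d _ _ hu.
    by apply: ho; move: hd; rewrite /d3; lia.
  by exists v => //; apply: sat_sub.
have regs := gotzmann_regularity hE hK (sorted_dec sa) gsJk ssJk csJ.
move=> d zd; have [k] := ubnP (d0 - d)%N; elim: k d zd => [//|k IHk] d zd dk.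
have [le|lt] := leqP d0 d; first exact: ho.
have {IHk} oe := IHk d.+1 (leqW zd) ltac:(lia).
have zde : (size (dec a) <= d.+1)%N by apply: leq_trans (size_dec a) (leqW zd).
(* Both have codimension [hf d.+1 (dec a)]: the saturation by its own regularity, the section itself
   by the regularity of Ik in degrees d and d + 1. *)
have eqJk u : sat E (hyper E Ik (map_mx g t)) u -> @hyper _ E _ Ik (map_mx g t) d.+1 u.
  move: u; apply: cod_sub; [exact: (proj1 gJk)|exact: (proj1 gsJk)|by move=> u; apply: sat_sub|].
  rewrite regs //; have := cod_hyper (map_mx g t) d gIk.
  rewrite (_ : cod (fun v => Ik d.+1 (v *m lform_mx E d (map_mx g t))) = cod (@Ik d)).
    2: by apply: cod_ext => v; split=> [/nzdk//|]; apply: graded_lin.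
  by rewrite !reg ?(leqW zd) // hf_diff ?(leqW zd) //; lia.
have oJ : onto (@hyper _ E _ I t d.+1) (@sat _ E _ (hyper E Ik (map_mx g t)) d.+1).
  by move=> u /eqJk /(hyper_onto (t := t) oe).
have fsJ : free_quotient (hf d.+1 (dec a)) (@sat _ E _ (hyper E I t) d.+1).
  apply: (local_free (proj1 gsJ d.+1) (proj1 gsJk d.+1)); [exact: osJ|exact: flat_indep|exact: regs].
have eqJ : forall v, sat E (hyper E I t) v -> @hyper _ E _ I t d.+1 v.
  apply: (nakayama_eq (proj1 gJ d.+1) _ (proj1 gsJ d.+1) (msJ d.+1) (proj1 gsJk d.+1) oJ fsJ).
  by move=> v; apply: sat_sub.
have [C [F [hFC hC]]] := fsJ.
move=> u hu; have [f hf] := lift_mx u.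
have [i hi1 hi2] := oe _ (graded_lin (map_mx g t) gIk hu).
(* [y] lies in J = I + tS and vanishes on the special fibre. Writing it as a combination of the rows
   of 1 - C F, which lie in J too, gives y = t y U' modulo I, so f + y U' multiplied by t lies in I.
   The correction y U' vanishes on the special fibre because y does. *)
pose y := i - f *m lform_mx E d t.
have hy : y *m C = 0.
  apply/hC/sat_sub; rewrite /y; apply: submodB; [exact: (proj1 gJ)|exact: hyper_sub|exact: hyper_lin].
have /fin_all_exists[U hU] j : @hyper _ E _ I t d.+1 (row j (1%:M - C *m F)).
  by apply: eqJ; apply/hC; rewrite -row_mul mulmxBl mul1mx -mulmxA hFC mulmx1 subrr row0.
pose U' := \matrix_j U j.
have hyU : I d.+1 (y - y *m U' *m lform_mx E d t).
  rewrite -mulmxA -{1}[y]mulmx1 -mulmxBr.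
  have -> : y *m (1%:M - U' *m lform_mx E d t) = y *m (1%:M - C *m F - U' *m lform_mx E d t).
    by rewrite !mulmxBr !mulmxA hy mul0mx subr0.
  apply: submod_mulmx; first exact: (proj1 gI).
  by move=> j; rewrite linearB /= row_mul rowK.
exists (f + y *m U').
  apply: nzd; rewrite mulmxDl.
  have := submodB (proj1 gI d.+1) hi1 hyU.
  by rewrite {1}/y !opprD !opprK !addrA subrr add0r.
rewrite map_mxD map_mxM hf /y map_mxB map_mxM lform_mx_map hi2 hf.
by rewrite subrr mul0mx addr0.
Qed.

End Local.

(** * Quotients and localization *)

Section Classes.
Context (T : Type) (e : T -> T -> Prop).

Definition classes_of := {C : T -> Prop | exists x, C = e x}.

Definition class_of (x : T) : classes_of := exist _ (e x) (ex_intro _ x erefl).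

Definition class_repr (q : classes_of) : T := projT1 (cid (proj2_sig q)).

Lemma class_reprK q : class_of (class_repr q) = q.
Proof.
case: q => C hC; apply: eq_exist => /=; rewrite /class_repr; case: cid => x /= hx.
by rewrite hx.
Qed.

Hypotheses (er : forall x, e x x) (es : forall x y, e x y -> e y x)
  (et : forall x y z, e x y -> e y z -> e x z).

Lemma class_of_eq x y : class_of x = class_of y <-> e x y.
Proof.
split=> [h|h]; first by have := congr1 (fun q => proj1_sig q y) h => /= ->.
apply: eq_exist; apply: funext => z /=; apply: propext.
by split; apply: et => //; apply: es.
Qed.

End Classes.

Section QuotientModule.
Context (R : comNzRingType) (V : lmodType R) (W : V -> Prop) (hW : is_submod W).

Definition quot_rel (x y : V) := W (x - y).

(** The proof of [is_submod W] is an argument of the type because the module structure depends on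
    it. *)
Definition quotient_of of is_submod W := classes_of quot_rel.
Local Notation Q := (quotient_of hW).
Local Notation pi := (class_of quot_rel).

HB.instance Definition _ := gen_eqMixin Q.
HB.instance Definition _ := gen_choiceMixin Q.

Lemma quot_eq x y : pi x = pi y <-> W (x - y).
Proof.
case: (hW) => h0 hD hZ; apply: class_of_eq => [{}x|{}x {}y h|{}x {}y z h1 h2].
- by rewrite /quot_rel subrr.
- by rewrite /quot_rel -opprB; apply: submodN.
- by rewrite /quot_rel -[x](subrK y) -addrA; apply: hD.
Qed.

Lemma quot_repr (q : Q) : exists x, q = pi x.
Proof. by exists (class_repr q); rewrite class_reprK. Qed.

Definition quot_add (p q : Q) : Q := pi (class_repr p + class_repr q).
Definition quot_opp (p : Q) : Q := pi (- class_repr p).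
Definition quot_scale a (p : Q) : Q := pi (a *: class_repr p).

Lemma quot_reprB x : W (class_repr (pi x) - x).
Proof. by apply/quot_eq; rewrite class_reprK. Qed.

Lemma quot_addE x y : quot_add (pi x) (pi y) = pi (x + y).
Proof.
by apply/quot_eq; case: (hW) => _ hD _; rewrite opprD addrACA; apply: hD; exact: quot_reprB.
Qed.

Lemma quot_oppE x : quot_opp (pi x) = pi (- x).
Proof. by apply/quot_eq; rewrite -opprD; apply: submodN => //; exact: quot_reprB. Qed.

Lemma quot_scaleE a x : quot_scale a (pi x) = pi (a *: x).
Proof.
by apply/quot_eq; rewrite -scalerBr; case: (hW) => _ _; apply; exact: quot_reprB.
Qed.

Fact quot_addA : associative quot_add.
Proof.
move=> p q s; have [[x ->] [y ->] [z ->]] := And3 (quot_repr p) (quot_repr q) (quot_repr s).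
by rewrite !quot_addE addrA.
Qed.

Fact quot_addC : commutative quot_add.
Proof.
by move=> p q; have [[x ->] [y ->]] := conj (quot_repr p) (quot_repr q); rewrite !quot_addE addrC.
Qed.

Fact quot_add0 : left_id (pi 0 : Q) quot_add.
Proof. by move=> p; have [x ->] := quot_repr p; rewrite quot_addE add0r. Qed.

Fact quot_addN : left_inverse (pi 0 : Q) quot_opp quot_add.
Proof. by move=> p; have [x ->] := quot_repr p; rewrite quot_oppE quot_addE addNr. Qed.

HB.instance Definition _ := GRing.isZmodule.Build Q quot_addA quot_addC quot_add0 quot_addN.

Fact quot_scaleA a b v : quot_scale a (quot_scale b v) = quot_scale (a * b) v.
Proof. by have [x ->] := quot_repr v; rewrite !quot_scaleE scalerA. Qed.

Fact quot_scale1 : left_id 1 quot_scale.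
Proof. by move=> v; have [x ->] := quot_repr v; rewrite !quot_scaleE scale1r. Qed.

Fact quot_scaleDr : right_distributive quot_scale +%R.
Proof.
move=> a p q; have [[x ->] [y ->]] := conj (quot_repr p) (quot_repr q).
change (quot_scale a (quot_add (pi x) (pi y)) =
  quot_add (quot_scale a (pi x)) (quot_scale a (pi y))).
by rewrite !(quot_scaleE, quot_addE) scalerDr.
Qed.

Fact quot_scaleDl v : {morph quot_scale^~ v : a b / a + b}.
Proof.
move=> a b; have [x ->] := quot_repr v.
change (quot_scale (a + b) (pi x) = quot_add (quot_scale a (pi x)) (quot_scale b (pi x))).
by rewrite !quot_scaleE quot_addE scalerDl.
Qed.

HB.instance Definition _ :=
  GRing.Zmodule_isLmodule.Build R Q quot_scaleA quot_scale1 quot_scaleDr quot_scaleDl.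

Definition quot_pi (x : V) : Q := pi x.

Lemma quot_pi_linear : linear quot_pi.
Proof. by move=> a x y; rewrite /quot_pi -quot_addE -quot_scaleE. Qed.

HB.instance Definition _ := GRing.isLinear.Build R V Q _ quot_pi quot_pi_linear.

Lemma quot_pi0 x : quot_pi x = 0 <-> W x.
Proof. by rewrite -[X in W X]subr0; exact: quot_eq. Qed.

Lemma quot_pi_surj q : exists x, q = quot_pi x.
Proof. exact: quot_repr. Qed.

End QuotientModule.

Record local_datum (R : comNzRingType) := LocalDatum {
  datum_prime : R -> Prop;
  datum_ideal : R -> Prop;
  datum_primeP : is_prime_ideal datum_prime;
  datum_idealP : is_ideal datum_ideal;
  datum_sub : forall x, datum_ideal x -> datum_prime x }.

(* The localization of R/J at the prime P/J, where J and P are the two ideals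
   of the datum. The case J = 0 gives the local ring and the case J = P the
   residue field of P. *)
Section Localization.
Context (R : comNzRingType) (D : local_datum R).
Local Notation P := (datum_prime D).
Local Notation J := (datum_ideal D).

Record fraction := Fraction { frac_num : R; frac_den : R; frac_denP : ~ P frac_den }.

Definition frac_rel (x y : fraction) := exists2 u, ~ P u &
  J (u * (frac_num x * frac_den y - frac_num y * frac_den x)).

Definition localized := classes_of frac_rel.
Local Notation L := localized.
Local Notation pi := (class_of frac_rel).

HB.instance Definition _ := gen_eqMixin L.
HB.instance Definition _ := gen_choiceMixin L.

Lemma primeM x y : ~ P x -> ~ P y -> ~ P (x * y).
Proof. by move=> hx hy; case: (datum_primeP D) => _ _ h /h[]. Qed.

Lemma prime1 : ~ P 1.
Proof. by case: (datum_primeP D). Qed.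

Lemma frac_eq x y : pi x = pi y <-> frac_rel x y.
Proof.
have [j0 jD jM] := datum_idealP D.
apply: class_of_eq => [{}x|{}x {}y [u hu h]|{}x {}y z [u hu h1] [v hv h2]].
- by exists 1; [exact: prime1|rewrite subrr mulr0].
- by exists u => //; rewrite -opprB mulrN -mulN1r; apply: jM.
exists (u * v * frac_den y); first by do !apply: primeM => //; exact: frac_denP.
have := jD _ _ (jM (v * frac_den z) _ h1) (jM (u * frac_den x) _ h2).
by congr J; ring.
Qed.

Lemma frac_repr (x : L) : exists f, x = pi f.
Proof. by exists (class_repr x); rewrite class_reprK. Qed.

Lemma frac_reprE f : frac_rel (class_repr (pi f)) f.
Proof. by apply/frac_eq; rewrite class_reprK. Qed.

Definition frac_add (x y : fraction) := Fraction
  (frac_num x * frac_den y + frac_num y * frac_den x)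
  (primeM (@frac_denP x) (@frac_denP y)).
Definition frac_mul (x y : fraction) := Fraction
  (frac_num x * frac_num y) (primeM (@frac_denP x) (@frac_denP y)).
Definition frac_opp (x : fraction) := Fraction (- frac_num x) (@frac_denP x).
Definition frac_of (a : R) := Fraction (a) prime1.

Definition loc_add (x y : L) : L := pi (frac_add (class_repr x) (class_repr y)).
Definition loc_mul (x y : L) : L := pi (frac_mul (class_repr x) (class_repr y)).
Definition loc_opp (x : L) : L := pi (frac_opp (class_repr x)).

Lemma loc_addE f h : loc_add (pi f) (pi h) = pi (frac_add f h).
Proof.
have [j0 jD jM] := datum_idealP D.
apply/frac_eq; have [u hu h1] := frac_reprE f; have [v hv h2] := frac_reprE h.
exists (u * v); first exact: primeM.
have := jD _ _ (jM (v * frac_den h * frac_den (class_repr (pi h))) _ h1)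
  (jM (u * frac_den f * frac_den (class_repr (pi f))) _ h2).
by congr J; rewrite /frac_add /=; ring.
Qed.

Lemma loc_mulE f h : loc_mul (pi f) (pi h) = pi (frac_mul f h).
Proof.
have [j0 jD jM] := datum_idealP D.
apply/frac_eq; have [u hu h1] := frac_reprE f; have [v hv h2] := frac_reprE h.
exists (u * v); first exact: primeM.
have := jD _ _ (jM (v * frac_num (class_repr (pi h)) * frac_den h) _ h1)
  (jM (u * frac_num f * frac_den (class_repr (pi f))) _ h2).
by congr J; rewrite /frac_mul /=; ring.
Qed.

Lemma loc_oppE f : loc_opp (pi f) = pi (frac_opp f).
Proof.
have [j0 jD jM] := datum_idealP D.
apply/frac_eq; have [u hu h1] := frac_reprE f; exists u => //.
have := jM (-1) _ h1; by congr J; rewrite /frac_opp /=; ring.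
Qed.

Lemma frac_eqW f h : frac_num f * frac_den h = frac_num h * frac_den f -> pi f = pi h.
Proof.
move=> e; apply/frac_eq; exists 1; first exact: prime1.
by rewrite e subrr mulr0; case: (datum_idealP D).
Qed.

Fact loc_addA : associative loc_add.
Proof.
move=> x y z; have [[f ->] [g ->] [h ->]] := And3 (frac_repr x) (frac_repr y) (frac_repr z).
by rewrite !loc_addE; apply: frac_eqW => /=; ring.
Qed.

Fact loc_addC : commutative loc_add.
Proof.
move=> x y; have [[f ->] [g ->]] := conj (frac_repr x) (frac_repr y).
by rewrite !loc_addE; apply: frac_eqW => /=; ring.
Qed.

Fact loc_add0 : left_id (pi (frac_of 0) : L) loc_add.
Proof.
by move=> x; have [f ->] := frac_repr x; rewrite !loc_addE; apply: frac_eqW => /=; ring.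
Qed.

Fact loc_addN : left_inverse (pi (frac_of 0) : L) loc_opp loc_add.
Proof.
move=> x; have [f ->] := frac_repr x; rewrite loc_oppE loc_addE.
by apply: frac_eqW => /=; ring.
Qed.

HB.instance Definition _ := GRing.isZmodule.Build L loc_addA loc_addC loc_add0 loc_addN.

Fact loc_mulA : associative loc_mul.
Proof.
move=> x y z; have [[f ->] [g ->] [h ->]] := And3 (frac_repr x) (frac_repr y) (frac_repr z).
by rewrite !loc_mulE; apply: frac_eqW => /=; ring.
Qed.

Fact loc_mulC : commutative loc_mul.
Proof.
move=> x y; have [[f ->] [g ->]] := conj (frac_repr x) (frac_repr y).
by rewrite !loc_mulE; apply: frac_eqW => /=; ring.
Qed.

Fact loc_mul1 : left_id (pi (frac_of 1) : L) loc_mul.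
Proof.
by move=> x; have [f ->] := frac_repr x; rewrite !loc_mulE; apply: frac_eqW => /=; ring.
Qed.

Fact loc_mulDl : left_distributive loc_mul loc_add.
Proof.
move=> x y z; have [[f ->] [g ->] [h ->]] := And3 (frac_repr x) (frac_repr y) (frac_repr z).
by rewrite !(loc_mulE, loc_addE); apply: frac_eqW => /=; ring.
Qed.

Fact loc_oner_neq0 : (pi (frac_of 1) : L) != pi (frac_of 0).
Proof.
apply/eqP => /frac_eq[u hu] /=; rewrite mulr1 mul0r subr0 mulr1.
by move=> /datum_sub.
Qed.

HB.instance Definition _ := GRing.Zmodule_isComNzRing.Build L
  loc_mulA loc_mulC loc_mul1 loc_mulDl loc_oner_neq0.

Definition to_loc (a : R) : L := pi (frac_of a).

Fact to_loc_additive : zmod_morphism to_loc.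
Proof.
move=> a b; rewrite /to_loc -[RHS]/(loc_add _ (loc_opp _)) loc_oppE loc_addE.
by apply: frac_eqW => /=; ring.
Qed.

Fact to_loc_multiplicative : monoid_morphism to_loc.
Proof.
split=> // a b; rewrite /to_loc -[RHS]/(loc_mul _ _) loc_mulE.
by apply: frac_eqW => /=; ring.
Qed.

HB.instance Definition _ := GRing.isZmodMorphism.Build R L to_loc to_loc_additive.
HB.instance Definition _ := GRing.isMonoidMorphism.Build R L to_loc to_loc_multiplicative.

Lemma to_loc0 a : to_loc a = 0 <-> exists2 u, ~ P u & J (u * a).
Proof.
split=> [/frac_eq[u hu]|[u hu h]]; first by rewrite /= mulr1 mul0r subr0; exists u.
by apply/frac_eq; exists u => //=; rewrite mulr1 mul0r subr0.
Qed.

Lemma loc_unit s : ~ P s -> exists y, to_loc s * y = 1.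
Proof.
move=> hs; exists (pi (Fraction (1) hs)).
by rewrite -[LHS]/(loc_mul _ _) loc_mulE; apply: frac_eqW => /=; ring.
Qed.

Lemma loc_fraction (x : L) : exists2 s, ~ P s & exists a, to_loc s * x = to_loc a.
Proof.
have [[a s hs] ->] := frac_repr x; exists s => //; exists a.
by rewrite -[LHS]/(loc_mul _ _) loc_mulE; apply: frac_eqW => /=; ring.
Qed.

End Localization.

Definition zero_datum (R : comNzRingType) (P : R -> Prop) (hP : is_prime_ideal P) :
  local_datum R.
Proof.
exists P (fun x => x = 0) => //; last by move=> x ->; case: hP => -[].
by split=> // [x y -> ->|a x ->]; rewrite ?addr0 ?mulr0.
Defined.

Definition prime_datum (R : comNzRingType) (P : R -> Prop) (hP : is_prime_ideal P) :
  local_datum R.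
Proof. by exists P P => //; case: hP. Defined.

(** A separate name for the case J = P, to which the field structure is attached. *)
Definition residue (R : comNzRingType) (P : R -> Prop) (hP : is_prime_ideal P) :=
  localized (prime_datum hP).

Section Residue.
Context (R : comNzRingType) (P : R -> Prop) (hP : is_prime_ideal P).
Local Notation K := (residue hP).

HB.instance Definition _ := GRing.ComNzRing.on K.

Definition residue_inv (x : K) : K :=
  if pselect (exists y, y * x = 1) is left h then projT1 (cid h) else 0.

Fact residue_mulVf (x : K) : x != 0 -> residue_inv x * x = 1.
Proof.
move=> x0; rewrite /residue_inv; case: pselect => [h|h]; first exact: (projT2 (cid h)).
case: h; have [s hs [a ha]] := loc_fraction x.
have [|y hy] := @loc_unit R (prime_datum hP) a.
  move=> /= pa; case/eqP: x0; have [y hy] := loc_unit hs.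
  have a0 : to_loc (prime_datum hP) a = 0.
    by apply/to_loc0; exists 1; [exact: prime1|rewrite mul1r].
  by rewrite -[x]mul1r -hy mulrAC ha a0 mul0r.
by exists (y * to_loc _ s); rewrite -mulrA ha mulrC.
Qed.

Fact residue_inv0 : residue_inv 0 = 0.
Proof.
rewrite /residue_inv; case: pselect => // h; exfalso; case: h => y /eqP.
by rewrite mulr0 eq_sym oner_eq0.
Qed.

HB.instance Definition _ := GRing.ComNzRing_isField.Build K residue_mulVf residue_inv0.

Definition to_residue : R -> K := to_loc (prime_datum hP).
HB.instance Definition _ := GRing.RMorphism.on to_residue.

Lemma to_residue0 a : to_residue a = 0 <-> P a.
Proof.
rewrite to_loc0 /=; split=> [[u hu]|h]; last first.
  by exists 1; [exact: (@prime1 _ (prime_datum hP))|rewrite mul1r].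
by case: hP => _ _ h /h[].
Qed.

Lemma to_residue_field : residue_field to_residue.
Proof.
move=> x; have [s hs [a ha]] := loc_fraction x; exists a, s.
have s0 : to_residue s != 0 by apply/eqP => /to_residue0.
have {}ha : to_residue s * x = to_residue a := ha.
by split=> //; apply: (canRL (mulfK s0)); rewrite mulrC; exact: ha.
Qed.

End Residue.

(** The same ring under a name that carries the k-algebra structure: points of the Grassmannian are
    tested on k-algebras, and the local rings of A have to be among them. *)
Definition localized_alg (k : fieldType) (A : comAlgType k) (D : local_datum A) :=
  localized D.

Section LocalizedAlgebra.
Context (k : fieldType) (A : comAlgType k) (D : local_datum A).
Local Notation L := (localized_alg D).

HB.instance Definition _ := GRing.ComNzRing.on L.

Definition loc_scale (c : k) (x : L) : L := to_loc D c%:A * x.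

Fact loc_scaleA a b v : loc_scale a (loc_scale b v) = loc_scale (a * b) v.
Proof. by rewrite /loc_scale mulrA -rmorphM -scalerAl mul1r scalerA. Qed.

Fact loc_scale1 : left_id 1 loc_scale.
Proof. by move=> v; rewrite /loc_scale scale1r rmorph1 mul1r. Qed.

Fact loc_scaleDr : right_distributive loc_scale +%R.
Proof. by move=> a x y; rewrite /loc_scale mulrDr. Qed.

Fact loc_scaleDl v : {morph loc_scale^~ v : a b / a + b}.
Proof. by move=> a b; rewrite /loc_scale scalerDl rmorphD mulrDl. Qed.

HB.instance Definition _ := GRing.Zmodule_isLmodule.Build k L
  loc_scaleA loc_scale1 loc_scaleDr loc_scaleDl.

Fact loc_scaleAl (a : k) (u v : L) : a *: (u * v) = (a *: u) * v.
Proof. exact: mulrA. Qed.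

HB.instance Definition _ := GRing.Lmodule_isLalgebra.Build k L loc_scaleAl.
HB.instance Definition _ := GRing.Lalgebra_isComAlgebra.Build k L.

Definition to_loc_alg : A -> L := to_loc D.
HB.instance Definition _ := GRing.RMorphism.on to_loc_alg.

Fact to_loc_alg_scalable : scalable to_loc_alg.
Proof.
move=> c a; rewrite -[RHS]/(to_loc D c%:A * to_loc D a) -rmorphM.
by rewrite -scalerAl mul1r.
Qed.

HB.instance Definition _ := GRing.isScalable.Build k A L _ to_loc_alg to_loc_alg_scalable.

End LocalizedAlgebra.

Lemma ideal_gen_ideal (A : comNzRingType) (S : A -> Prop) : is_ideal (ideal_gen S).
Proof.
split=> [I [h0 _ _] _ //|x y hx hy I hI hS|a x hx I hI hS]; case: (hI) => _ hD hM.
  by apply: hD; [apply: hx|apply: hy].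
by apply: hM; apply: hx.
Qed.

Lemma ideal_gen_sub (A : comNzRingType) (S : A -> Prop) x : S x -> ideal_gen S x.
Proof. by move=> hx I _; apply. Qed.

(** * Noetherian rings and the local-global principle *)

Section Noetherian.
Context (A : comNzRingType) (nA : noetherian A).

Lemma ideal_gen_comb (s : seq A) x : ideal_gen (fun x => x \in s) x ->
  exists c : 'I_(size s) -> A, x = \sum_i c i * s`_i.
Proof.
move=> h; apply: (h (fun x => exists c : 'I_(size s) -> A, x = \sum_i c i * s`_i)); first split.
- by exists (fun _ => 0); rewrite big1 // => i _; rewrite mul0r.
- move=> _ _ [c ->] [d ->]; exists (fun i => c i + d i); rewrite -big_split /=.
  by apply: eq_bigr => i _; rewrite mulrDl.
- move=> a _ [c ->]; exists (fun i => a * c i); rewrite mulr_sumr.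
  by apply: eq_bigr => i _; rewrite mulrA.
move=> y ys; have lt : (index y s < size s)%N by rewrite index_mem.
exists (fun i => (i == Ordinal lt)%:R); rewrite (bigD1 (Ordinal lt)) //= eqxx mul1r.
by rewrite nth_index // big1 ?addr0 // => i /negbTE->; rewrite mul0r.
Qed.

(** Otherwise choice yields a strictly increasing chain in S. The finitely many generators of its
    union lie in one member, where the chain would stop. *)
Lemma exists_maximal (S : (A -> Prop) -> Prop) I0 : (forall I, S I -> is_ideal I) -> S I0 ->
  exists2 M, S M & forall I, S I -> (forall x, M x -> I x) -> forall x, I x -> M x.
Proof.
move=> Sid S0; apply: contrapT => hno.
have step (I : {I | S I}) : exists J : {I | S I},
    (forall x, sval I x -> sval J x) /\ exists2 x, sval J x & ~ sval I x.
  case: I => I SI; apply: contrapT => h; apply: hno; exists I => // J SJ IJ x Jx.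
  apply: contrapT => nx; apply: h; exists (exist _ J SJ); split=> //=.
  by exists x.
have [f hf] := choice step.
pose J n := iter n f (exist _ I0 S0).
have mono m n : (m <= n)%N -> forall x, sval (J m) x -> sval (J n) x.
  elim: n => [|n IH]; first by rewrite leqn0 => /eqP->.
  rewrite leq_eqVlt => /orP[/eqP-> //|]; rewrite ltnS => /IH h x /h hx.
  exact: (hf (J n)).1.
pose U x := exists n, sval (J n) x.
have idU : is_ideal U.
  split=> [|x y [m hx] [l hy]|a x [m hx]].
  - by exists 0%N; have [] := Sid _ S0.
  - exists (maxn m l); have [_ hD _] := Sid _ (svalP (J (maxn m l))).
    by apply: hD; [apply: mono hx|apply: mono hy]; lia.
  - by exists m; have [_ _ hM] := Sid _ (svalP (J m)); apply: hM.
have [s hs] := nA idU.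
have [m hm] : exists m, forall x, x \in s -> sval (J m) x.
  have : forall x, x \in s -> U x by move=> x xs; apply/hs; exact: ideal_gen_sub.
  elim: (s) => [|y s' IH] h; first by exists 0%N.
  have [|m hm] := IH; first by move=> x xs; apply: h; rewrite inE xs orbT.
  have [l hl] := h y (mem_head _ _); exists (maxn m l) => x; rewrite inE => /orP[/eqP->|xs].
    by apply: mono hl; lia.
  by apply: mono (hm _ xs); lia.
have [_ [x hx nx]] := hf (J m); apply: nx.
have : U x by exists m.+1.
by move=> /hs; apply => //; exact: Sid (svalP _).
Qed.

Lemma exists_prime (I : A -> Prop) : is_ideal I -> ~ I 1 ->
  exists2 P, is_prime_ideal P & forall x, I x -> P x.
Proof.
move=> hI I1; pose S J := [/\ is_ideal J, ~ J 1 & forall x, I x -> J x].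
have [|//|M [idM M1 IM] Mmax] := @exists_maximal S I; first by move=> J [].
exists M => //; split=> // x y hxy; apply: contrapT => /not_orP[nx ny].
case: (idM) => h0 hD hM.
pose J z := exists m a, M m /\ z = m + a * x.
have idJ : is_ideal J.
  split=> [|_ _ [m [a [hm ->]]] [m' [a' [hm' ->]]]|b _ [m [a [hm ->]]]].
  - by exists 0, 0; split=> //; rewrite mul0r addr0.
  - by exists (m + m'), (a + a'); split; [exact: hD|ring].
  - by exists (b * m), (b * a); split; [exact: hM|ring].
have MJ z : M z -> J z by move=> hz; exists z, 0; split=> //; rewrite mul0r addr0.
have [|m [a [hm e]]] := @contrapT (J 1).
  move=> J1; apply: nx; apply: (Mmax J) => //.
    by split=> // z /IM /MJ.
  by exists 0, 1; split=> //; rewrite mul1r add0r.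
apply: ny; rewrite -[y]mulr1 e mulrDr; apply: hD; first exact: hM.
by rewrite (_ : y * (a * x) = a * (x * y)); [exact: hM|ring].
Qed.

(** The multipliers s with s v in W form an ideal that lies in no prime, hence contains 1. *)
Lemma local_global (V : lmodType A) (W : V -> Prop) v : is_submod W ->
  (forall P, is_prime_ideal P -> exists2 s, ~ P s & W (s *: v)) -> W v.
Proof.
move=> [h0 hD hZ] h; pose I s := W (s *: v).
have idI : is_ideal I.
  split; first by rewrite /I scale0r.
    by move=> x y; rewrite /I scalerDl; apply: hD.
  by move=> a x; rewrite /I -scalerA; apply: hZ.
rewrite -[v]scale1r; apply: contrapT => I1.
by have [P /h[s ns Is] IP] := exists_prime idI I1; apply: ns; apply: IP.
Qed.

(** [Wj j] consists of the elements of W whose first j coordinates vanish. Their next coordinates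
    form a finitely generated ideal; subtracting a combination of lifts of its generators makes one
    more coordinate vanish. *)
Lemma submod_fg N (W : 'rV[A]_N -> Prop) : is_submod W ->
  exists m (M : 'M[A]_(m, N)), (forall i, W (row i M)) /\ forall v, W v -> exists c, v = c *m M.
Proof.
move=> sW; pose Wj j v := W v /\ forall i : 'I_N, (i < j)%N -> v 0 i = 0.
suff H : forall k, (k <= N)%N -> exists m (M : 'M[A]_(m, N)), (forall i, W (row i M)) /\
    forall v, Wj (N - k)%N v -> exists c, v = c *m M.
  have [m [M [h1 h2]]] := H N (leqnn N); exists m, M; split=> // v hv; apply: h2.
  by rewrite subnn; split.
elim=> [|k IH] kN.
  exists 0%N, 0; split=> [[]//|v [_ h]]; exists 0; rewrite mul0mx.
  by apply/rowP => i; rewrite h ?mxE // subn0.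
have [m [M [h1 h2]]] := IH (ltnW kN).
have jN : (N - k.+1 < N)%N by lia.
pose j := Ordinal jN; case: (sW) => h0 hD hZ.
pose I x := exists2 v, Wj (N - k.+1)%N v & v 0 j = x.
have idI : is_ideal I.
  split=> [|_ _ [v [v1 v2] <-] [w [w1 w2] <-]|a _ [v [v1 v2] <-]].
  - by exists 0; rewrite ?mxE //; split=> // i _; rewrite mxE.
  - exists (v + w); last by rewrite mxE.
    by split=> [|i hi]; [exact: hD|rewrite mxE v2 // w2 // addr0].
  - exists (a *: v); last by rewrite mxE.
    by split=> [|i hi]; [exact: hZ|rewrite mxE v2 // mulr0].
have [s hs] := nA idI.
have /fin_all_exists2[w hw1 hw2] (i : 'I_(size s)) : I s`_i.
  by apply/hs; apply: ideal_gen_sub; exact: mem_nth.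
exists (size s + m)%N, (col_mx (\matrix_i w i) M); split=> [i|v [hv1 hv2]].
  case: (splitP i) => l e.
    have -> : i = lshift m l by apply: val_inj.
    by rewrite rowKu rowK; case: (hw1 l).
  have -> : i = rshift (size s) l by apply: val_inj.
  by rewrite rowKd.
have /hs/ideal_gen_comb[c hc] : I (v 0 j) by exists v.
pose c' := \row_i c i.
have [|d hd] := h2 (v - c' *m \matrix_i w i).
  split.
    apply: submodB => //; apply: submod_mulmx => // i; rewrite rowK.
    by case: (hw1 i).
  move=> i hi; rewrite !mxE.
  have : (i <= N - k.+1)%N by lia.
  rewrite leq_eqVlt => /orP[/eqP e|lt].
    have -> : i = j by apply: val_inj.
    rewrite hc -sumrB big1 // => l _; rewrite !mxE hw2; ring.
  rewrite hv2 // big1 ?subr0 // => l _; rewrite !mxE.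
  by case: (hw1 l) => _ ->; rewrite ?mulr0.
by exists (row_mx c' d); rewrite mul_row_col -hd addrC subrK.
Qed.

Lemma localized_noetherian (D : local_datum A) : noetherian (localized D).
Proof.
move=> J [j0 jD jM]; pose t := to_loc D; pose I a := J (t a).
have idI : is_ideal I.
  split=> [|x y|a x]; first by rewrite /I /t rmorph0.
    by rewrite /I /t rmorphD; apply: jD.
  by rewrite /I /t rmorphM; apply: jM.
have [s hs] := nA idI; exists (map t s) => y; split=> [Jy|]; last first.
  by apply=> // _ /mapP[x xs ->]; apply/hs; apply: ideal_gen_sub.
have [u nu [a e]] := loc_fraction y; have [z hz] := loc_unit nu.
have /hs : I a by rewrite /I /t -e; apply: jM.
move=> ha; have -> : y = z * t a by rewrite /t -e mulrA (mulrC z) hz mul1r.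
have [g0 gD gM] := ideal_gen_ideal (fun x : localized D => x \in map t s).
apply: (gM z); apply: (ha (fun a => ideal_gen (fun x : localized D => x \in map t s) (t a))).
  split=> [|x x'|b x]; first by rewrite /t rmorph0.
    by rewrite /t rmorphD; apply: gD.
  by rewrite /t rmorphM; apply: gM.
by move=> x xs; apply: ideal_gen_sub; exact: map_f.
Qed.

End Noetherian.

Lemma submod_gen_submod (R : comNzRingType) (V : lmodType R) (S : V -> Prop) :
  is_submod (submod_gen S).
Proof.
split=> [W [h0 _ _] _ //|x y hx hy W hW hS|a x hx W hW hS]; case: (hW) => _ hD hZ.
  by apply: hD; [apply: hx|apply: hy].
by apply: hZ; apply: hx.
Qed.

Lemma Grass_map_submod N (A B : comNzRingType) (g : {rmorphism A -> B})
  (W : 'rV[A]_N -> Prop) : is_submod (Grass_map g W).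
Proof. exact: submod_gen_submod. Qed.

Lemma Grass_map_sub N (A B : comNzRingType) (g : {rmorphism A -> B})
  (W : 'rV[A]_N -> Prop) v : W v -> Grass_map g W (map_mx g v).
Proof. by move=> hv W' _; apply; exists v. Qed.

Lemma Grass_map_ind N (A B : comNzRingType) (g : {rmorphism A -> B})
    (W : 'rV[A]_N -> Prop) (W' : 'rV[B]_N -> Prop) : is_submod W' ->
  (forall v, W v -> W' (map_mx g v)) -> forall w, Grass_map g W w -> W' w.
Proof. by move=> sW h w; apply => // _ [v hv ->]; apply: h. Qed.

Lemma Grass_map_comp N (A B C : comNzRingType) (g : {rmorphism A -> B})
    (f : {rmorphism B -> C}) (W : 'rV[A]_N -> Prop) :
  Grass_map f (Grass_map g W) = Grass_map (f \o g) W.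
Proof.
apply: funext => w; apply: propext; split; apply: Grass_map_ind; try exact: Grass_map_submod.
  move=> v; apply: (Grass_map_ind (W' := fun v => Grass_map (f \o g) W (map_mx f v))).
    have [h0 hD hZ] := Grass_map_submod (f \o g) W.
    split=> [|x y|a x]; first by rewrite map_mx0.
      by rewrite map_mxD; apply: hD.
    by rewrite map_mxZ; apply: hZ.
  by move=> x hx; have := @Grass_map_sub _ _ _ (f \o g) _ _ hx; rewrite map_mx_comp.
move=> v hv; rewrite map_mx_comp; apply: (@Grass_map_sub _ _ _ f (Grass_map g W)).
exact: Grass_map_sub.
Qed.

(** * Denominators at a prime *)

Section LocalTools.
Context (A : comNzRingType) (P : A -> Prop) (hP : is_prime_ideal P).
Local Notation D := (zero_datum hP).
Local Notation L := (localized D).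
Local Notation t := (to_loc D).

Lemma loc_cancel (V : lmodType L) (W : V -> Prop) s x : is_submod W -> ~ P s ->
  W (t s *: x) -> W x.
Proof.
move=> [_ _ hZ] ns h; have [y hy] := @loc_unit _ D s ns.
by rewrite -[x]scale1r -hy mulrC -scalerA; apply: hZ.
Qed.

Lemma loc_eq0 a : t a = 0 -> exists2 s, ~ P s & s * a = 0.
Proof. by move/to_loc0. Qed.

Lemma common_multiple (I : finType) (Q : I -> A -> Prop) :
  (forall i, exists2 s, ~ P s & Q i s) -> (forall i a s, Q i s -> Q i (a * s)) ->
  exists2 s, ~ P s & forall i, Q i s.
Proof.
move=> /fin_all_exists2[s hs hQ] hM; exists (\prod_i s i).
  have [_ P1 hp] := hP; apply: (big_ind (fun x => ~ P x)) => // x y nx ny.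
  exact: (@primeM _ D).
by move=> i; rewrite (bigD1 i) //= mulrC; apply: hM.
Qed.

Lemma loc_mx_eq0 m p (M : 'M[A]_(m, p)) : map_mx t M = 0 ->
  exists2 s, ~ P s & s *: M = 0.
Proof.
move=> h; have [|ij a s|s ns hs] := @common_multiple ('I_m * 'I_p)%type
    (fun ij s => s * M ij.1 ij.2 = 0).
- move=> [i j] /=; apply: loc_eq0.
  by have := congr1 (fun X : 'M[L]_(m, p) => X i j) h; rewrite !mxE.
- by rewrite -mulrA => ->; rewrite mulr0.
- by exists s => //; apply/matrixP => i j; rewrite !mxE (hs (i, j)).
Qed.

Lemma loc_mx_clear m p (M : 'M[L]_(m, p)) :
  exists2 s, ~ P s & exists M' : 'M[A]_(m, p), t s *: M = map_mx t M'.
Proof.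
have [|ij a s [b hb]|s ns hs] := @common_multiple ('I_m * 'I_p)%type
    (fun ij s => exists a, t s * M ij.1 ij.2 = t a).
- by move=> [i j] /=; exact: (@loc_fraction _ D).
- by exists (a * b); rewrite !rmorphM -mulrA hb.
have /fin_all_exists[f hf] := hs; exists s => //; exists (\matrix_(i, j) f (i, j)).
by apply/matrixP => i j; rewrite !mxE -(hf (i, j)).
Qed.

Lemma Grass_map_loc N (W : 'rV[A]_N -> Prop) : is_submod W ->
  forall w, Grass_map t W w <->
  exists2 s, ~ P s & exists2 v, W v & t s *: w = map_mx t v.
Proof.
move=> sW w; split; last first.
  move=> [s ns [v hv e]]; apply: (loc_cancel (Grass_map_submod t W) ns).
  by rewrite e; apply: Grass_map_sub.
have n1 := @prime1 _ D; case: (sW) => h0 hD hZ.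
apply: (Grass_map_ind (W' := fun w => exists2 s, ~ P s & exists2 v, W v & t s *: w = map_mx t v)); last by move=> v hv; exists 1 => //; exists v; rewrite ?rmorph1 ?scale1r.
split=> [|x y [s ns [v hv e]] [s' ns' [v' hv' e']]|a x [s ns [v hv e]]].
- by exists 1 => //; exists 0; rewrite ?scaler0 ?map_mx0.
- exists (s * s'); first exact: (@primeM _ D).
  exists (s' *: v + s *: v'); first by apply: hD; apply: hZ.
  by rewrite map_mxD !map_mxZ -e -e' rmorphM scalerDr !scalerA (mulrC (t s') (t s)).
- have [u nu [b hb]] := @loc_fraction _ D a; exists (u * s); first exact: (@primeM _ D).
  by exists (b *: v); [exact: hZ|rewrite map_mxZ /= -hb -e rmorphM !scalerA (mulrAC (t u) a)].
Qed.

Lemma Grass_map_loc_mx N (W : 'rV[A]_N -> Prop) : is_submod W ->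
  forall v, Grass_map t W (map_mx t v) <-> exists2 s, ~ P s & W (s *: v).
Proof.
move=> sW v; rewrite (Grass_map_loc sW); case: (sW) => h0 hD hZ; split.
  move=> [s ns [w hw e]].
  have [|u nu hu] := @loc_mx_eq0 _ _ (s *: v - w).
    by rewrite map_mxB map_mxZ e subrr.
  exists (u * s); first exact: (@primeM _ D).
  by rewrite -scalerA -[s *: v](subrK w) scalerDr hu add0r; apply: hZ.
by move=> [s ns hs]; exists s => //; exists (s *: v) => //; rewrite map_mxZ.
Qed.

End LocalTools.

(* A family of charts of the Grassmannian around every prime, with the
   denominators cleared: W is the kernel of C, and F is a section of C, after
   inverting s. *)
Definition locally_split (A : comNzRingType) (p N : nat) (W : 'rV[A]_N -> Prop) :=
  forall P, is_prime_ideal P -> exists2 s, ~ P s &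
  exists (C : 'M[A]_(N, p)) (F : 'M[A]_(p, N)),
  [/\ forall w, W w -> w *m C = 0, forall v, W (s *: v - v *m C *m F)
    & F *m C = s%:M].

Lemma split_locally_free (A : comNzRingType) p N (W : 'rV[A]_N -> Prop) :
  locally_split p W -> locally_free_quotient p W.
Proof.
move=> h P hP; have [s ns [C [F [h1 h2 h3]]]] := h P hP; exists s => //; exists F.
split=> [v|c /h1]; first by exists 1%N, (v *m C); rewrite expr1.
by rewrite -mulmxA h3 mul_mx_scalar => hc; exists 1%N; rewrite expr1.
Qed.

Lemma split_base_change (A B : comNzRingType) (g : {rmorphism A -> B}) p N
  (W : 'rV[A]_N -> Prop) : locally_split p W -> locally_split p (Grass_map g W).
Proof.
move=> h Q [idQ Q1 Qp].
have hP : is_prime_ideal (fun a => Q (g a)).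
  case: idQ => q0 qD qM; split; first split.
  - by rewrite rmorph0.
  - by move=> x y; rewrite rmorphD; apply: qD.
  - by move=> a x; rewrite rmorphM; apply: qM.
  - by rewrite rmorph1.
  - by move=> x y; rewrite rmorphM; apply: Qp.
have [s ns [C [F [h1 h2 h3]]]] := h _ hP.
exists (g s) => //; exists (map_mx g C), (map_mx g F); split.
- apply: (Grass_map_ind (W' := fun w => w *m map_mx g C = 0)); last by move=> v /h1 hv; rewrite -map_mxM hv map_mx0.
  split=> [|x y hx hy|a x hx]; rewrite ?mul0mx // ?mulmxDl ?hx ?hy ?addr0 //.
  by rewrite -scalemxAl hx scaler0.
- move=> v; rewrite -mulmxA -map_mxM -mul_mx_scalar -map_scalar_mx -mulmxBr -map_mxB.
  apply: submod_mulmx; first exact: Grass_map_submod.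
  move=> i; rewrite -map_row; apply: Grass_map_sub.
  by rewrite rowE mulmxBr mul_mx_scalar mulmxA; exact: h2.
- by rewrite -map_mxM h3 map_scalar_mx.
Qed.

Lemma residue_comp (A B : comNzRingType) (K : fieldType) (t : {rmorphism A -> B})
    (g : {rmorphism B -> K}) : residue_field g ->
  (forall b, g b != 0 -> exists b', b * b' = 1) ->
  (forall x, exists s a, t s * x = t a /\ g (t s) != 0) ->
  (forall x, exists b, g b = x) /\ residue_field (g \o t).
Proof.
move=> res unit den; have sur x : exists b, g b = x.
  have [b [c [c0 ->]]] := res x; have [c' hc] := unit c c0; exists (b * c').
  by apply: (canRL (mulfK c0)); rewrite -rmorphM -mulrA (mulrC c') hc mulr1.
split=> // x; have [b <-] := sur x; have [s [a [e s0]]] := den b.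
by exists a, s; split=> //=; rewrite -e rmorphM mulrAC mulfV // mul1r.
Qed.

Section LocalRing.
Context (A : comNzRingType) (P : A -> Prop) (hP : is_prime_ideal P).
Local Notation D := (zero_datum hP).
Local Notation L := (localized D).
Local Notation t := (to_loc D).

Definition loc_max (x : L) := exists2 s, ~ P s & exists2 a, P a & t s * x = t a.

Lemma loc_eq (a b : A) : t a = t b -> exists2 u, ~ P u & u * a = u * b.
Proof.
move=> e; have /loc_eq0[u nu h] : t (a - b) = 0 by rewrite rmorphB /= e subrr.
by exists u => //; apply/eqP; rewrite -subr_eq0 -mulrBr h.
Qed.

Lemma loc_max_prime : is_prime_ideal loc_max.
Proof.
have [[p0 pD pM] p1 pp] := hP; split; first split.
- by exists 1 => //; exists 0; rewrite ?mulr0 ?rmorph0.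
- move=> x y [s ns [a pa ea]] [s' ns' [a' pa' ea']].
  exists (s * s'); first exact: (@primeM _ D).
  exists (s' * a + s * a'); first by apply: pD; apply: pM.
  by rewrite rmorphD !rmorphM /= -ea -ea'; ring.
- move=> x y [s ns [a pa ea]]; have [u nu [b eb]] := @loc_fraction _ D x.
  exists (u * s); first exact: (@primeM _ D).
  by exists (b * a); [exact: pM|rewrite !rmorphM /= -ea -eb; ring].
- move=> [s ns [a pa]]; rewrite mulr1 => /loc_eq[u nu e].
  by have : P (u * s) by [rewrite e; exact: pM]; move=> /pp[].
- move=> x y [s ns [a pa e]].
  have [s1 ns1 [a1 e1]] := @loc_fraction _ D x; have [s2 ns2 [a2 e2]] := @loc_fraction _ D y.
  have /loc_eq[u nu h] : t (s * (a1 * a2)) = t (s1 * s2 * a).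
    by rewrite !rmorphM /= -e1 -e2 -e; ring.
  have : P (u * (s * (a1 * a2))) by rewrite h mulrA; exact: pM.
  by move=> /pp[//|/pp[//|/pp[h1|h2]]]; [left; exists s1 => //; exists a1|right; exists s2 => //; exists a2].
Qed.

(** Collects what is needed of the residue field K at P: it is the residue field of the local ring
    in the form used for linear algebra, and the composite from A is the map on which the definition
    of [Hilb] tests fibres. *)
Lemma residue_exists : exists (K : fieldType) (g : {rmorphism L -> K}),
  [/\ forall x, exists b, g b = x,
      forall b, g b != 0 -> exists b', b * b' = 1,
      residue_field (g \o t)
    & forall a, g (t a) = 0 <-> P a].
Proof.
have hm := loc_max_prime; exists (residue hm), (@to_residue _ _ hm).
have unit b : @to_residue _ _ hm b != 0 -> exists b', b * b' = 1.
  move=> /eqP b0; have [s ns [a ha]] := @loc_fraction _ D b.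
  have [|y hy] := @loc_unit _ D a.
    by move=> pa; apply: b0; apply/to_residue0; exists s => //; exists a.
  by exists (t s * y); rewrite mulrCA mulrA ha.
have ker a : to_residue hm (t a) = 0 <-> P a.
  rewrite to_residue0; split=> [[s ns [b pb]]|pa]; last first.
    by exists 1; [exact: (@prime1 _ D)|exists a => //; rewrite rmorph1 mul1r].
  rewrite -rmorphM => /loc_eq[u nu e]; have [[_ _ pM] _ pp] := hP.
  have : P (u * (s * a)) by rewrite e; exact: pM.
  by move=> /pp[//|/pp[]].
have [|sur res] := @residue_comp _ _ _ t (to_residue hm) (@to_residue_field _ _ hm) unit.
  move=> x; have [s ns [a ha]] := @loc_fraction _ D x; exists s, a; split; first exact: ha.
  by apply/eqP => /ker.
by split.
Qed.

Lemma free_of_locally_free p N (W : 'rV[A]_N -> Prop) : is_submod W ->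
  locally_free_quotient p W -> free_quotient p (Grass_map t W).
Proof.
move=> sW /(_ P hP)[s ns [b [h1 h2]]].
have nsm m : ~ P (s ^+ m).
  by elim: m => [|m IH]; [exact: (@prime1 _ D)|rewrite exprS; exact: (@primeM _ D)].
have sG := Grass_map_submod t W.
have /fin_all_exists[C hC] (i : 'I_N) : exists c : 'rV[L]_p,
    Grass_map t W (row i 1%:M - c *m map_mx t b).
  have [m [c hc]] := h1 (row i 1%:M); have [y hy] := @loc_unit _ D _ (nsm m).
  exists (y *: map_mx t c); apply: (loc_cancel sG (nsm m)).
  rewrite -scalemxAl scalerBr scalerA hy scale1r -map_mxM.
  by rewrite -(map_mx1 t) -map_row -map_mxZ -map_mxB; apply: Grass_map_sub.
exists (\matrix_i C i), (map_mx t b); apply: free_quotientI => // [v|c].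
  rewrite -{1}[v]mulmx1 -mulmxA -mulmxBr; apply: submod_mulmx => // i.
  by rewrite linearB /= row_mul rowK.
have [u nu [c' hc']] := @loc_mx_clear _ _ hP _ _ c.
have [_ _ hZ] := sG; move=> /(hZ (t u)); rewrite scalemxAl hc' -map_mxM.
move=> /(Grass_map_loc_mx hP sW)[u' nu']; rewrite scalemxAl => /h2[m].
rewrite scalerA => /(congr1 (map_mx t)); rewrite map_mxZ map_mx0 -hc' scalerA -rmorphM => e.
have [|y hy] := @loc_unit _ D (s ^+ m * u' * u).
  by do 2!apply: (@primeM _ D) => //.
by rewrite -[c]scale1r -hy mulrC -scalerA e scaler0.
Qed.

Lemma split_loc_free p N (W : 'rV[A]_N -> Prop) : is_submod W ->
  locally_split p W -> free_quotient p (Grass_map t W).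
Proof. by move=> sW /split_locally_free; apply: free_of_locally_free. Qed.

End LocalRing.

(** The local coordinates and section are cleared of denominators. Since W is finitely generated, a
    single further denominator makes the coordinates vanish on W. *)
Lemma split_of_free (A : comNzRingType) (nA : noetherian A) p N
    (W : 'rV[A]_N -> Prop) : is_submod W ->
  (forall P (hP : is_prime_ideal P), free_quotient p (Grass_map (to_loc (zero_datum hP)) W)) ->
  locally_split p W.
Proof.
move=> sW h P hP; have [C0 [F0 [hFC hC]]] := h P hP.
pose D := zero_datum hP; pose t := to_loc D.
have [s1 ns1 [C1 e1]] := loc_mx_clear C0; have [s2 ns2 [F1 e2]] := loc_mx_clear F0.
have pM x y : ~ P x -> ~ P y -> ~ P (x * y) by exact: (@primeM _ D).
have [u nu hu] : exists2 u, ~ P u & u *: (F1 *m C1) = (u * (s1 * s2))%:M.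
  have [|u nu hu] := @loc_mx_eq0 _ _ hP _ _ (F1 *m C1 - (s1 * s2)%:M).
    rewrite map_mxB map_mxM -e1 -e2 -scalemxAl -scalemxAr hFC map_scalar_mx /=.
    by rewrite scalerA scalemx1 -rmorphM mulrC subrr.
  by exists u => //; apply/eqP; rewrite -scale_scalar_mx -subr_eq0 -scalerBr hu.
have [m [M [hM1 hM2]]] := submod_fg nA sW.
have [u' nu' hu'] : exists2 u', ~ P u' & u' *: (M *m C1) = 0.
  apply: (loc_mx_eq0 (hP := hP)); rewrite map_mxM -e1 -scalemxAr.
  suff -> : map_mx (to_loc (zero_datum hP)) M *m C0 = 0 by rewrite scaler0.
  apply/row_matrixP => i; rewrite row_mul row0 -map_row; apply/hC.
  exact: Grass_map_sub.
have [v nv hv] : exists2 v, ~ P v & forall i : 'I_N, W (row i (v *: ((s1 * s2)%:M - C1 *m F1))).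
  apply: (common_multiple hP) => [i|i a v hv]; last first.
    by rewrite -scalerA linearZ /=; case: sW => _ _; apply.
  have : Grass_map t W (row i (map_mx t ((s1 * s2)%:M - C1 *m F1))).
    rewrite map_mxB map_mxM -e1 -e2 -scalemxAl -scalemxAr scalerA map_scalar_mx /=.
    rewrite -rmorphM -scalemx1 -scalerBr linearZ /=; case: (Grass_map_submod t W) => _ _; apply.
    by apply/hC; rewrite -row_mul mulmxBl mul1mx -mulmxA hFC mulmx1 subrr row0.
  rewrite -map_row => /(Grass_map_loc_mx hP sW)[w nw hw]; exists w => //.
  by rewrite linearZ.
(* The factor u serves the identity for F C, u' the vanishing on W and v the membership in W. Both
   [C1] and [F1] are multiplied by U, whence its square in the denominator. *)
pose U := u * u' * v.
exists (U * (U * (s1 * s2))); first by rewrite /U; do !apply: (pM).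
exists (U *: C1), (U *: F1); split.
- move=> w /hM2[c ->]; rewrite -mulmxA -scalemxAr /U -[u * u']mulrC -mulrA mulrC.
  by rewrite -scalerA hu' scaler0 mulmx0.
- move=> w; rewrite -mulmxA -mul_mx_scalar -mulmxBr; apply: submod_mulmx => // i.
  have -> : (U * (U * (s1 * s2)))%:M - U *: C1 *m (U *: F1) =
      (u * u' * U) *: (v *: ((s1 * s2)%:M - C1 *m F1)).
    rewrite -scalemxAl -scalemxAr !scalerBr !scalerA !scale_scalar_mx.
    by congr (_%:M - _ *: _); rewrite /U; ring.
  by rewrite linearZ /=; case: sW => _ _; apply.
- rewrite -scalemxAl -scalemxAr /U.
  have -> : u * u' * v = u' * v * u by ring.
  rewrite -[X in _ *: X]scalerA hu !scale_scalar_mx; congr (_%:M); ring.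
Qed.

Lemma free_cod (K : fieldType) p N (W : 'rV[K]_N -> Prop) : free_quotient p W -> cod W = p.
Proof.
move=> [C [F [hFC hC]]]; rewrite (@cod_mx _ _ _ _ (kermx C)); last first.
  by move=> u; rewrite hC; split=> [/sub_kermxP|/sub_kermxP].
have rC : \rank C = p.
  apply/eqP; rewrite eqn_leq rank_leq_col /=.
  by have := mxrankM_maxr F C; rewrite hFC mxrank1.
by rewrite /codim mxrank_ker rC; have := rank_leq_row C; rewrite rC; lia.
Qed.

Lemma cod_free (K : fieldType) p N (W : 'rV[K]_N -> Prop) : is_submod W ->
  cod W = p -> free_quotient p W.
Proof.
move=> sW hp; have [] := @local_free K K idfun _ _ N W W p sW sW.
- by move=> x; exists x.
- by move=> b b0; exists b^-1; rewrite mulfV.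
- by move=> u hu; exists u => //; apply/matrixP => i j; rewrite mxE.
- by move=> q F hF c hc; apply: hF; rewrite map_mx_id.
- exact: hp.
by move=> C hC; exists C.
Qed.

(** * Minors and the rank of a quotient *)

Section Minors.
Context (R : comNzRingType).

(** As in the Cauchy-Binet formula, expanding the determinant of X M over all maps f expresses it
    through the minors of X. *)
Lemma det_mulmx_cols q b (X : 'M[R]_(q, b)) (M : 'M[R]_(b, q)) :
  (forall f : 'I_q -> 'I_b, \det (colsub f X) = 0) -> \det (X *m M) = 0.
Proof.
move=> h; rewrite -det_tr trmx_mul /determinant.
transitivity (\sum_(f : {ffun 'I_q -> 'I_b}) (\prod_i M (f i) i) * \det (colsub f X)); last first.
  by rewrite big1 // => f _; rewrite h mulr0.
under [RHS]eq_bigr => f _ do rewrite -det_tr /determinant mulr_sumr.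
rewrite exchange_big; apply: eq_bigr => s _ /=.
rewrite (eq_bigr (fun i => \sum_j M j i * X (s i) j)); last first.
  by move=> i _; rewrite !mxE; apply: eq_bigr => j _; rewrite !mxE.
rewrite bigA_distr_bigA /= mulr_sumr; apply: eq_bigr => f _.
rewrite big_split /= mulrCA; congr (_ * (_ * _)).
by apply: eq_bigr => i _; rewrite !mxE.
Qed.

Lemma det_mulmx_rows q b (X : 'M[R]_(b, q)) (M : 'M[R]_(q, b)) :
  (forall f : 'I_q -> 'I_b, \det (rowsub f X) = 0) -> \det (M *m X) = 0.
Proof.
move=> h; rewrite -det_tr trmx_mul; apply: det_mulmx_cols => f.
by rewrite -det_tr (_ : _^T = rowsub f X) //; apply/matrixP => i j; rewrite !mxE.
Qed.

Lemma det_thin m q (X : 'M[R]_(q, m)) (Y : 'M[R]_(m, q)) : (m < q)%N -> \det (X *m Y) = 0.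
Proof.
move=> mq; apply: det_mulmx_cols => f.
have : ~~ injectiveb f.
  by apply/injectiveP => /leq_card; rewrite !card_ord leqNgt mq.
move=> /injectivePn[i [j ij e]]; rewrite -det_tr.
apply: (determinant_alternate ij) => k; by rewrite !mxE e.
Qed.

(** The matrix M is arbitrary rather than a selection of columns, which makes the condition
    independent of the choice of coordinates. *)
Definition minors_vanish q N (W : 'rV[R]_N -> Prop) :=
  forall (w : 'M[R]_(q, N)) (M : 'M[R]_(N, q)), (forall i, W (row i w)) -> \det (w *m M) = 0.

(** The product of w stacked on F with M beside C factors through dimension N < q + p, so its
    determinant is 0. It is block triangular with diagonal blocks w M and 1. *)
Lemma free_minors p q N (W : 'rV[R]_N -> Prop) : free_quotient p W ->
  (N < q + p)%N -> minors_vanish q W.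
Proof.
move=> [C [F [hFC hC]]] lt w M hw.
have wC : w *m C = 0 by apply/row_matrixP => i; rewrite row_mul row0; apply/hC.
have := @det_thin N (q + p) (col_mx w F) (row_mx M C) lt.
by rewrite mul_col_row wC hFC det_lblock det1 mulr1.
Qed.

Definition in_span N (T : 'rV[R]_N -> Prop) (v : 'rV[R]_N) :=
  exists m (U : 'rV[R]_m) (G : 'M[R]_(m, N)), (forall i, T (row i G)) /\ v = U *m G.

Lemma in_span_rows q N (T : 'rV[R]_N -> Prop) (w : 'M[R]_(q, N)) :
  (forall i, in_span T (row i w)) ->
  exists m (U : 'M[R]_(q, m)) (G : 'M[R]_(m, N)), (forall i, T (row i G)) /\ w = U *m G.
Proof.
elim: q w => [|q IH] w h.
  by exists 0%N, 0, 0; split=> [[]//|]; apply/matrixP => -[].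
rewrite -[w](@vsubmxK _ 1 q).
have [m1 [U1 [G1 [h1 e1]]]] := h ord0.
have [|m2 [U2 [G2 [h2 e2]]]] := IH (@dsubmx _ 1 q _ w).
  move=> i; have := h (rshift 1 i); congr (in_span T _).
  by apply/rowP => j; rewrite !mxE; congr (w _ _); apply: val_inj.
exists (m1 + m2)%N, (block_mx U1 0 0 U2), (col_mx G1 G2); split=> [i|].
  by case: (split_ordP i) => j ->; rewrite ?rowKu ?rowKd.
have e := mul_block_col U1 (0 : 'M_(1, m2)) (0 : 'M_(q, m1)) U2 G1 G2.
rewrite !mul0mx addr0 add0r in e; apply: (etrans _ (esym e)).
rewrite -e2; congr col_mx; rewrite -e1; apply/rowP => j; rewrite !mxE; congr (w _ _); exact: val_inj.
Qed.

Lemma minors_span q N (T W : 'rV[R]_N -> Prop) : (forall v, W v -> in_span T v) ->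
  (forall (w : 'M[R]_(q, N)) f, (forall i, T (row i w)) -> \det (colsub f w) = 0) ->
  minors_vanish q W.
Proof.
move=> hW hT w M hw.
have [|m [U [G [hG ->]]]] := @in_span_rows _ _ T w; first by move=> i; apply: hW.
rewrite -mulmxA; apply: det_mulmx_rows => f.
rewrite -mul_rowsub_mx; apply: det_mulmx_cols => f'; apply: hT => i.
by have := hG (f i); congr T; apply/rowP => j; rewrite !mxE.
Qed.

Lemma minors_sub q N (W W' : 'rV[R]_N -> Prop) : (forall v, W v -> W' v) ->
  minors_vanish q W' -> minors_vanish q W.
Proof. by move=> h hW' w M hw; apply: hW' => i; apply: h. Qed.

End Minors.

Section LocalMinors.
Context (B : comNzRingType) (K : fieldType) (g : {rmorphism B -> K}).
Hypothesis gsurj : forall x, exists b, g b = x.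
Hypothesis gunit : forall b, g b != 0 -> exists b', b * b' = 1.

(** A rank above N - p would exhibit the identity matrix of size N - p + 1 as a product w M with the
    rows of w in Wk. *)
Lemma rank_minors p N (Wk : 'rV[K]_N -> Prop) : is_submod Wk ->
  minors_vanish (N - p).+1 Wk -> (p <= N)%N -> (p <= cod Wk)%N.
Proof.
move=> sW hW pN; rewrite leqNgt; apply/negP => lt; pose q := (N - p).+1.
have hq : (q <= \rank (spmx Wk))%N by move: lt; rewrite /q /cod /codim; lia.
pose S := row_base (spmx Wk).
have /row_freeP[Y hY] := row_base_free (spmx Wk).
pose w := pid_mx q *m S : 'M[K]_(q, N).
have := @hW w (Y *m pid_mx q); have -> : w *m (Y *m pid_mx q) = 1%:M.
  by rewrite /w -mulmxA (mulmxA S) hY mul1mx mul_pid_mx minnn (minn_idPr hq) pid_mx_1.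
rewrite det1 => /(_ _)/eqP; rewrite oner_eq0 => h.
suff : false by []; apply: h => i; apply/spmxP => //.
by rewrite row_mul (submx_trans (submxMl _ _)) // eq_row_base.
Qed.

(** Lifts w' of a basis of Wk and F of a complementary basis form a basis of the free module, with
    coordinates Y and C. For v in W, the rows v and w' have a minor of size N - p + 1 equal to a
    coordinate of v on F; it vanishes, so w' spans W. *)
Lemma minors_free p N (W : 'rV[B]_N -> Prop) (Wk : 'rV[K]_N -> Prop) : is_submod W ->
  is_submod Wk -> onto g W Wk -> cod Wk = p -> (p <= N)%N ->
  minors_vanish (N - p).+1 W -> free_quotient p W.
Proof.
move=> sW sWk ho hp pN hW; have [Fk [hF full]] := complement_mx sWk hp.
have rk : \rank (spmx Wk) = (N - p)%N.
  by move: hp; rewrite /cod /codim; have := rank_leq_col (spmx Wk); lia.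
have [wk [hwk ewk]] : exists wk : 'M[K]_(N - p, N), row_free wk /\ (wk :=: spmx Wk)%MS.
  by rewrite -rk; exists (row_base (spmx Wk)); split; [exact: row_base_free|exact: eq_row_base].
have [F eF] := lift_mx gsurj Fk.
have /fin_all_exists2[w hw1 hw2] (i : 'I_(N - p)) : exists2 v, W v & map_mx g v = row i wk.
  by apply: ho; apply/spmxP => //; rewrite -ewk row_sub.
pose w' := \matrix_i w i.
have ew : map_mx g w' = wk by apply/row_matrixP => i; rewrite -map_row rowK hw2.
have hfull : row_full (map_mx g (col_mx w' F)).
  by rewrite map_col_mx ew eF -sub1mx -addsmxE (adds_eqmx ewk (eqmx_refl _)) addsmxE sub1mx.
have hfree : row_free (map_mx g (col_mx w' F)).
  by rewrite /row_free eqn_leq rank_leq_row /=; move: hfull => /eqP->; lia.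
have [Z hZ] := local_left_inv gsurj gunit hfull.
have [Z' hZ'] := local_right_inv gsurj gunit hfree.
have eZ : Z' = Z by rewrite -[Z']mul1mx -hZ -mulmxA hZ' mulmx1.
pose Y := lsubmx Z; pose C := rsubmx Z.
have {hZ} h1 : Y *m w' + C *m F = 1%:M by rewrite -mul_row_col hsubmxK.
have : block_mx (w' *m Y) (w' *m C) (F *m Y) (F *m C) = 1%:M.
  by rewrite -mul_col_row hsubmxK -eZ.
rewrite scalar_mx_block => /eq_block_mx[wY wC FY FC].
exists C, F; split=> // v; split=> [hv|e]; last first.
  rewrite -[v]mulmx1 -h1 mulmxDr !mulmxA e mul0mx addr0.
  by apply: submod_mulmx => // i; rewrite rowK.
apply/rowP => j; rewrite [RHS]mxE.
have rows l : W (row l (col_mx v w' : 'M_(1 + (N - p), N))).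
  by case: (split_ordP l) => l' ->; rewrite ?rowKu ?rowKd ?rowK // ord1 row_id.
have := hW _ (row_mx (col j C) Y) rows.
have wCj : w' *m col j C = 0 by rewrite colE mulmxA wC mul0mx.
have e := mul_col_row v w' (col j C) Y; rewrite wY wCj in e.
have -> : \det ((col_mx v w' : 'M_((N - p).+1, N)) *m row_mx (col j C) Y) =
    \det (block_mx (v *m col j C) (v *m Y) 0 1%:M).
  by congr (\det _); exact: e.
rewrite det_ublock det1 mulr1 det_mx11 => <-.
by rewrite colE mulmxA -colE [RHS]mxE.
Qed.

End LocalMinors.

(** * The graded ideal generated in one degree *)

Inductive gen_ideal (n : nat) (E : forall d, 'I_('C(n + d, n)) -> 'X_{1..n.+1})
    (R : comNzRingType) (r : nat) (L : 'rV[R]_('C(n + r, n)) -> Prop) : gfamily n R :=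
  | gen_base v : L v -> @gen_ideal n E R r L r v
  | gen_zero d : @gen_ideal n E R r L d 0
  | gen_add d u v : @gen_ideal n E R r L d u -> @gen_ideal n E R r L d v ->
      @gen_ideal n E R r L d (u + v)
  | gen_scale d a v : @gen_ideal n E R r L d v -> @gen_ideal n E R r L d (a *: v)
  | gen_mult d i v : @gen_ideal n E R r L d v ->
      @gen_ideal n E R r L d.+1 (v *m mult_mx E R i d).

Section GeneratedIdeal.
Context (n : nat) (E : forall d, 'I_('C(n + d, n)) -> 'X_{1..n.+1}) (r : nat).

Lemma gen_graded (R : comNzRingType) (L : 'rV[R]_('C(n + r, n)) -> Prop) :
  graded_ideal E (gen_ideal E L).
Proof.
split=> [d|d i v]; last exact: gen_mult.
by split; [exact: gen_zero|exact: gen_add|exact: gen_scale].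
Qed.

Lemma gen_min (R : comNzRingType) (L : 'rV[R]_('C(n + r, n)) -> Prop) (I : gfamily n R) :
  graded_ideal E I -> (forall v, L v -> I r v) ->
  forall d v, gen_ideal E L v -> I d v.
Proof.
move=> [sI mI] h d v; elim=> {d v} [v /h //|d|d u v _ hu _ hv|d a v _ hv|d i v _ hv].
- by case: (sI d).
- by case: (sI d) => _ hD _; apply: hD.
- by case: (sI d) => _ _; apply.
- exact: mI.
Qed.

(** Minimality is applied to the graded ideal that is 0 below degree r, L in degree r and everything
    above; degree r is recognized by transport along [d = r]. *)
Lemma gen_degree (R : comNzRingType) (L : 'rV[R]_('C(n + r, n)) -> Prop) : is_submod L ->
  forall v, gen_ideal E L v -> L v.
Proof.
move=> sL v hv; pose I : gfamily n R := fun d v =>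
  (forall e : d = r, L (eq_rect d (fun d => 'rV[R]_('C(n + d, n))) v r e)) /\ ((d < r)%N -> v = 0).
have /gen_min-/(_ I)h := hv; have [] := h => //; last by move=> /(_ erefl).
- case: (sL) => h0 hD hZ; split=> [d|d i w [h1 h2]]; first split.
  + by split=> // e; subst d.
  + move=> x y [x1 x2] [y1 y2]; split=> [e|lt]; last by rewrite x2 // y2 // addr0.
    by have := x1 e; have := y1 e; subst d => /= hy hx; apply: hD.
  + move=> a x [x1 x2]; split=> [e|lt]; last by rewrite x2 // scaler0.
    by have := x1 e; subst d => /= hx; apply: hZ.
  + split=> [e|lt]; last by rewrite h2 ?mul0mx //; lia.
    subst r; rewrite h2 ?mul0mx //=.
- move=> w hw; split=> [e|]; last by rewrite ltnn.
  by rewrite (eq_axiomK e).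
Qed.

Lemma gen_map (A B : comNzRingType) (g : {rmorphism A -> B})
    (L : 'rV[A]_('C(n + r, n)) -> Prop) (L' : 'rV[B]_('C(n + r, n)) -> Prop) :
  (forall v, L v -> L' (map_mx g v)) ->
  forall d v, @gen_ideal n E A r L d v -> @gen_ideal n E B r L' d (map_mx g v).
Proof.
move=> h d v; elim=> {d v} [v /h|d|d u v _ hu _ hv|d a v _ hv|d i v _ hv].
- exact: gen_base.
- by rewrite map_mx0; exact: gen_zero.
- by rewrite map_mxD; exact: gen_add.
- by rewrite map_mxZ; exact: gen_scale.
- by rewrite map_mxM mult_mx_map; exact: gen_mult.
Qed.

Lemma Grass_map_graded (A B : comNzRingType) (g : {rmorphism A -> B}) (I : gfamily n A) :
  graded_ideal E I -> graded_ideal E (fun d => Grass_map g (@I d)).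
Proof.
move=> [sI mI]; split=> [d|d i v]; first exact: Grass_map_submod.
move: v; apply: (Grass_map_ind (W' := fun v => Grass_map g (@I d.+1) (v *m mult_mx E B i d))).
  exact/submod_comp/Grass_map_submod.
move=> v /mI-/(_ i) h; rewrite -(mult_mx_map E g) -map_mxM; exact: Grass_map_sub.
Qed.

Lemma gen_base_change (A B : comNzRingType) (g : {rmorphism A -> B})
    (L : 'rV[A]_('C(n + r, n)) -> Prop) d (v : 'rV[B]_('C(n + d, n))) :
  Grass_map g (gen_ideal E L (d := d)) v <-> gen_ideal E (Grass_map g L) v.
Proof.
split; last first.
  apply: (gen_min (I := fun d => Grass_map g (gen_ideal E L (d := d)))).
    exact/Grass_map_graded/gen_graded.
  by apply: Grass_map_ind; [exact: Grass_map_submod|move=> w hw; apply: Grass_map_sub; exact: gen_base].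
apply: Grass_map_ind; first by case: (gen_graded (Grass_map g L)).
by move=> w; apply: gen_map => u; exact: Grass_map_sub.
Qed.

End GeneratedIdeal.

(** * Graded ideals and the standard charts *)

Section Dehomogenization.
Context (n : nat) (i : 'I_n.+1).

Definition drop_var (m : 'X_{1..n.+1}) : 'X_{1..n} := [multinom m (lift i l) | l < n].

Lemma mdeg_drop m : mdeg m = (m i + mdeg (drop_var m))%N.
Proof. by rewrite !mdegE (bigD1_ord i) //=; congr (_ + _)%N; apply: eq_bigr => l _; rewrite mnmE. Qed.

Lemma drop_var_inj m m' : mdeg m = mdeg m' -> drop_var m = drop_var m' -> m = m'.
Proof.
rewrite !mdeg_drop => e h; rewrite h in e; move/addIn: e => e.
apply/mnmP => j; case: (unliftP i j) => [l|] -> //.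
by have := congr1 (fun m : 'X_{1..n} => m l) h; rewrite !mnmE.
Qed.

Lemma drop_var_surj m D : (mdeg m <= D)%N ->
  exists2 m', mdeg m' = D & drop_var m' = m.
Proof.
move=> le; pose m' := [multinom if unlift i j is Some l then m l else D - mdeg m | j < n.+1]%N.
have e : drop_var m' = m by apply/mnmP => l; rewrite !mnmE liftK.
by exists m' => //; rewrite mdeg_drop e mnmE unlift_none; lia.
Qed.

Section Ring.
Context (A : comNzRingType).
Local Notation dh := (@dehomog n A i).

Fact dehomog_zmod_morphism : zmod_morphism dh. Proof. exact: raddfB. Qed.

Fact dehomog_monoid_morphism : monoid_morphism dh.
Proof. by split; [exact: rmorph1|exact: rmorphM]. Qed.

HB.instance Definition _ := GRing.isZmodMorphism.Build _ _ dh dehomog_zmod_morphism.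
HB.instance Definition _ := GRing.isMonoidMorphism.Build _ _ dh dehomog_monoid_morphism.

Lemma dehomogX m : dh 'X_[m] = 'X_[drop_var m].
Proof.
rewrite /dehomog mmapX /mmap1 (bigD1_ord i) //= unlift_none expr1n mul1r.
by rewrite [RHS](mpolyXE _ 1%g); apply: eq_bigr => l _; rewrite liftK perm.perm1 mnmE.
Qed.

Lemma dehomogZ c f : dh (c *: f) = c *: dh f.
Proof. by rewrite /dehomog mmapZ mul_mpolyC. Qed.

Lemma dehomog_self : dh 'X_i = 1.
Proof. by rewrite /dehomog mmapX mmap1U unlift_none. Qed.

End Ring.

Lemma dehomog_map (A B : comNzRingType) (g : {rmorphism A -> B}) f :
  map_mpoly g (dehomog i f) = dehomog i (map_mpoly g f).
Proof.
elim/mpolyind: f => [|c m f _ _ IH]; first by rewrite !rmorph0.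
rewrite !rmorphD /= IH; congr (_ + _).
by rewrite map_mpolyZ dehomogZ map_mpolyZ dehomogZ !(dehomogX, map_mpolyX).
Qed.

End Dehomogenization.

Section Forms.
Context (n : nat) (E : forall d, 'I_('C(n + d, n)) -> 'X_{1..n.+1}).
Hypothesis hE : forall d, monomial_basis d (@E d).

Definition mform (A : comNzRingType) d (v : 'rV[A]_('C(n + d, n))) : {mpoly A[n.+1]} :=
  \sum_k v 0 k *: 'X_[E k].

Lemma mdegEk d (k : 'I_('C(n + d, n))) : mdeg (E k) = d.
Proof. by apply/(hE d).2; exists k. Qed.

Section Ring.
Context (A : comNzRingType).

Fact form_linear d : linear (@mform A d).
Proof.
move=> a u v; rewrite /mform scaler_sumr -big_split; apply: eq_bigr => k _ /=.
by rewrite !mxE scalerDl scalerA.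
Qed.

HB.instance Definition _ d := GRing.isLinear.Build A 'rV[A]_('C(n + d, n)) {mpoly A[n.+1]}
  _ (@mform A d) (@form_linear d).

Lemma form_homog d (v : 'rV[A]_('C(n + d, n))) : mform v \is d.-homog.
Proof. by apply: rpred_sum => k _; apply: rpredZ; rewrite dhomogX /= mdegEk. Qed.

Lemma form_coef d (v : 'rV[A]_('C(n + d, n))) k : (mform v)@_(E k) = v 0 k.
Proof.
rewrite raddf_sum (bigD1 k) //= mcoeffZ mcoeffX eqxx mulr1 big1 ?addr0 // => l lk.
rewrite mcoeffZ mcoeffX; case: eqP => [/(hE d).1 e|]; last by rewrite mulr0.
by rewrite e eqxx in lk.
Qed.

Lemma form_inj d : injective (@mform A d).
Proof. by move=> u v e; apply/rowP => k; rewrite -!form_coef e. Qed.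

Lemma form_surj d (f : {mpoly A[n.+1]}) : f \is d.-homog -> exists v, f = @mform A d v.
Proof.
move=> hf; exists (\row_k f@_(E k)); apply/mpolyP => m.
have [e|ne] := eqVneq (mdeg m) d.
  by have [k <-] := (proj1 ((hE d).2 m) e); rewrite form_coef mxE.
rewrite (dhomog_nemf_coeff hf) // (dhomog_nemf_coeff (form_homog _)) //.
Qed.

Lemma form_mult d j (v : 'rV[A]_('C(n + d, n))) : mform (v *m mult_mx E A j d) = 'X_j * mform v.
Proof.
rewrite /mform mulr_sumr.
under eq_bigr => l _ do rewrite mxE scaler_suml.
rewrite exchange_big; apply: eq_bigr => k _.
have [l [hl _]] := mult_mx_row hE j k.
rewrite (bigD1 l) //= mxE hl eqxx mulr1 big1 => [|l' ll'].
  by rewrite addr0 -scalerAr mpolyXD mulrC.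
rewrite mxE -hl; case: eqP => [/(hE d.+1).1 e|]; last by rewrite mulr0 scale0r.
by rewrite e eqxx in ll'.
Qed.

Lemma dehomog_form i d (v : 'rV[A]_('C(n + d, n))) :
  dehomog i (mform v) = \sum_k v 0 k *: 'X_[drop_var i (E k)].
Proof. by rewrite rmorph_sum; apply: eq_bigr => k _; rewrite /= dehomogZ dehomogX. Qed.

Lemma dehomog_form_coef i d (v : 'rV[A]_('C(n + d, n))) k :
  (dehomog i (mform v))@_(drop_var i (E k)) = v 0 k.
Proof.
rewrite dehomog_form raddf_sum (bigD1 k) //= mcoeffZ mcoeffX eqxx mulr1 big1 ?addr0 // => l lk.
rewrite mcoeffZ mcoeffX; case: eqP => [/drop_var_inj e|]; last by rewrite mulr0.
have hd : mdeg (E l) = mdeg (E k) by rewrite !mdegEk.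
by rewrite ((hE d).1 _ _ (e hd)) eqxx in lk.
Qed.

Lemma dehomog_homog_inj i d (f h : {mpoly A[n.+1]}) : f \is d.-homog -> h \is d.-homog ->
  dehomog i f = dehomog i h -> f = h.
Proof.
move=> /form_surj[u ->] /form_surj[v ->] e; congr mform; apply/rowP => k.
by rewrite -!(dehomog_form_coef i) e.
Qed.

(** Homogenization to degree d, defined linearly on all polynomials: monomials of degree above d are
    dropped, so it is faithful only for d large. *)
Definition homog_row i d (h : {mpoly A[n]}) : 'rV[A]_('C(n + d, n)) :=
  \row_k h@_(drop_var i (E k)).

Fact homog_row_linear i d : linear (homog_row i d).
Proof. by move=> a x y; apply/rowP => k; rewrite !mxE mcoeffD mcoeffZ. Qed.

Lemma homog_rowK i d h : (msize h <= d)%N -> dehomog i (mform (homog_row i d h)) = h.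
Proof.
move=> hd; apply/mpolyP => m; have [le|lt] := leqP (mdeg m) d.
  have [m' hm' <-] := drop_var_surj i le.
  have [k <-] := (proj1 ((hE d).2 m') hm'); by rewrite dehomog_form_coef mxE.
rewrite (memN_msupp_eq0 (msize_mdeg_ge (leq_trans hd (ltnW lt)))).
rewrite dehomog_form raddf_sum big1 // => k _ /=.
rewrite mcoeffZ mcoeffX; case: eqP => [e|]; last by rewrite mulr0.
by have := mdeg_drop i (E k); rewrite mdegEk e; lia.
Qed.

Lemma dehomog_surj i (h : {mpoly A[n]}) : exists D0, forall D, (D0 <= D)%N ->
  exists v : 'rV[A]_('C(n + D, n)), dehomog i (mform v) = h.
Proof. by exists (msize h) => D hD; exists (homog_row i D h); apply: homog_rowK. Qed.

End Ring.

Lemma form_map (A B : comNzRingType) (g : {rmorphism A -> B}) d (v : 'rV[A]_('C(n + d, n))) :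
  map_mpoly g (mform v) = mform (map_mx g v).
Proof.
rewrite /mform raddf_sum; apply: eq_bigr => k _ /=.
by rewrite map_mpolyZ map_mpolyX mxE.
Qed.

Section Charts.
Context (A : comNzRingType).
Implicit Types (I : gfamily n A) (X : chart_family n A).

Definition form_in I d (f : {mpoly A[n.+1]}) := exists2 v, I d v & f = mform v.

Lemma homog_power j m d (f : {mpoly A[n.+1]}) : f \is d.-homog ->
  'X_j ^+ m * f \is (m + d).-homog.
Proof.
move=> hf; apply: dhomogM => //; rewrite -[m in m.-homog]mul1n.
by apply: dhomogMn; rewrite dhomogX /= mdeg1.
Qed.

Lemma form_in_form I d (v : 'rV[A]_('C(n + d, n))) : form_in I d (mform v) <-> I d v.
Proof. by split=> [[w hw /form_inj->]|h] //; exists v. Qed.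

Lemma form_in_homog I d f : form_in I d f -> f \is d.-homog.
Proof. by move=> [v _ ->]; exact: form_homog. Qed.

Lemma form_inD I d f h : graded_ideal E I -> form_in I d f -> form_in I d h -> form_in I d (f + h).
Proof.
move=> [sI _] [u hu ->] [v hv ->]; exists (u + v); last by rewrite linearD.
by case: (sI d) => _ hD _; apply: hD.
Qed.

Lemma form_in_var I d j f : graded_ideal E I -> form_in I d f -> form_in I d.+1 ('X_j * f).
Proof.
move=> [_ mI] [v hv ->]; exists (v *m mult_mx E A j d); first exact: mI.
by rewrite form_mult.
Qed.

Lemma form_in_monom I d m f : graded_ideal E I -> form_in I d f ->
  form_in I (mdeg m + d) ('X_[m] * f).
Proof.
move=> gI; have [D] := ubnP (mdeg m); elim: D m => [//|D IH] m lt hf.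
have [m0|[j hj]] : mdeg m = 0%N \/ exists j, (0 < m j)%N.
  have [->|/eqP nz] := eqVneq (mdeg m) 0%N; [by left|right].
  apply: contrapT => h; apply: nz; rewrite mdegE big1 // => j _.
  by apply/eqP; rewrite -leqn0 leqNgt; apply/negP => hj; apply: h; exists j.
  by move: m0 => /eqP; rewrite mdeg_eq0 => /eqP->; rewrite mpolyX0 mul1r mdeg0.
have le : (U_(j) <= m)%MM by rewrite lep1mP -lt0n.
have em : m = (U_(j) + (m - U_(j)))%MM by rewrite addmC submK.
have dm : mdeg m = (mdeg (m - U_(j))%MM).+1 by rewrite {1}em mdegD mdeg1.
rewrite {2}em mpolyXD -mulrA dm addSn; apply: form_in_var => //.
by apply: IH => //; move: lt; rewrite dm.
Qed.

Lemma form_in_mul I d D g f : graded_ideal E I -> g \is D.-homog -> form_in I d f ->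
  form_in I (D + d) (g * f).
Proof.
move=> gI /form_surj[v ->] hf; rewrite /mform mulr_suml.
elim/big_ind: _ => [|x y|k _].
- by exists 0; [case: gI => /(_ (D + d)%N)[]|rewrite linear0].
- exact: form_inD.
- have [w hw e] := form_in_monom (E k) gI hf; rewrite mdegEk in w hw e.
  exists (v 0 k *: w); last by rewrite -scalerAl e linearZ.
  by case: gI => /(_ (D + d)%N)[_ _ hZ] _; apply: hZ.
Qed.

Lemma form_in_power I d j m f : graded_ideal E I -> form_in I d f ->
  form_in I (m + d) ('X_j ^+ m * f).
Proof.
move=> gI h; elim: m => [|m IH]; first by rewrite mul1r.
by rewrite exprS -mulrA addSn; apply: form_in_var.
Qed.

(** Induction on the sum of the exponents. If all are positive, x_j v satisfies the hypothesis with
    m_j lowered by one, so it lies in the saturation for every j. *)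
Lemma powers_sat I d (v : 'rV[A]_('C(n + d, n))) (m : 'I_n.+1 -> nat) : graded_ideal E I ->
  (forall j, form_in I (m j + d) ('X_j ^+ m j * mform v)) -> sat E I v.
Proof.
move=> gI; have [D] := ubnP (\sum_j m j)%N; elim: D d v m => [//|D IH] d v m lt h.
have [[j mj]|nz] := EM (exists j, m j = 0%N).
  by exists 0%N => /=; have := h j; rewrite mj mul1r => /form_in_form.
apply: sat_saturated => // j.
have mj : (0 < m j)%N by rewrite lt0n; apply/eqP => mj; apply: nz; exists j.
apply: (IH _ _ (fun i => m i - (i == j))%N).
  apply: leq_trans (_ : (\sum_j m j <= D)%N); last by rewrite -ltnS.
  rewrite (bigD1 j) //= [X in (_ < X)%N](bigD1 j) //= eqxx -addSn; apply: leq_add; first by lia.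
  by apply: leq_sum => i _; exact: leq_subr.
move=> i; rewrite form_mult; have [->|ij] := eqVneq i j.
  rewrite mulrA -exprSr; have -> : (m j - true + d.+1 = m j + d)%N by lia.
  by have -> : (m j - true).+1 = m j by lia.
by rewrite subn0 mulrCA addnS; apply: form_in_var.
Qed.

(** Degrees below r are left out because the ideals in question are controlled only from r on.
    Multiplication by powers of x_i shows that the charts of a graded ideal do not change. *)
Definition chart I r : chart_family n A := fun i h =>
  exists d, (r <= d)%N /\ exists2 v, I d v & h = dehomog i (mform v).

(** Forms with the same dehomogenization become equal after multiplication by powers of x_i that
    equalize the degrees. *)
Lemma chart_lift I r i d (f : {mpoly A[n.+1]}) : graded_ideal E I -> f \is d.-homog ->
  chart I r i (dehomog i f) -> exists m, (r <= m + d)%N /\ form_in I (m + d) ('X_i ^+ m * f).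
Proof.
move=> gI hf [e [re [w hw ew]]]; exists e; split; first by lia.
have -> : 'X_i ^+ e * f = 'X_i ^+ d * mform w.
  apply: (@dehomog_homog_inj _ i (e + d)).
  - exact: homog_power.
  - by rewrite addnC; apply: homog_power; exact: form_homog.
  - by rewrite !rmorphM !rmorphXn /= !dehomog_self !expr1n !mul1r.
by rewrite addnC; apply: form_in_power => //; exists w.
Qed.

Lemma form_in_chart I r i d f : (r <= d)%N -> form_in I d f -> chart I r i (dehomog i f).
Proof. by move=> rd [v hv ->]; exists d; split=> //; exists v. Qed.

Lemma chart_ideal I r i : graded_ideal E I -> is_ideal (chart I r i).
Proof.
move=> gI; have shift d e v : (r <= d)%N -> I d v ->
    form_in I (e + d) ('X_i ^+ e * mform v) /\ dehomog i ('X_i ^+ e * mform v) = dehomog i (mform v).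
  move=> rd hv; split; first by apply: form_in_power => //; exists v.
  by rewrite rmorphM rmorphXn /= dehomog_self expr1n mul1r.
split=> [|x y [d [rd [u hu ->]]] [e [re [w hw ->]]]|a x [d [rd [u hu ->]]]].
- by exists r; split=> //; exists 0; [case: gI => /(_ r)[]|rewrite linear0 rmorph0].
- have [h1 <-] := shift d e u rd hu; have [h2 <-] := shift e d w re hw.
  rewrite -rmorphD; apply: (@form_in_chart _ _ _ (e + d)%N); first by lia.
  by apply: form_inD => //; rewrite addnC.
- have [D0 /(_ D0 (leqnn _))[v <-]] := dehomog_surj i a.
  rewrite -rmorphM; apply: (@form_in_chart _ _ _ (D0 + d)%N); first by lia.
  by apply: form_in_mul => //; [exact: form_homog|exists u].
Qed.

Lemma chart_closed I r : graded_ideal E I -> closed_subscheme (chart I r).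
Proof.
move=> gI; split=> [i|i j d f hf]; first exact: chart_ideal.
suff H i' j' : (exists m, chart I r i' (dehomog i' 'X_j' ^+ m * dehomog i' f)) ->
    exists m, chart I r j' (dehomog j' 'X_i' ^+ m * dehomog j' f).
  by split; apply: H.
move=> [m]; rewrite -rmorphXn -rmorphM => h.
have hX : 'X_j' ^+ m * f \is (m + d).-homog.
  exact: homog_power.
have [m' [le h']] := chart_lift gI hX h; exists m'.
have := form_in_chart j' le h'.
by rewrite !rmorphM !rmorphXn /= dehomog_self expr1n mul1r.
Qed.

Definition section_ideal X : gfamily n A := fun d v => H0_ideal X d (mform v).

Lemma section_idealE X d (v : 'rV[A]_('C(n + d, n))) :
  section_ideal X v <-> forall i, X i (dehomog i (mform v)).
Proof. by split=> [[]//|h]; split=> //; exact: form_homog. Qed.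

Lemma section_graded X : (forall i, is_ideal (X i)) -> graded_ideal E (section_ideal X).
Proof.
move=> hX; split=> [d|d j v /section_idealE h]; last first.
  by apply/section_idealE => i; rewrite form_mult rmorphM; case: (hX i) => _ _; apply.
split=> [|x y /section_idealE hx /section_idealE hy|a x /section_idealE hx];
  apply/section_idealE => i; case: (hX i) => h0 hD hM.
- by rewrite linear0 rmorph0.
- by rewrite linearD rmorphD; apply: hD.
- by rewrite linearZ dehomogZ -mul_mpolyC; apply: hM.
Qed.

Lemma section_saturated X : saturated E (section_ideal X).
Proof.
move=> d v h; apply/section_idealE => i; have /section_idealE/(_ i) := h i.
by rewrite form_mult rmorphM /= dehomog_self mul1r.
Qed.

(** X is recovered from its sections: h is homogenized, and by gluing a common power of x_i brings
    the form into the ideal of every chart. *)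
Lemma chart_section X r i h : closed_subscheme X ->
  chart (section_ideal X) r i h <-> X i h.
Proof.
move=> [hX glue]; split=> [[d [_ [v /section_idealE hv ->]]] //|hh].
have [D0 hD] := dehomog_surj i h; have [v ev] := hD (maxn D0 r) (leq_maxl _ _).
have /fin_all_exists[m hm] j : exists m, X j (dehomog j 'X_i ^+ m * dehomog j (mform v)).
  by apply/(glue i j (maxn D0 r) _ (form_homog v)); exists 0%N; rewrite ev mul1r.
pose M := (\max_j m j)%N.
have hF : 'X_i ^+ M * mform v \is (M + maxn D0 r).-homog.
  by apply: homog_power; exact: form_homog.
have [w ew] := form_surj hF; exists (M + maxn D0 r)%N; split; first by lia.
exists w; last by rewrite -ew rmorphM rmorphXn /= dehomog_self expr1n mul1r.
apply/section_idealE => j; rewrite -ew rmorphM rmorphXn /=.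
have -> : M = ((M - m j) + m j)%N by rewrite subnK // /M; exact: leq_bigmax.
by rewrite exprD -mulrA; case: (hX j) => _ _; apply.
Qed.

Lemma section_chart_sat I r d (v : 'rV[A]_('C(n + d, n))) : graded_ideal E I ->
  section_ideal (chart I r) v -> sat E I v.
Proof.
move=> gI /section_idealE h.
have /fin_all_exists[m hm] j : exists m, form_in I (m + d) ('X_j ^+ m * mform v).
  by have [m [_ hm]] := chart_lift gI (form_homog v) (h j); exists m.
exact: powers_sat hm.
Qed.

Lemma section_chart_sub I r d (v : 'rV[A]_('C(n + d, n))) : (r <= d)%N -> I d v ->
  section_ideal (chart I r) v.
Proof. by move=> rd hv; apply/section_idealE => i; exists d; split=> //; exists v. Qed.

End Charts.

Lemma chart_base_change (A B : comNzRingType) (g : {rmorphism A -> B}) (I : gfamily n A) r :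
  graded_ideal E I ->
  base_change g (chart I r) = chart (fun d => Grass_map g (@I d)) r.
Proof.
move=> gI; have gB := Grass_map_graded g gI.
apply: funext => i; apply: funext => h; apply: propext; split.
  apply; first exact: chart_ideal.
  move=> _ [_ [d [rd [v hv ->]]] ->]; exists d; split=> //; exists (map_mx g v).
    exact: Grass_map_sub.
  by rewrite dehomog_map form_map.
move=> [d [rd [w hw ->]]].
have [h0 hD hM] := ideal_gen_ideal (fun f => exists2 h, chart I r i h & f = map_mpoly g h).
apply: (Grass_map_ind (W' := fun w => base_change g (chart I r) i (dehomog i (mform w)))) hw.
  split=> [|x y|a x]; first by rewrite linear0 rmorph0.
    by rewrite linearD rmorphD; apply: hD.
  by rewrite linearZ dehomogZ -mul_mpolyC; apply: hM.
move=> v hv; apply: ideal_gen_sub; exists (dehomog i (mform v)).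
  by exists d; split=> //; exists v.
by rewrite dehomog_map form_map.
Qed.

End Forms.

(** * Modules of functions and maps out of quotients *)

Section FunctionModule.
Context (J : Type) (R : comNzRingType) (M : lmodType R).

Definition fun_module of phant R := J -> M.
Local Notation F := (fun_module (Phant R)).

HB.instance Definition _ := gen_eqMixin F.
HB.instance Definition _ := gen_choiceMixin F.

Fact fun_addA : associative (fun (f h : F) => (fun j => f j + h j) : F).
Proof. by move=> f h l; apply: funext => j; rewrite addrA. Qed.
Fact fun_addC : commutative (fun (f h : F) => (fun j => f j + h j) : F).
Proof. by move=> f h; apply: funext => j; rewrite addrC. Qed.
Fact fun_add0 : left_id ((fun _ => 0) : F) (fun f h => (fun j => f j + h j) : F).
Proof. by move=> f; apply: funext => j; rewrite add0r. Qed.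
Fact fun_addN : left_inverse ((fun _ => 0) : F) (fun f => (fun j => - f j) : F)
  (fun f h => (fun j => f j + h j) : F).
Proof. by move=> f; apply: funext => j; rewrite addNr. Qed.

HB.instance Definition _ := GRing.isZmodule.Build F fun_addA fun_addC fun_add0 fun_addN.

Definition fun_scale (c : R) (f : F) : F := fun j => c *: f j.
Fact fun_scaleA a b v : fun_scale a (fun_scale b v) = fun_scale (a * b) v.
Proof. by apply: funext => j; rewrite /fun_scale scalerA. Qed.
Fact fun_scale1 : left_id 1 fun_scale.
Proof. by move=> f; apply: funext => j; rewrite /fun_scale scale1r. Qed.
Fact fun_scaleDr : right_distributive fun_scale +%R.
Proof. by move=> a f h; apply: funext => j; rewrite /fun_scale scalerDr. Qed.
Fact fun_scaleDl v : {morph fun_scale^~ v : a b / a + b}.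
Proof. by move=> a b; apply: funext => j; rewrite /fun_scale scalerDl. Qed.

HB.instance Definition _ :=
  GRing.Zmodule_isLmodule.Build R F fun_scaleA fun_scale1 fun_scaleDr fun_scaleDl.

Lemma fun_addE (f h : F) j : (f + h) j = f j + h j. Proof. by []. Qed.
Lemma fun_scaleE c (f : F) j : (c *: f) j = c *: f j. Proof. by []. Qed.
Lemma fun_sumE (T : Type) (s : seq T) (G : T -> F) j :
  (\sum_(x <- s) G x) j = \sum_(x <- s) G x j.
Proof. by elim: s => [|x s IH]; rewrite ?big_nil // !big_cons fun_addE IH. Qed.

End FunctionModule.

Section LinearFun.
Context (R : comNzRingType) (U V : lmodType R) (f : U -> V) (hf : linear f).

Lemma linear_fun0 : f 0 = 0.
Proof. by have := hf (-1) 0 0; rewrite scaler0 addr0 scaleN1r addNr. Qed.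

Lemma linear_funZ a x : f (a *: x) = a *: f x.
Proof. by have := hf a x 0; rewrite !addr0 linear_fun0 addr0. Qed.

Lemma linear_funD x y : f (x + y) = f x + f y.
Proof. by have := hf 1 x y; rewrite !scale1r. Qed.

Lemma linear_fun_sum (I : Type) (s : seq I) (F : I -> U) :
  f (\sum_(i <- s) F i) = \sum_(i <- s) f (F i).
Proof. by elim/big_rec2: _ => [|i x y _ <-]; [exact: linear_fun0|rewrite linear_funD]. Qed.

End LinearFun.

Section QuotientLift.
Context (R : comNzRingType) (V U : lmodType R) (W : V -> Prop) (hW : is_submod W).
Context (f : {linear V -> U}) (hf : forall x, W x -> f x = 0).

Definition quot_lift of (forall x, W x -> f x = 0) := fun q : quotient_of hW => f (class_repr q).

Lemma quot_liftE x : quot_lift hf (quot_pi hW x) = f x.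
Proof.
apply/eqP; rewrite -subr_eq0 -linearB; apply/eqP/hf.
exact: quot_reprB.
Qed.

Fact quot_lift_linear : linear (quot_lift hf).
Proof.
move=> a p q; have [x ->] := quot_pi_surj p; have [y ->] := quot_pi_surj q.
by rewrite -linearP !quot_liftE linearP.
Qed.

HB.instance Definition _ := GRing.isLinear.Build R (quotient_of hW) U _ (quot_lift hf)
  quot_lift_linear.

End QuotientLift.

(** * The Hilbert functor *)

Section HilbertPolynomial.
Local Open Scope ring_scope.

Lemma hf_sum d a : hf d a = (\sum_(i < size a) 'C(d - i + nth 0%N a i, d - i))%N.
Proof.
elim: a d => [|x a IH] d /=; first by rewrite big_ord0.
rewrite big_ord_recl /= subn0 IH; congr addn; apply: eq_bigr => i _.
by rewrite /bump /= add1n subnS predn_sub.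
Qed.

Lemma binomial_polyE (t i x : nat) : (i <= t)%N ->
  (binomial_poly (x%:R - i%:R) x).[t%:R] = 'C(t - i + x, t - i)%:R.
Proof.
move=> it; rewrite /binomial_poly hornerZ horner_prod.
have -> : \prod_(j < x) ('X + (x%:R - i%:R - j%:R)%:P).[t%:R] = ((t - i + x) ^_ x)%:R :> rat.
  rewrite ffact_prod natr_prod; apply: eq_bigr => j _.
  rewrite hornerD hornerX hornerC natrB; last by have := ltn_ord j; lia.
  by rewrite natrD natrB //; ring.
rewrite -bin_ffact natrM mulrCA mulVf ?mulr1; last by rewrite Num.Theory.pnatr_eq0 -lt0n fact_gt0.
by rewrite -(bin_sub (leq_addl (t - i) x)) addnK.
Qed.

Lemma gotzmann_hf (P : {poly rat}) r (a : r.-tuple nat) :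
  P = \sum_(i < r) binomial_poly ((tnth a i)%:R - i%:R) (tnth a i) ->
  forall t, (r <= t)%N -> P.[t%:R] = (hf t a)%:R.
Proof.
move=> -> t rt; rewrite hf_sum horner_sum natr_sum size_tuple; apply: eq_bigr => i _.
by rewrite binomial_polyE ?(tnth_nth 0%N) //; have := ltn_ord i; lia.
Qed.

Context (n : nat) (E : forall d, 'I_('C(n + d, n)) -> 'X_{1..n.+1}).
Hypothesis hE : forall d, monomial_basis d (@E d).
Context (K : fieldType).

(** Translates unique coordinates in a basis into codimensions, the language of Macaulay's
    theorem. *)
Lemma hilbert_cod (X : chart_family n K) P : (forall i, is_ideal (X i)) ->
  hilbert_polynomial X P <->
  exists t0, forall t, (t0 <= t)%N -> P.[t%:R] = (cod (section_ideal E X (d := t)))%:R.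
Proof.
move=> hX; have [sI _] := section_graded hE hX.
split=> -[t0 h]; exists t0 => t /h.
  move=> [d -> [b bh hb]]; congr (_%:R); symmetry; apply: free_cod.
  have /fin_all_exists[F hF] j : exists v, b j = @mform n E K t v by exact: form_surj.
  pose Fm : 'M[K]_(d, _) := \matrix_j F j.
  have eF (c : 'rV[K]_d) : \sum_j c 0 j *: b j = mform E (c *m Fm).
    rewrite mulmx_sum_row linear_sum; apply: eq_bigr => j _.
    by rewrite linearZ /= rowK hF.
  have hv (v : 'rV[K]_('C(n + t, n))) : exists! c, section_ideal E X (v - c *m Fm).
    have [c [hc uc]] := hb _ (form_homog hE v); exists c; split.
      by move: hc; rewrite eF -linearB.
    by move=> c' hc'; apply: uc; rewrite eF -linearB.
  have /fin_all_exists[C hC] (k : 'I_('C(n + t, n))) :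
      exists c, section_ideal E X (row k 1%:M - c *m Fm).
    by have [c [hc _]] := hv (row k 1%:M); exists c.
  exists (\matrix_k C k), Fm; apply: free_quotientI => // [v|c hc].
    rewrite -{1}[v]mulmx1 -mulmxA -mulmxBr; apply: submod_mulmx => // k.
    by rewrite linearB /= row_mul rowK.
  have [c0 [_ uc]] := hv 0; rewrite -(uc 0); last by rewrite mul0mx subr0; case: (sI t).
  by symmetry; apply: uc; rewrite sub0r; apply: submodN.
move=> ->; exists (cod (section_ideal E X (d := t))) => //.
have [C [F [hFC hC]]] := cod_free (sI t) erefl.
have eF (c : 'rV[K]_(cod (section_ideal E X (d := t)))) : \sum_j c 0 j *: mform E (row j F) = mform E (c *m F).
  by rewrite mulmx_sum_row linear_sum; apply: eq_bigr => j _; rewrite linearZ.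
exists (fun j => mform E (row j F)) => [j|f /(form_surj hE)[v ->]]; first exact: form_homog.
exists (v *m C); split=> [|c]; rewrite eF -linearB.
  by apply/hC; rewrite mulmxBl -!mulmxA hFC mulmx1 subrr.
move=> /hC; rewrite mulmxBl -mulmxA hFC mulmx1 => /eqP; rewrite subr_eq0 => /eqP//.
Qed.

End HilbertPolynomial.

(** * Flatness of charts and of graded pieces *)

Section FlatCharts.
Context (n : nat) (E : forall d, 'I_('C(n + d, n)) -> 'X_{1..n.+1}).
Hypothesis hE : forall d, monomial_basis d (@E d).
Context (A : comNzRingType).

Lemma dehomog_mulmx i d p (c : 'rV[A]_p) (b : 'M[A]_(p, 'C(n + d, n))) :
  dehomog i (mform E (c *m b)) = \sum_j c 0 j *: dehomog i (mform E (row j b)).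
Proof.
rewrite mulmx_sum_row linear_sum rmorph_sum; apply: eq_bigr => j _ /=.
by rewrite linearZ /= dehomogZ.
Qed.

Lemma common_denominator (K : fieldType) (g : {rmorphism A -> K}) p (u : 'rV[K]_p) :
  residue_field g -> exists2 s, g s != 0 & exists u', g s *: u = map_mx g u'.
Proof.
move=> res; have /fin_all_exists[b hb] (j : 'I_p) : exists b, exists a, g b != 0 /\ u 0 j = g a / g b.
  by have [a [b [h1 h2]]] := res (u 0 j); exists b, a.
have /fin_all_exists[a ha] := hb.
exists (\prod_j b j); first by rewrite rmorph_prod prodf_seq_neq0; apply/allP => j _; case: (ha j).
exists (\row_j (a j * \prod_(l | l != j) b l)); apply/rowP => j.
rewrite !mxE (bigD1 j) //= !rmorphM; case: (ha j) => b0 ->.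
by rewrite mulrC mulrA mulfVK.
Qed.

(* Flatness is tested on the ideal generated by the entries of c, presented as
   the quotient of the free module by the relations between them. The bilinear
   map sends (a, h) to u(a) h in the quotient of the chart of the fibre. *)
Lemma flat_section (X : chart_family n A) (K : fieldType) (g : {rmorphism A -> K}) d :
  (forall i, is_ideal (X i)) -> (forall i, flat_quotient (X i)) -> residue_field g ->
  forall p (c : 'rV[A]_p) (b : 'M[A]_(p, 'C(n + d, n))), section_ideal E X (c *m b) ->
  forall u : 'rV[K]_p, (forall a : 'cV[A]_p, c *m a = 0 -> u *m map_mx g a = 0) ->
  section_ideal E (base_change g X) (u *m map_mx g b).
Proof.
move=> idX flX res p c b /(section_idealE hE) hcb u hu; apply/section_idealE => // i.
have [k0 kD kM] := ideal_gen_ideal (fun f => exists2 h, X i h & f = map_mpoly g h).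
(* The bilinear map needs coefficients in A, so u is replaced by its numerator; s is invertible in K
   and is divided out at the end. *)
have [s s0 [u' eu]] := common_denominator u res.
pose W (h : {mpoly A[n]}) := base_change g X i (map_mpoly g h).
have sW : is_submod W.
  split=> [|x y|a x]; first by rewrite /W rmorph0.
    by rewrite /W rmorphD; apply: kD.
  by rewrite /W map_mpolyZ -mul_mpolyC; apply: kM.
pose rel (a : 'rV[A]_p) := a *m c^T = 0.
have srel : is_submod rel by apply: (submod_comp (W := fun x : 'rV[A]_1 => x = 0));
  split=> // [x y -> ->|a x ->]; rewrite ?addr0 ?scaler0.
pose ev (x : 'rV[A]_p) : A^o := (x *m c^T) 0 0.
have ev_lin : linear ev by move=> a x y; rewrite /ev mulmxDl -scalemxAl !mxE.
pose evL := HB.pack_for {linear 'rV[A]_p -> A^o} ev (GRing.isLinear.Build _ _ _ _ ev ev_lin).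
have ev_rel x : rel x -> evL x = 0 by rewrite /= /ev => ->; rewrite mxE.
pose phi : {linear quotient_of srel -> A^o} := @quot_lift _ _ _ _ srel _ ev_rel.
have phiE x : phi (quot_pi srel x) = ev x by exact: (quot_liftE srel ev_rel).
have phi_inj : injective phi.
  move=> q1 q2; have [x ->] := quot_pi_surj q1; have [y ->] := quot_pi_surj q2.
  rewrite !phiE => e; apply/eqP; rewrite -subr_eq0 -linearB; apply/eqP/quot_pi0.
  by apply/matrixP => k l; rewrite !ord1 mulmxBl mxE [X in _ + X]mxE -/(ev x) -/(ev y) e subrr mxE.
pose v j := dehomog i (mform E (row j b)).
pose sq := [seq (quot_pi srel (delta_mx 0 j), v j) | j <- enum 'I_p].
(* The image is the tensor of 1 with the dehomogenization of c b, which lies in X i. *)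
have hz : tensor_zero (X i) [seq (phi x.1, x.2) | x <- sq].
  move=> T beta b1 b2 b3; rewrite -map_comp big_map big_enum /=.
  transitivity (beta (1 : A^o) (\sum_j c 0 j *: v j)); last by apply: b3; rewrite -dehomog_mulmx; exact: hcb.
  rewrite (linear_fun_sum (b2 1)); apply: eq_bigr => j _.
  transitivity (beta (ev (delta_mx 0 j)) (v j)); first by congr (beta _ _); exact: phiE.
  rewrite (linear_funZ (b2 1)) /ev -rowE !mxE.
  by rewrite -(linear_funZ (b1 (v j)) (c 0 j) 1) -[c 0 j *: _]/(c 0 j * 1) mulr1.
have := flX i _ _ phi phi_inj sq hz.
pose w (x : 'rV[A]_p) : A := (x *m u'^T) 0 0.
have w_lin : linear (w : _ -> A^o) by move=> a x y; rewrite /w mulmxDl -scalemxAl !mxE.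
have w_rel x h : rel x -> W (w x *: h).
  move=> hx; rewrite /W map_mpolyZ (_ : g (w x) = 0) ?scale0r //.
  have : u *m map_mx g x^T = 0 by apply: hu; rewrite -[c]trmxK -trmx_mul hx trmx0.
  move=> /(congr1 (fun M : 'M[K]_1 => g s * M 0 0)); rewrite [in RHS]mxE mulr0 => <-.
  rewrite /w !mxE rmorph_sum mulr_sumr; apply: eq_bigr => j _.
  rewrite rmorphM !mxE mulrA mulrC; congr (_ * _).
  by have := congr1 (fun M : 'rV[K]_p => M 0 j) eu; rewrite !mxE.
pose beta (q : quotient_of srel) (h : {mpoly A[n]}) : quotient_of sW :=
  w (class_repr q) *: quot_pi sW h.
have betaE x h : beta (quot_pi srel x) h = quot_pi sW (w x *: h).
  rewrite /beta -linearZ; apply/eqP; rewrite -subr_eq0 -linearB -scalerBl; apply/eqP/quot_pi0.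
  have -> : w (class_repr (quot_pi srel x)) - w x = w (class_repr (quot_pi srel x) - x).
    by rewrite /w mulmxBl [RHS]mxE [X in _ = _ + X]mxE.
  by apply: w_rel; exact: quot_reprB.
move=> /(_ _ beta) h.
have : \sum_(x <- sq) beta x.1 x.2 = 0.
  apply: h => [h'|q a x y|q h' hh].
  - move=> a q1 q2; have [x ->] := quot_pi_surj q1; have [y ->] := quot_pi_surj q2.
    by rewrite -linearP !betaE w_lin scalerDl -linearP scalerA.
  - by rewrite /beta linearP scalerDr !scalerA mulrC.
  - have [x ->] := quot_pi_surj q; rewrite betaE; apply/quot_pi0.
    rewrite /W map_mpolyZ -mul_mpolyC; apply: kM; apply: ideal_gen_sub; by exists h'.
rewrite big_map big_enum /=.
under eq_bigr => j _ do rewrite betaE.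
rewrite -linear_sum => /quot_pi0; rewrite /W.
have wE j : w (delta_mx 0 j) = u' 0 j by rewrite /w -rowE !mxE.
under eq_bigr => j _ do rewrite wE.
rewrite -dehomog_mulmx (dehomog_map i g) form_map map_mxM -eu -scalemxAl linearZ dehomogZ => hs.
rewrite -[mform E _](scale1r) -(mulVf s0) -scalerA dehomogZ -mul_mpolyC; apply: kM.
by rewrite dehomogZ.
Qed.

(* The sections of a linear functional on S_d/I_d for all large d detect the
   elements of the tensor product with the chart, which is a direct limit of
   the finitely generated projective modules S_d/I_d. *)
Lemma chart_flat (nA : noetherian A) (I : gfamily n A) r i : graded_ideal E I ->
  (forall d, (r <= d)%N -> exists p, locally_split p (@I d)) ->
  flat_quotient (chart E I r i).
Proof.
move=> gI hsplit M' M phi phi_inj s hz T beta b1 b2 b3.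
pose hom d (h : {mpoly A[n]}) := homog_row E i d h.
have homP d h : (msize h <= d)%N -> dehomog i (mform E (hom d h)) = h by exact: homog_rowK.
have hom_lin d : linear (hom d) by exact: homog_row_linear.
have homI h : chart E I r i h -> exists d0, forall d, (d0 <= d)%N -> I d (hom d h).
  move=> [e [re [w hw ew]]]; exists (maxn e (msize h)) => d hd.
  have hF : form_in E I (d - e + e) ('X_i ^+ (d - e) * mform E w).
    by apply: form_in_power => //; exists w.
  rewrite subnK in hF; last by lia.
  apply/(form_in_form hE); rewrite (_ : mform E (hom d h) = 'X_i ^+ (d - e) * mform E w) //.
  apply: (dehomog_homog_inj hE (i := i) (form_homog hE _) (form_in_homog hE hF)).
  by rewrite homP ?rmorphM ?rmorphXn /= ?dehomog_self ?expr1n ?mul1r //; lia.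
(* An index is a degree with a linear functional on S_d. The test module consists of functions on
   the indices modulo those that vanish in large degrees, because an element of the chart ideal has
   its homogenization in I_d only for d large. *)
pose J := {d : nat & 'cV[A]_('C(n + d, n))}.
pose adm (j : J) := forall v, I (tag j) v -> v *m tagged j = 0.
pose F := fun_module J M (Phant A).
pose ev0 (f : F) := exists d0, forall j, (d0 <= tag j)%N -> f j = 0.
have sev : is_submod ev0.
  split=> [|f h [d hd] [e he]|a f [d hd]].
  - by exists 0%N.
  - by exists (maxn d e) => j hj; rewrite fun_addE hd ?he ?addr0 //; lia.
  - by exists d => j hj; rewrite fun_scaleE hd ?scaler0.
pose tst (m : M) (h : {mpoly A[n]}) : F := fun j =>
  if pselect (adm j) then (hom (tag j) h *m tagged j) 0 0 *: m else 0.
have tst1 h a x y : tst (a *: x + y) h = a *: tst x h + tst y h.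
  apply: funext => j; rewrite fun_addE fun_scaleE /tst; case: pselect => /= _.
    by rewrite scalerDr !scalerA mulrC.
  by rewrite scaler0 addr0.
have tst2 m a x y : tst m (a *: x + y) = a *: tst m x + tst m y.
  apply: funext => j; rewrite fun_addE fun_scaleE /tst; case: pselect => /= _.
    by rewrite hom_lin mulmxDl -scalemxAl !mxE scalerDl scalerA.
  by rewrite scaler0 addr0.
have := hz _ (fun m h => quot_pi sev (tst m h)); rewrite big_map -linear_sum /= => hzz.
have {hzz} : ev0 (\sum_(x <- s) tst (phi x.1) x.2).
  apply/quot_pi0/hzz => [h a x y|m a x y|m h hh].
  - by rewrite tst1 linearP.
  - by rewrite tst2 linearP.
  - apply/quot_pi0; have [d0 hd0] := homI _ hh; exists d0 => j hj; rewrite /tst.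
    by case: pselect => // aj; rewrite aj ?mxE ?scale0r //; apply: hd0.
move=> [d1 hd1].
have [d2 hd2] : exists d2, forall x, x \in s -> (msize x.2 <= d2)%N.
  exists (\max_(x <- s) msize x.2)%N => x xs; rewrite (big_rem x) //=; exact: leq_maxl.
(* Large enough for I_d to be split, for the tests to vanish and for the homogenizations to be
   faithful. *)
pose d := maxn r (maxn d1 d2).
have [p sp] := hsplit d (leq_maxl _ _).
have key (l : 'cV[A]_('C(n + d, n))) : (forall v, I d v -> v *m l = 0) ->
    \sum_(x <- s) (hom d x.2 *m l) 0 0 *: x.1 = 0.
  move=> hl; apply: phi_inj; rewrite linear0 linear_sum.
  have dd1 : (d1 <= d)%N by rewrite /d; lia.
  have := hd1 (Tagged (fun d => 'cV[A]_('C(n + d, n))) l) dd1.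
  rewrite fun_sumE => e; rewrite -[RHS]e.
  apply: eq_bigr => x _; rewrite linearZ /tst; case: pselect => [//|naj] /=.
  by case: naj.
apply: (local_global nA (W := fun x : T => x = 0)).
  by split=> // [x y -> ->|a x ->]; rewrite ?addr0 ?scaler0.
move=> P hP; have [s0 ns [C [Fm [h1 h2 h3]]]] := sp P hP; exists s0 => //.
(* Modulo the chart ideal, s0 times each polynomial expands along the rows of Fm with the columns of
   C as functionals. These kill I_d, so [key] applies to each. *)
transitivity (\sum_(x <- s) \sum_(j < p) beta ((hom d x.2 *m col j C) 0 0 *: x.1) (dehomog i (mform E (row j Fm)))).
  rewrite scaler_sumr; apply: eq_big_seq => x xs; rewrite -(linear_funZ (b2 x.1)).
  have e : s0 *: x.2 = dehomog i (mform E (s0 *: hom d x.2 - hom d x.2 *m C *m Fm)) +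
      \sum_j (hom d x.2 *m col j C) 0 0 *: dehomog i (mform E (row j Fm)).
    rewrite linearB rmorphB /= linearZ /= dehomogZ homP; last by apply: leq_trans (hd2 x xs) _; rewrite /d; lia.
    rewrite dehomog_mulmx -addrA (_ : - _ + _ = 0) ?addr0 //.
    rewrite addrC; apply/eqP; rewrite subr_eq0; apply/eqP/eq_bigr => j _.
    by rewrite colE mulmxA -colE [in LHS]mxE.
  rewrite e (linear_funD (b2 x.1)) b3 ?add0r.
    rewrite (linear_fun_sum (b2 x.1)); apply: eq_bigr => j _.
    by rewrite (linear_funZ (b2 x.1)) (linear_funZ (b1 _)).
  by exists d; split; [rewrite /d; lia|exists (s0 *: hom d x.2 - hom d x.2 *m C *m Fm)].
rewrite exchange_big big1 // => j _; rewrite -(linear_fun_sum (b1 _)) key ?(linear_fun0 (b1 _)) // => v /h1 e.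
by rewrite colE mulmxA e mul0mx.
Qed.

End FlatCharts.

Section BaseChange.
Context (B : comNzRingType) (K : comNzRingType) (g : {rmorphism B -> K}).

Lemma Grass_map_onto (gsurj : forall x, exists b, g b = x) N (W : 'rV[B]_N -> Prop) :
  is_submod W -> forall u, Grass_map g W u -> exists2 v, W v & map_mx g v = u.
Proof.
move=> [h0 hD hZ]; apply: (Grass_map_ind (W' := fun u => exists2 v, W v & map_mx g v = u)).
  split=> [|_ _ [x hx <-] [y hy <-]|a _ [x hx <-]].
  - by exists 0; rewrite ?map_mx0.
  - by exists (x + y); [exact: hD|rewrite map_mxD].
  - by have [b <-] := gsurj a; exists (b *: x); [exact: hZ|rewrite map_mxZ].
by move=> v hv; exists v.
Qed.

Lemma free_base_change p N (W : 'rV[B]_N -> Prop) :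
  free_quotient p W -> free_quotient p (Grass_map g W).
Proof.
move=> [C [F [hFC hC]]]; exists (map_mx g C), (map_mx g F).
split=> [|u]; first by rewrite -map_mxM hFC map_mx1.
split.
  apply: (Grass_map_ind (W' := fun u => u *m map_mx g C = 0)).
    by apply: (submod_comp (W := fun v : 'rV[K]_p => v = 0)); split=> // [x y -> ->|a x ->];
      rewrite ?addr0 ?scaler0.
  by move=> v /hC e; rewrite -map_mxM e map_mx0.
move=> e; have -> : u = u *m map_mx g (1%:M - C *m F).
  by rewrite map_mxB map_mx1 map_mxM mulmxBr mulmx1 mulmxA e mul0mx subr0.
apply: submod_mulmx => [|i]; first exact: Grass_map_submod.
rewrite -map_row; apply: Grass_map_sub; apply/hC.
by rewrite -row_mul mulmxBl mul1mx -mulmxA hFC mulmx1 subrr row0.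
Qed.

End BaseChange.

Lemma field_split (K : fieldType) p N (W : 'rV[K]_N -> Prop) : is_submod W ->
  locally_split p W -> cod W = p.
Proof.
move=> sW h; apply: free_cod; have [|s /eqP s0 [C [F [h1 h2 h3]]]] := h (fun x => x = 0).
  split; last 2 first.
  - by apply/eqP; rewrite oner_eq0.
  - by move=> x y /eqP; rewrite mulf_eq0 => /orP[/eqP|/eqP]; [left|right].
  by split=> // [x y -> ->|a x ->]; rewrite ?addr0 ?mulr0.
exists (s^-1 *: C), F; split=> [|v]; first by rewrite -scalemxAr h3 scale_scalar_mx mulVf.
rewrite -scalemxAr; split=> [/h1->|e]; first by rewrite scaler0.
have e' : v *m C = 0 by rewrite -[_ *m _]scale1r -(mulfV s0) -scalerA e scaler0.
have := h2 v; rewrite e' mul0mx subr0 => hs; case: sW => _ _ hZ.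
by rewrite -[v]scale1r -(mulVf s0) -scalerA; apply: hZ.
Qed.

(** * Flat families and locally split graded ideals *)

Section HilbertFunctor.
Context (n : nat) (E : forall d, 'I_('C(n + d, n)) -> 'X_{1..n.+1}).
Hypothesis hE : forall d, monomial_basis d (@E d).

Context (A : comNzRingType) (nA : noetherian A).
Hypothesis hinf : forall (K : fieldType) (g : {rmorphism A -> K}),
  injective (fun i : nat => i%:R : K).
Context (P : {poly rat}) (a : seq nat) (sa : sorted geq a).
Hypothesis hP : forall t, (size a <= t)%N -> P.[t%:R] = (hf t a)%:R.

Section AtPrime.
Context (Q : A -> Prop) (hQ : is_prime_ideal Q).
Local Notation D := (zero_datum hQ).
Local Notation L := (localized D).
Local Notation t := (to_loc D).

Lemma Grass_map_saturated (I : gfamily n A) : graded_ideal E I -> saturated E I ->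
  saturated E (fun d => Grass_map t (@I d)).
Proof.
move=> [mI gI] sI d v h; have [s ns [v' ev]] := @loc_mx_clear _ _ hQ _ _ v.
apply: (loc_cancel (Grass_map_submod t _) ns); rewrite ev.
apply/(Grass_map_loc_mx hQ (mI d)).
have [i|i b x hx|s' ns' hs'] := @common_multiple _ _ hQ _
    (fun (i : 'I_n.+1) s => I d.+1 ((s *: v') *m mult_mx E A i d)).
- have : Grass_map t (@I d.+1) (map_mx t (v' *m mult_mx E A i d)).
    rewrite map_mxM mult_mx_map -ev -scalemxAl; case: (Grass_map_submod t (@I d.+1)) => _ _; apply.
    exact: h.
  by move=> /(Grass_map_loc_mx hQ (mI d.+1))[s' ns' hs']; exists s' => //; rewrite -scalemxAl.
- by rewrite -scalerA -scalemxAl; case: (mI d.+1) => _ _; apply.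
- by exists s' => //; apply: sI.
Qed.

Lemma flat_section_local (X : chart_family n A) (K : fieldType) (g : {rmorphism L -> K}) d :
  (forall i, is_ideal (X i)) -> (forall i, flat_quotient (X i)) -> residue_field (g \o t) ->
  flat_pair g (Grass_map t (section_ideal E X (d := d)))
    (section_ideal E (base_change (g \o t) X) (d := d)).
Proof.
move=> idX flX res p c b hcb u hu.
have sI := (section_graded hE idX).1 d.
have [s1 ns1 [c1 e1]] := @loc_mx_clear _ _ hQ _ _ c.
have [s2 ns2 [b2 e2]] := @loc_mx_clear _ _ hQ _ _ b.
have sIk : is_submod (section_ideal E (base_change (g \o t) X) (d := d)).
  by apply: (section_graded hE _).1 => i; exact: ideal_gen_ideal.
have [s3 ns3 hs] : exists2 s3, ~ Q s3 & section_ideal E X (s3 *: (c1 *m b2)).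
  apply/(Grass_map_loc_mx hQ sI); rewrite map_mxM -e1 -e2 -scalemxAl -scalemxAr.
  have [_ _ hZ] := Grass_map_submod t (section_ideal E X (d := d)).
  by apply: (hZ); apply: (hZ).
rewrite scalemxAl in hs.
have gs0 : g (t s2) != 0.
  have [y hy] := @loc_unit _ D s2 ns2; apply/eqP => e.
  have := congr1 g hy; rewrite rmorphM /= e mul0r rmorph1 => /eqP.
  by rewrite eq_sym oner_eq0.
have := flat_section hE idX flX res hs (u := u).
rewrite (map_mx_comp t g b2) -e2 map_mxZ -scalemxAr => h.
have {}h : section_ideal E (base_change (g \o t) X) (g (t s2) *: (u *m map_mx g b)).
  apply: h => a'; rewrite -scalemxAl => /(congr1 (map_mx t)).
  rewrite map_mxZ map_mxM map_mx0 -e1 -scalemxAl scalerA -rmorphM => e.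
  rewrite map_mx_comp; apply: hu.
  have [|y hy] := @loc_unit _ D (s3 * s1); first exact: (@primeM _ D).
  by rewrite -[_ *m _]scale1r -hy mulrC -scalerA e scaler0.
case: sIk => _ _ /(_ (g (t s2))^-1 _ h).
by rewrite scalerA mulVf // scale1r.
Qed.

(** The sections Ik of the fibre are contained in the saturation of the image Img of the sections of
    the family. In degree [size a] one exponent k serves all of Ik, so Macaulay's theorem bounds the
    codimension of Img by P in all large degrees; there Img equals Ik, that is, sections lift.
    [local_descent] carries the lifting down to degree [size a], and flatness yields freeness. *)
Lemma hilb_free_local (X : chart_family n A) : Hilb P X ->
  forall d, (size a <= d)%N -> free_quotient (hf d a) (Grass_map t (section_ideal E X (d := d))).
Proof.
move=> [clX flX hpX]; have idX := clX.1.
have [K [g [gsurj gunit res ker]]] := residue_exists hQ.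
have hK := hinf (g \o t).
pose I : gfamily n A := section_ideal E X; pose IL : gfamily n L := fun d => Grass_map t (@I d).
pose Xk := base_change (g \o t) X; pose Ik : gfamily n K := section_ideal E Xk.
have gI : graded_ideal E I by exact: section_graded.
have gIL : graded_ideal E IL by exact: Grass_map_graded.
have idXk i : is_ideal (Xk i) by exact: ideal_gen_ideal.
have gIk : graded_ideal E Ik by exact: section_graded.
have sIL : saturated E IL by apply: Grass_map_saturated => //; exact: section_saturated.
have sIk : saturated E Ik by exact: section_saturated.
pose Img : gfamily n K := fun d => Grass_map g (@IL d).
have gImg : graded_ideal E Img by exact: Grass_map_graded.
have eXk : Xk = chart E Img 0.
  rewrite /Xk (_ : X = chart E I 0); last first.
    apply: funext => i; apply: funext => h; apply: propext; symmetry; exact: chart_section.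
  rewrite (chart_base_change hE) //; congr (chart E _ 0).
  by apply: functional_extensionality_dep => d; rewrite /Img /IL Grass_map_comp.
have hm d : maps g (@IL d) (@Ik d).
  move=> v hv; rewrite /Ik eXk; apply: section_chart_sub => //.
  exact: Grass_map_sub.
have hImg d u : Img d u -> Ik d u.
  by move=> h; rewrite /Ik eXk; apply: section_chart_sub.
have [d0 hd0] := proj1 (hilbert_cod hE P idXk) (hpX K (g \o t) res).
have cod_large d : (maxn d0 (size a) <= d)%N -> cod (@Ik d) = hf d a.
  move=> hd; have h1 : (d0 <= d)%N by lia.
  have := hd0 d h1; rewrite hP; last by lia.
  by move=> /eqP; rewrite Num.Theory.eqr_nat => /eqP.
have reg := gotzmann_regularity hE hK sa gIk sIk cod_large.
have [k hk] : exists k, forall w : 'rV_('C(n + size a, n)), (w <= spmx (@Ik (size a)))%MS -> satn E Img k w.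
  have /fin_all_exists[k hk] i : exists k, satn E Img k (row i (spmx (@Ik (size a)))).
    have : Ik _ (row i (spmx (@Ik (size a)))) by apply/spmxP; [case: gIk|exact: row_sub].
    by rewrite {1}/Ik eXk => /(section_chart_sat hE gImg).
  exists (\max_i k i)%N => w /submxP[c ->]; apply: submod_mulmx; first exact: satn_submod.
  by move=> i; apply: satn_leq (hk i) => //; exact: leq_bigmax.
have [e ze he] := satn_bound hE hK gImg sa hk (leqnn _) (eq_leq (reg _ (leqnn _))).
have onto_large d : (e <= d)%N -> onto g (@IL d) (@Ik d).
  move=> hd u hu; apply: (Grass_map_onto gsurj); first exact: (proj1 gIL).
  move: u hu; apply: (@cod_sub _ _ (@Img d) (@Ik d)); [exact: (proj1 gImg d)|exact: (proj1 gIk d)|exact: hImg|].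
  rewrite reg; last exact: leq_trans hd.
  exact: (macaulay_family hE hK gImg sa ze hd he).
have fl d : flat_pair g (@IL d) (@Ik d) by exact: flat_section_local.
move=> d zd; apply: (local_free gsurj gunit (proj1 gIL d) (proj1 gIk d)); last exact: reg.
  apply: (local_descent gsurj gunit hE hK (d0 := maxn e (size a)) sa gIL gIk sIL sIk hm fl) => // d' hd'.
    by apply: reg; lia.
  by apply: onto_large; lia.
exact: flat_indep.
Qed.

(** Modulo I_d, v is a combination of a basis F of the free quotient. On the fibre the saturation
    adds nothing in degree d, so F is independent modulo it. Flatness lifts this to the local ring,
    and the combination is zero. *)
Lemma sat_local (I : gfamily n A) : graded_ideal E I ->
  (forall d, (size a <= d)%N -> locally_split (hf d a) (@I d)) ->
  forall d v, (size a <= d)%N -> sat E I v -> Grass_map t (@I d) (map_mx t v).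
Proof.
move=> gI hsp d v zd [k hk].
have [K [g [gsurj gunit res ker]]] := residue_exists hQ; have hK := hinf (g \o t).
pose IL : gfamily n L := fun d => Grass_map t (@I d).
pose Ik : gfamily n K := fun d => Grass_map g (@IL d).
have gIL : graded_ideal E IL by exact: Grass_map_graded.
have gIk : graded_ideal E Ik by exact: Grass_map_graded.
have fr e : (size a <= e)%N -> free_quotient (hf e a) (@IL e).
  by move=> /hsp; apply: split_loc_free; case: gI.
have hm e : maps g (@IL e) (@Ik e) by move=> u hu; exact: Grass_map_sub.
have ho e : onto g (@IL e) (@Ik e) by apply: (Grass_map_onto gsurj); case: gIL.
have cd e : (size a <= e)%N -> cod (@Ik e) = hf e a.
  by move=> /fr h; apply: free_cod; exact: free_base_change.
have fl e : (size a <= e)%N -> flat_pair g (@IL e) (@Ik e).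
  by move=> /fr; apply: free_flat.
have fls := sat_flat gIL fl.
have hs : sat E IL (map_mx t v).
  by exists k; apply: satn_map_mx hk => e u hu; exact: Grass_map_sub.
have [C [F [hFC hC]]] := fr d zd.
have h1 w : IL d (w - w *m C *m F) by apply/hC; rewrite mulmxBl -!mulmxA hFC mulmx1 subrr.
apply/hC; apply: (flat_indep gsurj gunit (fls d) (F := F)) => [u|].
  move=> /(sat_large hE hK gIk sa cd zd zd)/(free_ker gsurj (hm d) (@ho d) hFC hC).
  by rewrite -mulmxA -map_mxM hFC map_mx1 mulmx1.
have := submodB ((sat_graded hE gIL).1 d) hs (sat_sub E (h1 (map_mx t v))).
by rewrite subKr.
Qed.

End AtPrime.

Theorem hilb_split (X : chart_family n A) : Hilb P X ->
  forall d, (size a <= d)%N -> locally_split (hf d a) (section_ideal E X (d := d)).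
Proof.
move=> hX d zd; apply: split_of_free => // [|Q hQ]; last exact: hilb_free_local.
by case: hX => -[idX _] _ _; case: (section_graded hE idX).
Qed.

Section FromIdeal.
Context (I : gfamily n A) (gI : graded_ideal E I).
Hypothesis hsp : forall d, (size a <= d)%N -> locally_split (hf d a) (@I d).

Lemma section_chart d (v : 'rV[A]_('C(n + d, n))) : (size a <= d)%N ->
  section_ideal E (chart E I (size a)) v <-> @I d v.
Proof.
move=> zd; split=> [/(section_chart_sat hE gI) hs|]; last exact: section_chart_sub.
apply: (local_global nA) => [|Q hQ]; first by case: gI.
have sI := proj1 gI d.
by apply/(Grass_map_loc_mx hQ sI); apply: sat_local.
Qed.

Theorem chart_hilb : Hilb P (chart E I (size a)).
Proof.
split=> [|i|K g res].
- exact: chart_closed.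
- by apply: chart_flat => // d /hsp; exists (hf d a).
rewrite (chart_base_change hE) //.
pose J : gfamily n K := fun d => Grass_map g (@I d).
have gJ : graded_ideal E J by exact: Grass_map_graded.
have hK := hinf g.
have cd d : (size a <= d)%N -> cod (@J d) = hf d a.
  by move=> zd; apply: field_split; [case: gJ|apply: split_base_change; exact: hsp].
apply/(hilbert_cod hE) => [i|]; first exact: chart_ideal.
exists (size a) => d zd; rewrite hP // -cd //; congr (_%:R); apply: cod_ext => v.
split=> [|/(section_chart_sat hE gJ)]; first exact: section_chart_sub.
exact: (sat_large hE hK gJ sa cd zd zd).
Qed.

End FromIdeal.

End HilbertFunctor.

Lemma exists_monomial_basis n d : exists e : 'I_('C(n + d, n)) -> 'X_{1..n.+1}, monomial_basis d e.
Proof.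
pose s := [seq s2m t | t : d.-tuple 'I_n.+1 <- enum (mpoly.basis n.+1 d)].
have sz : size s = 'C(n + d, n).
  by rewrite mpoly.size_basis -(bin_sub (leq_addr d n)) addKn addnC.
exists (fun k => nth 0%MM s k); split.
  move=> i j /eqP; rewrite nth_uniq ?sz ?ltn_ord //; last exact: mpoly.uniq_basis.
  by move/eqP/val_inj.
move=> m; split=> [/eqP|[k <-]]; last by apply/eqP; rewrite mpoly.basis_cover mem_nth ?sz.
rewrite mpoly.basis_cover => hm; have lt : (index m s < 'C(n + d, n))%N by rewrite -sz index_mem.
by exists (Ordinal lt); rewrite nth_index.
Qed.

(** The theorem prescribes the basis in degree r; in the other degrees any choice will do. *)
Lemma exists_monomial_bases n r (e : 'I_('C(n + r, n)) -> 'X_{1..n.+1}) : monomial_basis r e ->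
  exists E : forall d, 'I_('C(n + d, n)) -> 'X_{1..n.+1},
    (forall d, monomial_basis d (@E d)) /\ E r = e.
Proof.
move=> he; have [E hE] : {E : forall d, 'I_('C(n + d, n)) -> 'X_{1..n.+1} | forall d, monomial_basis d (@E d)}.
  by exists (fun d => projT1 (cid (exists_monomial_basis n d))) => d; case: cid.
pose F d : 'I_('C(n + d, n)) -> 'X_{1..n.+1} :=
  if r =P d is ReflectT h then eq_rect r (fun d => 'I_('C(n + d, n)) -> 'X_{1..n.+1}) e d h
  else E d.
exists F; split=> [d|].
  by rewrite /F; case: eqP => [h|_] //; subst d.
by rewrite /F; case: eqP => // h; rewrite (eq_axiomK h).
Qed.

(** A positive integer is invertible in k, hence in every field that receives a map from a
    k-algebra. *)
Lemma char0_natr_inj (k : fieldType) : [pchar k] =i pred0 ->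
  forall (A : comAlgType k) (K : fieldType) (g : {rmorphism A -> K}),
  injective (fun i : nat => i%:R : K).
Proof.
move=> /pcharf0P hk A K g.
have nz m : (0 < m)%N -> m%:R != 0 :> K.
  move=> m0; apply/eqP => e; have c0 : m%:R != 0 :> k by rewrite hk -lt0n.
  have := congr1 g (erefl (1 : A)); rewrite -{1}(scale1r (1 : A)) -(mulVf c0).
  rewrite -scalerA scaler_nat -[1 *+ m](mulr_natl 1) mulr1 -mulr_algl rmorphM rmorph_nat e.
  by rewrite mulr0 rmorph1 => /eqP; rewrite eq_sym oner_eq0.
move=> i j /= e; apply/eqP; rewrite eqn_leq; apply/andP; split; rewrite leqNgt; apply/negP => lt.
  have := nz (i - j)%N; rewrite subn_gt0 natrB ?e ?subrr ?eqxx; last exact: ltnW.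
  by move=> /(_ lt).
have := nz (j - i)%N; rewrite subn_gt0 natrB ?e ?subrr ?eqxx; last exact: ltnW.
by move=> /(_ lt).
Qed.

Lemma in_span_submod (R : comNzRingType) N (T : 'rV[R]_N -> Prop) : is_submod (in_span T).
Proof.
split=> [|_ _ [m [U [G [hG ->]]]] [m' [U' [G' [hG' ->]]]]|c _ [m [U [G [hG ->]]]]].
- by exists 0%N, 0, 0; split=> [[]//|]; rewrite mul0mx.
- exists (m + m')%N, (row_mx U U'), (col_mx G G'); split; last by rewrite mul_row_col.
  by move=> i; case: (split_ordP i) => j ->; rewrite ?rowKu ?rowKd.
- by exists m, (c *: U), G; split=> //; rewrite -scalemxAl.
Qed.

Lemma split_minors (A : comNzRingType) (nA : noetherian A) p N (W : 'rV[A]_N -> Prop) :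
  is_submod W -> locally_split p W -> minors_vanish (N - p).+1 W.
Proof.
move=> sW sp w M hw.
apply: (local_global nA (V := A^o) (W := fun x => x = 0)).
  by split=> // [x y -> ->|a x ->]; rewrite ?addr0 ?scaler0.
move=> Q hQ; have fr := split_loc_free hQ sW sp.
have lt : (N < (N - p).+1 + p)%N by lia.
have := free_minors fr lt (w := map_mx (to_loc (zero_datum hQ)) w) (map_mx (to_loc _) M).
rewrite -map_mxM det_map_mx => h; apply: (loc_eq0 (hP := hQ)); apply: h => i.
by rewrite -map_row; apply: Grass_map_sub.
Qed.

Lemma minors_map (B K : comNzRingType) (g : {rmorphism B -> K}) q N (W : 'rV[B]_N -> Prop) :
  (forall x, exists b, g b = x) -> is_submod W ->
  minors_vanish q W -> minors_vanish q (Grass_map g W).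
Proof.
move=> gsurj sW hW w M hw.
have /fin_all_exists2[v hv ev] i : exists2 v, W v & map_mx g v = row i w.
  exact: Grass_map_onto.
have [h hh] := choice gsurj.
have -> : w = map_mx g (\matrix_i v i) by apply/row_matrixP => i; rewrite -map_row rowK ev.
have -> : M = map_mx g (map_mx h M) by apply/matrixP => i j; rewrite !mxE hh.
rewrite -map_mxM det_map_mx hW ?rmorph0 // => i; by rewrite rowK.
Qed.

(** C has full column rank on the special fibre, so p of its rows form an invertible matrix;
    dividing by it normalizes the coordinates. *)
Lemma local_chart (B : comNzRingType) (K : fieldType) (g : {rmorphism B -> K}) p N
    (W : 'rV[B]_N -> Prop) : (forall x, exists b, g b = x) ->
  (forall b, g b != 0 -> exists b', b * b' = 1) -> free_quotient p W ->
  exists sigma (C : 'M[B]_(N, p)), Grass_chart sigma C W.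
Proof.
move=> gsurj gunit [C [F [hFC hC]]].
have full : row_full (map_mx g C).
  by apply/row_fullP; exists (map_mx g F); rewrite -map_mxM hFC map_mx1.
pose sigma := fullrankfun full; have := fullrowsub_unit full.
rewrite -/sigma -map_mxsub => /(local_inv gunit)[U [hU1 hU2]].
exists sigma, (C *m U); split; first by rewrite -mul_rowsub_mx.
move=> v; rewrite hC mulmxA; split=> [->|e]; first by rewrite mul0mx.
by rewrite -[v *m C]mulmx1 -hU1 mulmxA e mul0mx.
Qed.

(** * Equations of the Hilbert scheme *)

Section Equations.
Context (k : fieldType) (n : nat) (E : forall d, 'I_('C(n + d, n)) -> 'X_{1..n.+1}).
Context (a : seq nat) (p : nat).
Local Notation r := (size a).
Local Notation N := ('C(n + r, n)).
Local Notation Ru := {mpoly k[N * p]}.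

Definition generic_coord : 'M[Ru]_(N, p) := \matrix_(i, j) 'X_(mxvec_index i j).

(* On the chart of sigma, the submodule with coordinates C is the row space
   of this matrix. *)
Definition relation_mx (R : comNzRingType) (sigma : 'I_p -> 'I_N) (C : 'M[R]_(N, p)) : 'M[R]_N :=
  1%:M - C *m rowsub sigma 1%:M.

Definition generic_submod (sigma : 'I_p -> 'I_N) (v : 'rV[Ru]_N) : Prop :=
  exists w, v = w *m relation_mx sigma generic_coord.

(* The condition that S_(d-r) L has codimension at least P(d) in S_d for all
   d >= r. The opposite inequality holds everywhere by Macaulay's theorem. *)
Definition hilb_equations : Grass_ideals k N p := fun sigma =>
  ideal_gen (fun F => exists d (w : 'M[Ru]_(('C(n + d, n) - hf d a).+1, 'C(n + d, n))) f,
    [/\ (r <= d)%N, forall i, gen_ideal E (generic_submod sigma) (row i w)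
      & F = \det (colsub f w)]).

Definition coord_eval (A : comAlgType k) (C : 'M[A]_(N, p)) : Ru -> A :=
  mmap (fun c : k => c%:A) (fun x => mxvec C 0 x).

Lemma coord_eval_morph (A : comAlgType k) (C : 'M[A]_(N, p)) :
  exists f : {rmorphism Ru -> A}, f =1 coord_eval C.
Proof. by exists (mmap (in_alg A) (fun x => mxvec C 0 x)). Qed.

(** The rows of the relation matrix generate L and come from the polynomial ring, so the minors of
    generators over A are values of the equations. The resulting condition mentions only L, which is
    why the equations agree on overlaps of charts. *)
Lemma satisfies_equations (A : comAlgType k) sigma (C : 'M[A]_(N, p)) L :
  Grass_chart sigma C L ->
  satisfies (hilb_equations sigma) C <->
  forall d, (r <= d)%N -> minors_vanish ('C(n + d, n) - hf d a).+1 (gen_ideal E L (d := d)).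
Proof.
move=> [hs hL]; have [f ef] := coord_eval_morph C.
have eC : map_mx f generic_coord = C.
  apply/matrixP => i j; rewrite !mxE ef.
  transitivity (mmap (in_alg A) (fun x => mxvec C 0 x) 'X_(mxvec_index i j)); first by [].
  by rewrite mmapX mmap1U mxvecE.
have eS : map_mx f (relation_mx sigma generic_coord) = relation_mx sigma C.
  by rewrite map_mxB map_mx1 map_mxM eC map_mxsub map_mx1.
have SC : relation_mx sigma C *m C = 0.
  by rewrite mulmxBl mul1mx -mulmxA mul_rowsub_mx mul1mx hs mulmx1 subrr.
have mapL v : generic_submod sigma v -> L (map_mx f v).
  by move=> [w ->]; apply/hL; rewrite map_mxM eS -mulmxA SC mulmx0.
split=> [sat d rd|h F hF].
  apply: (minors_span (T := fun v => exists2 u, gen_ideal E (generic_submod sigma) u & v = map_mx f u)).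
    apply: (gen_min (I := fun d => in_span (fun v => exists2 u : 'rV[Ru]_('C(n + d, n)),
       gen_ideal E (generic_submod sigma) u & v = map_mx f u))).
      split=> [d'|d' i _ [m [U [G [hG ->]]]]]; first exact: in_span_submod.
      exists m, U, (G *m mult_mx E A i d'); rewrite mulmxA; split=> // j.
      rewrite row_mul; have [u hu ->] := hG j; exists (u *m mult_mx E _ i d'); first exact: gen_mult.
      by rewrite map_mxM mult_mx_map.
    move=> v /hL hv; exists N, v, (relation_mx sigma C); split.
      move=> i; exists (row i (relation_mx sigma generic_coord)); last by rewrite map_row eS.
      by apply: gen_base; exists (delta_mx 0 i); rewrite rowE.
    by rewrite mulmxBr mulmx1 mulmxA hv mul0mx subr0.
  move=> w f' hw; have /fin_all_exists2[u hu eu] := hw.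
  have -> : colsub f' w = map_mx f (colsub f' (\matrix_i u i)).
    apply/matrixP => i j; rewrite !mxE; have := congr1 (fun M : 'rV[A]__ => M 0 (f' j)) (eu i).
    by rewrite !mxE.
  rewrite det_map_mx ef; apply: sat; apply: ideal_gen_sub.
  by exists d, (\matrix_i u i), f'; split=> // i; rewrite rowK.
rewrite -[LHS]/(coord_eval C F) -ef; apply: (hF (fun F => f F = 0)).
  by split=> [|x y hx hy|c x hx]; rewrite ?rmorph0 ?rmorphD ?hx ?hy ?addr0 // rmorphM hx mulr0.
move=> _ [d [w [f' [rd hw ->]]]]; rewrite -det_map_mx map_mxsub.
have -> : colsub f' (map_mx f w) = map_mx f w *m colsub f' 1%:M.
  apply/matrixP => i j; rewrite !mxE (bigD1 (f' j)) //= !mxE eqxx mulr1 big1 ?addr0 // => l lf.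
  by rewrite !mxE (negbTE lf) mulr0.
apply: h => // i; rewrite -map_row; exact: gen_map (hw i).
Qed.

Lemma equations_closed : Grass_closed_subscheme hilb_equations.
Proof.
split=> [sigma|sigma tau A C D L _ hC hD]; first exact: ideal_gen_ideal.
have e1 := satisfies_equations hC; have e2 := satisfies_equations hD.
by split=> [/e1/e2|/e2/e1].
Qed.

End Equations.

(** * Comparison of the Hilbert functor with the points of the equations *)

Section Representability.
Context (k : fieldType) (hk : [pchar k] =i pred0) (n : nat).
Context (E : forall d, 'I_('C(n + d, n)) -> 'X_{1..n.+1}).
Hypothesis hE : forall d, monomial_basis d (@E d).
Context (P : {poly rat}) (a : seq nat) (sa : sorted geq a).
Hypothesis hP : forall t, (size a <= t)%N -> P.[t%:R] = (hf t a)%:R.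
Hypothesis hbound : forall d, (size a <= d)%N -> (hf d a <= 'C(n + d, n))%N.
Local Notation r := (size a).
Local Notation p := (hf (size a) a).
Local Notation hinf := (char0_natr_inj hk).

Lemma chart_of_hilb (A : comAlgType k) (X : chart_family n A) : Hilb P X ->
  X = chart E (section_ideal E X) r.
Proof.
move=> [clX _ _]; apply: funext => i; apply: funext => h; apply: propext.
by symmetry; apply: chart_section.
Qed.

Lemma hilb_graded (A : comAlgType k) (X : chart_family n A) : Hilb P X ->
  graded_ideal E (section_ideal E X).
Proof. by move=> [[idX _] _ _]; exact: section_graded. Qed.

(** Locally split graded pieces stay so under base change, and X is given by the charts of its
    section ideal. The charts of the new pieces thus form a family in the Hilbert functor with
    exactly these sections. *)
Lemma hilb_base_change (A B : comAlgType k) (g : {rmorphism A -> B}) (X : chart_family n A) :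
  noetherian A -> noetherian B -> Hilb P X ->
  Hilb P (base_change g X) /\
  forall d v, (r <= d)%N ->
    section_ideal E (base_change g X) (d := d) v <-> Grass_map g (section_ideal E X (d := d)) v.
Proof.
move=> nA nB hX; have gI := hilb_graded hX.
have hsp := hilb_split hE nA (@hinf A) sa hP hX.
have gJ := Grass_map_graded g gI.
have hsJ d : (r <= d)%N -> locally_split (hf d a) (Grass_map g (section_ideal E X (d := d))).
  by move=> rd; apply: split_base_change; exact: hsp.
have -> : base_change g X = chart E (fun d => Grass_map g (section_ideal E X (d := d))) r.
  by rewrite [X in base_change g X](chart_of_hilb hX); apply: chart_base_change.
split.
  exact: (chart_hilb hE nB (@hinf B) sa hP gJ hsJ).
by move=> d v rd; apply: (section_chart hE nB (@hinf B) sa gJ hsJ).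
Qed.

(** On a fibre, Macaulay bounds the codimension of the ideal generated in degree r by P(d), which is
    the codimension of I_d; so the two agree there, and Nakayama lifts the equality to the local
    rings. *)
Lemma generated_in_degree (A : comAlgType k) (nA : noetherian A) (I : gfamily n A) :
  graded_ideal E I -> (forall d, (r <= d)%N -> locally_split (hf d a) (@I d)) ->
  forall d v, (r <= d)%N -> I d v -> gen_ideal E (@I r) v.
Proof.
move=> gI hsp d v rd hv.
have gG : graded_ideal E (gen_ideal E (@I r)) by exact: gen_graded.
apply: (local_global nA) => [|Q hQ]; first by case: gG.
have sG := proj1 gG d; apply/(Grass_map_loc_mx hQ sG).
have [K [g [gsurj gunit res ker]]] := residue_exists hQ.
pose t := to_loc (zero_datum hQ); have hK := @hinf A K (g \o t).
pose IL : gfamily n _ := fun d => Grass_map t (@I d).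
pose Ik : gfamily n K := fun d => Grass_map g (@IL d).
have gIL : graded_ideal E IL by exact: Grass_map_graded.
have gIk : graded_ideal E Ik by exact: Grass_map_graded.
have fr e : (r <= e)%N -> free_quotient (hf e a) (@IL e).
  by move=> /hsp; apply: split_loc_free; case: gI.
have cd e : (r <= e)%N -> cod (@Ik e) = hf e a.
  by move=> /fr h; apply: free_cod; exact: free_base_change.
have gGk := gen_graded E (@Ik r).
have subG e u : gen_ideal E (@Ik r) u -> Ik e u by apply: gen_min.
have genk u : Ik d u -> gen_ideal E (@Ik r) u.
  move: u; apply: cod_sub; [exact: (proj1 gGk d)|exact: (proj1 gIk d)|exact: subG|].
  rewrite cd //; apply: (macaulay_family hE hK gGk sa (leqnn _) rd).
  rewrite -cd //; apply: cod_le; [exact: (proj1 gIk)|exact: (proj1 gGk)|].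
  by move=> u; exact: gen_base.
apply: (nakayama_eq gsurj gunit (W := @IL d) (Wk := @Ik d) (Grass_map_submod t _) _
  (proj1 gIL d) _ (proj1 gIk d) _ (fr d rd)).
- move=> w; apply: (Grass_map_ind (W' := @IL d)); first exact: (proj1 gIL d).
  by move=> u /(gen_min gI (fun v h => h)) hu; exact: Grass_map_sub.
- by move=> w hw; exact: Grass_map_sub.
- move=> w /genk hw; apply: (Grass_map_onto gsurj); first exact: Grass_map_submod.
  rewrite (_ : Grass_map t _ = gen_ideal E (@IL r) (d := d)).
    by apply/gen_base_change.
  by apply: funext => u; apply: propext; exact: gen_base_change.
- exact: Grass_map_sub.
Qed.

Lemma hilb_points (A : comAlgType k) (X : chart_family n A) : noetherian A -> Hilb P X ->
  Grass_points (@hilb_equations k n E a p) (section_ideal E X (d := r)).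
Proof.
move=> nA hX; have gI := hilb_graded hX.
have hsp := hilb_split hE nA (@hinf A) sa hP hX.
split; first by split; [case: gI|apply: split_locally_free; exact: hsp].
move=> B g nB sigma C hC; apply/(@satisfies_equations k n E a p _ _ _ _ hC) => d rd.
have [hXB eB] := hilb_base_change g nA nB hX.
have gIB := hilb_graded hXB.
apply: (minors_sub (W' := section_ideal E (base_change g X) (d := d))).
  by apply: gen_min => // v hv; apply/eB.
apply: split_minors => //; first by case: gIB.
exact: (hilb_split hE nB (@hinf B) sa hP hXB).
Qed.

Lemma hilb_determined (A : comAlgType k) (X Y : chart_family n A) : noetherian A ->
  Hilb P X -> Hilb P Y ->
  same_elts (section_ideal E X (d := r)) (section_ideal E Y (d := r)) ->
  forall i, same_elts (X i) (Y i).
Proof.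
move=> nA hX hY e; suff H (X' Y' : chart_family n A) : Hilb P X' -> Hilb P Y' ->
    same_elts (section_ideal E X' (d := r)) (section_ideal E Y' (d := r)) ->
    forall i h, X' i h -> Y' i h.
  by move=> i h; split; apply: H => // v; split => /e.
move=> {X Y} {}hX {}hY {}e i h.
rewrite {1}(chart_of_hilb hX) {1}(chart_of_hilb hY) => -[d [rd [v hv ->]]].
exists d; split=> //; exists v => //.
apply: (gen_min (hilb_graded hY) (L := section_ideal E X' (d := r))) => [u /e //|].
apply: (generated_in_degree nA (hilb_graded hX)) rd hv.
exact: (hilb_split hE nA (@hinf A) sa hP hX).
Qed.

Lemma points_hilb (A : comAlgType k) (L : 'rV[A]_('C(n + r, n)) -> Prop) : noetherian A ->
  Grass_points (@hilb_equations k n E a p) L ->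
  exists2 X : chart_family n A, Hilb P X & same_elts (section_ideal E X (d := r)) L.
Proof.
move=> nA [[sL lfL] hL]; pose I : gfamily n A := gen_ideal E L.
have gI : graded_ideal E I by exact: gen_graded.
suff hsp d : (r <= d)%N -> locally_split (hf d a) (@I d).
  exists (chart E I r); first exact: (chart_hilb hE nA (@hinf A) sa hP gI hsp).
  move=> v; rewrite (section_chart hE nA (@hinf A) sa gI hsp) //.
  by split=> [/gen_degree|/gen_base]; apply.
move=> rd; apply: split_of_free => // [|Q hQ]; first by case: gI.
have [K [g [gsurj gunit res ker]]] := residue_exists hQ.
pose t := to_loc (zero_datum hQ); have hK := @hinf A K (g \o t).
have frL : free_quotient p (Grass_map t L) by apply: free_of_locally_free.
have [sigma [C hC]] := local_chart gsurj gunit frL.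
have nB : noetherian (localized_alg (zero_datum hQ)) by exact: localized_noetherian.
pose Bk : comAlgType k := localized_alg (zero_datum hQ).
(* The condition on points is used for the local ring of A at Q, where L has coordinates in a single
   chart. *)
have /(@satisfies_equations k n E a p Bk sigma C (Grass_map t L) hC) minors :=
  hL Bk (@to_loc_alg k A (zero_datum hQ)) nB sigma C hC.
have eG e : Grass_map t (@I e) = gen_ideal E (Grass_map t L) (d := e).
  by apply: funext => u; apply: propext; exact: gen_base_change.
have hW : minors_vanish ('C(n + d, n) - hf d a).+1 (Grass_map t (@I d)).
  by rewrite eG; exact: minors.
have sW := Grass_map_submod t (@I d); have sWk := Grass_map_submod g (Grass_map t (@I d)).
apply: (minors_free gsurj gunit sW sWk) => //; last exact: hbound.
  by move=> u hu; apply: Grass_map_onto.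
(* On the fibre the minors bound the codimension from below, and Macaulay's theorem, started from
   codimension p in degree r, bounds it from above. *)
apply/eqP; rewrite eqn_leq; apply/andP; split; last first.
  by apply: rank_minors; [|apply: minors_map|exact: hbound].
have gGk := gen_graded E (Grass_map g (Grass_map t L)).
rewrite (_ : Grass_map g _ = gen_ideal E (Grass_map g (Grass_map t L)) (d := d)); last first.
  by rewrite eG; apply: funext => u; apply: propext; exact: gen_base_change.
apply: (macaulay_family hE hK gGk sa (leqnn _) rd).
rewrite -[X in (_ <= X)%N](free_cod (free_base_change g frL)).
apply: cod_le; [exact: Grass_map_submod|exact: (proj1 gGk)|].
by move=> u; exact: gen_base.
Qed.

End Representability.

Theorem theorem4p9 (k : fieldType) (hk : [pchar k] =i pred0) (n : nat)
    (P : {poly rat})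
    (hP : exists2 X : chart_family n k,
            closed_subscheme X & hilbert_polynomial X P)
    (r : nat) (hr : gotzmann_number P r)
    (p : nat) (hp : P.[r%:R] = p%:R)
    (e : 'I_('C(n + r, n)) -> 'X_{1..n.+1}) (he : monomial_basis r e) :
  exists2 Z : Grass_ideals k 'C(n + r, n) p,
    Grass_closed_subscheme Z & Hilb_iso_points P r e Z.
Proof.
have [a [sa za ha]] : exists a : seq nat, [/\ sorted geq a, size a = r &
    forall t, (r <= t)%N -> P.[t%:R] = (hf t a)%:R].
  have [a sa eP] := hr; exists a; split; [exact: sa|exact: size_tuple|exact: gotzmann_hf].
clear hr; subst r.
have ep : p = hf (size a) a.
  by apply/eqP; rewrite -(Num.Theory.eqr_nat rat) -hp ha.
subst p.
have [E [hE eE]] := exists_monomial_bases he; subst e.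
have hK : injective (fun i : nat => i%:R : k) by exact: (char0_natr_inj hk (A := k^o) idfun).
(* By regularity [hf d a] is a codimension in S_d for the given subscheme of projective space over
   k. The bound ensures that the subtraction in the size of the minors is not truncated. *)
have hbound d : (size a <= d)%N -> (hf d a <= 'C(n + d, n))%N.
  move=> zd; have [X [idX glue] hX] := hP.
  have gI := section_graded hE idX; have sI := @section_saturated n E hE k X.
  have [d0 hd0] := proj1 (hilbert_cod hE P idX) hX.
  rewrite -(gotzmann_regularity hE hK sa gI sI (d0 := maxn d0 (size a)) _ zd).
    exact: leq_subr.
  move=> t ht; have h1 : (d0 <= t)%N by lia.
  have := hd0 t h1; rewrite ha; last by lia.
  by move=> /eqP; rewrite Num.Theory.eqr_nat => /eqP.
exists (@hilb_equations k n E a (hf (size a) a)); first exact: equations_closed.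
split=> [A nA|A B g nA nB X hX].
  split=> [X|X Y hX hY|L].
  - exact: hilb_points.
  - exact: (@hilb_determined k hk n E hE P a sa ha A X Y nA hX hY).
  - move=> hL; have [X hX eX] := points_hilb hk hE sa ha hbound nA hL.
    by exists X.
have [h1 h2] := hilb_base_change hk hE sa ha g nA nB hX.
by split=> // v; apply: h2.
Qed.
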